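(* Let $f,g\in M^1_{\nu_2}(\mathbb{R}^d)$. Then the map $\operatorname{GL}_{2d}(\mathbb{R})\to\mathbb{R}$, $L\mapsto\|\overline{\pi}_L({}_L\langle f,g\rangle)\|$, is locally $\frac12$-Hölder continuous. In particular, the map $L\mapsto\|f\|_{\mathcal{E}_L(\mathbb{R}^d)}=\|\overline{\pi}_L({}_L\langle f,f\rangle)\|^{1/2}$ is locally $\frac12$-Hölder continuous.
   Context: Fix $d\ge1$. For $z=(x,\omega)\in\mathbb{R}^{2d}$, $(\pi(z)f)(t)=e^{2\pi i\,t\cdot\omega}f(t-x)$ on $L^2(\mathbb{R}^d)$, and $\mathcal{V}_gf(z)=\langle f,\pi(z)g\rangle_2$. Put $\phi(t)=e^{-\pi\|t\|^2}$, $\nu_s(z)=(1+\sum_i|z_i|)^s$, and $M^1_{\nu_s}(\mathbb{R}^d)=\{f\in L^2(\mathbb{R}^d):\mathcal{V}_\phi f\cdot\nu_s\in L^1(\mathbb{R}^{2d})\}$. For $f,g\in M^1_{\nu_2}(\mathbb{R}^d)$ and $L\in\operatorname{GL}_{2d}(\mathbb{R})$, ${}_L\langle f,g\rangle\in\ell^1(\mathbb{Z}^{2d})$ is the sequence $k\mapsto\langle f,\pi(Lk)g\rangle_2$; for $\mathbf{a}\in\ell^1(\mathbb{Z}^{2d})$, $\overline{\pi}_L(\mathbf{a})=\sum_ka(k)\pi(Lk)$, a bounded operator on $L^2(\mathbb{R}^d)$, and $\|\cdot\|$ is the operator norm. $\|f\|_{\mathcal{E}_L(\mathbb{R}^d)}$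 is the Heisenberg module norm, i.e. the infimum of $C^{1/2}$ over all $C>0$ with $\sum_k|\langle h,\pi(Lk)f\rangle|^2\le C\|h\|_2^2$ for all $h\in L^2(\mathbb{R}^d)$. $\operatorname{GL}_{2d}(\mathbb{R})$ is considered as a subset of the normed space of real $2d\times2d$ matrices (operator norm). A map $F$ between (subsets of) normed spaces is $\alpha$-Hölder if $\|F(x_1)-F(x_2)\|\le C\|x_1-x_2\|^\alpha$ for some $C>0$ and all $x_1,x_2$; it is locally $\alpha$-Hölder if every point has a neighborhood on which $F$ is $\alpha$-Hölder. *)

(* Defs.v *)
From HB Require Import structures.
From mathcomp Require Import all_boot all_order all_algebra finmap.
From mathcomp Require Import complex.
From mathcomp Require Import all_classical all_reals all_analysis.
From mathcomp.analysis.showcase Require summability.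

Set Implicit Arguments.
Unset Strict Implicit.
Unset Printing Implicit Defensive.
Import Order.TTheory GRing.Theory Num.Theory.
Import numFieldNormedType.Exports.

Local Open Scope classical_set_scope.
Local Open Scope ring_scope.

(* The product sigma-algebra on column vectors, exactly as the library equips
   [n.-tuple T]. *)
Definition measure_cV_display : measure_display -> measure_display.
Proof. exact. Qed.

Section measurable_cV.
Context {d} {T : sigmaRingType d}.
Variable n : nat.

Let coors : 'I_n -> 'cV[T]_n -> T := fun i x => x i ord0.

Let cV_set0 : g_sigma_preimage coors set0.
Proof. exact: sigma_algebra0. Qed.

Let cV_setC A : g_sigma_preimage coors A -> g_sigma_preimage coors (~` A).
Proof. exact: sigma_algebraC. Qed.

Let cV_bigcup (F : _^nat) : (forall i, g_sigma_preimage coors (F i)) ->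
  g_sigma_preimage coors (\bigcup_i (F i)).
Proof. exact: sigma_algebra_bigcup. Qed.

HB.instance Definition _ := @isMeasurable.Build (measure_cV_display d)
  'cV[T]_n (g_sigma_preimage coors) cV_set0 cV_setC cV_bigcup.

End measurable_cV.

Lemma measurable_coord_cV d (T : sigmaRingType d) n (i : 'I_n) :
  measurable_fun [set: 'cV[T]_n] (fun x : 'cV[T]_n => x i ord0).
Proof.
move=> _ Y mY; rewrite setTI; apply: sub_sigma_algebra => /=.
rewrite -bigcup_seq/=; exists i => /=; first by rewrite mem_index_enum.
by exists Y => //; rewrite setTI.
Qed.

Lemma measurable_fun_cV d1 d2 (T1 : measurableType d1) (T2 : measurableType d2)
    n (f : T1 -> 'cV[T2]_n) :
  (forall i, measurable_fun [set: T1] (fun x => f x i ord0)) ->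
  measurable_fun [set: T1] f.
Proof.
move=> mf _ A mA; rewrite setTI; move: A mA.
suff : g_sigma_preimage (fun i (x : 'cV[T2]_n) => x i ord0) `<=`
       [set A | measurable (f @^-1` A)] by [].
apply: smallest_sub.
  split => /=.
  - by rewrite preimage_set0; exact: measurable0.
  - by move=> A mA; rewrite setTD -preimage_setC; exact: measurableC.
  - by move=> F mF; rewrite preimage_bigcup; exact: bigcupT_measurable.
move=> A; rewrite -bigcup_seq/= => -[i _ [B mB <-]] /=.
by rewrite setTI; have := mf i measurableT B mB; rewrite setTI.
Qed.

Section lebesgue_measure_cV.
Context {R : realType}.

Definition cV_cons n (p : R * 'cV[R]_n) : 'cV[R]_n.+1 :=
  \col_i oapp (fun j => p.2 j ord0) p.1 (unlift ord0 i).

Lemma cV_cons_surj n (v : 'cV[R]_n.+1) :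
  cV_cons (v ord0 ord0, \col_j v (lift ord0 j) ord0) = v.
Proof.
apply/colP => i; rewrite mxE.
by case: unliftP => [j|] -> //=; rewrite mxE.
Qed.

Lemma measurable_cV_cons n : measurable_fun [set: R * 'cV[R]_n] (@cV_cons n).
Proof.
apply: measurable_fun_cV => i.
under eq_fun do rewrite mxE.
case: unliftP => [j|] _ /=; last exact: measurable_fst.
apply: (@measurableT_comp _ _ _ _ _ _ (fun v : 'cV[R]_n => v j ord0)) => //.
exact: measurable_coord_cV.
Qed.

Lemma measurable_cV_uncons n : measurable_fun [set: 'cV[R]_n.+1]
  (fun v => (v ord0 ord0, \col_j v (lift ord0 j) ord0) : R * 'cV[R]_n).
Proof.
apply: measurable_fun_pair; first exact: measurable_coord_cV.
apply: measurable_fun_cV => j.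
under eq_fun do rewrite mxE.
exact: measurable_coord_cV.
Qed.

Section step.
Variables (n : nat) (m : {sigma_finite_measure set 'cV[R]_n -> \bar R}).

Definition leb_cons : set 'cV[R]_n.+1 -> \bar R :=
  pushforward (lebesgue_measure \x m)%E (@cV_cons n).

Let leb_cons0 : leb_cons set0 = 0%E.
Proof. by rewrite /leb_cons /pushforward preimage_set0 measure0. Qed.

Let leb_cons_ge0 A : (0 <= leb_cons A)%E.
Proof. by rewrite /leb_cons /pushforward; exact: measure_ge0. Qed.

Let leb_cons_sigma_additive : semi_sigma_additive leb_cons.
Proof.
have mcons (A : set 'cV[R]_n.+1) :
    measurable A -> measurable (@cV_cons n @^-1` A).
  by move=> mA; rewrite -[X in measurable X]setTI; exact: measurable_cV_cons.
move=> F mF tF mUF; rewrite /leb_cons /pushforward preimage_bigcup.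
apply: measure_semi_sigma_additive.
- by move=> k; exact: mcons.
- apply/trivIsetP => /= i j _ _ ij; rewrite -preimage_setI.
  by move/trivIsetP : tF => /(_ _ _ _ _ ij) ->//; rewrite preimage_set0.
- by rewrite -preimage_bigcup; exact: mcons.
Qed.

HB.instance Definition _ := isMeasure.Build _ _ _ leb_cons
  leb_cons0 leb_cons_ge0 leb_cons_sigma_additive.

Let product_sigma_finite : sigma_finite setT (lebesgue_measure \x m)%E.
Proof.
have /sigma_finiteP[F [TF ndF Foo]] := sigma_finiteT (@lebesgue_measure R).
have /sigma_finiteP[G [TG ndG Goo]] := sigma_finiteT m.
exists (fun k => F k `*` G k).
  rewrite -setXTT TF TG predeqE => -[x y]; split.
    move=> [/= [i _ Fix] [j _ Gjy]]; exists (maxn i j) => //; split.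
    - by move: x Fix; exact/subsetPset/ndF/leq_maxl.
    - by move: y Gjy; exact/subsetPset/ndG/leq_maxr.
  by move=> [i _ []/= ? ?]; split; exists i.
move=> k; have [? ?] := Foo k; have [? ?] := Goo k.
split; first exact: measurableX.
by rewrite product_measure1E// lte_mul_pinfty// ge0_fin_numE.
Qed.

Let leb_cons_sigma_finite : sigma_finite setT leb_cons.
Proof.
have [F FT Foo] := product_sigma_finite.
pose uncons (v : 'cV[R]_n.+1) : R * 'cV[R]_n :=
  (v ord0 ord0, \col_j v (lift ord0 j) ord0).
have consK : cancel (@cV_cons n) uncons.
  move=> [x v]; rewrite /uncons; congr pair; first by rewrite mxE unlift_none.
  by apply/colP => j; rewrite !mxE liftK.
exists (fun k => uncons @^-1` F k).
  by rewrite -preimage_bigcup -FT preimage_setT.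
move=> k; have [mF Fk] := Foo k; split.
  by rewrite -[X in measurable X]setTI; exact: measurable_cV_uncons.
rewrite /leb_cons /pushforward -comp_preimage.
by rewrite (_ : uncons \o _ = id) ?preimage_id//; exact/funext.
Qed.

HB.instance Definition _ := Measure_isSigmaFinite.Build _ _ _ leb_cons
  leb_cons_sigma_finite.

End step.

Fixpoint leb n : {sigma_finite_measure set 'cV[R]_n -> \bar R} :=
  match n with
  | 0%N => \d_(0 : 'cV[R]_0)
  | n'.+1 => leb_cons (leb n')
  end.

End lebesgue_measure_cV.

Section time_frequency.
Context {R : realType}.
Local Notation C := R[i].

Local Notation normc := (@ComplexField.Normc.normc R).

Section complex_functions.
Context {dsp : measure_display} {T : measurableType dsp}.
Variable mu : {measure set T -> \bar R}.

Definition cmeasurable (f : T -> C) : Prop :=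
  measurable_fun [set: T] (fun x => complex.Re (f x)) /\
  measurable_fun [set: T] (fun x => complex.Im (f x)).

Definition cLnorm (p : \bar R) (f : T -> C) : \bar R :=
  Lnorm mu p (fun x => (normc (f x))%:E).

(* Representatives of the elements of L^p: everything below is invariant under
   equality almost everywhere. *)
Definition cLp (p : \bar R) (f : T -> C) : Prop :=
  cmeasurable f /\ (cLnorm p f < +oo)%E.

Definition cintegral (f : T -> C) : C :=
  Complex (Rintegral mu [set: T] (fun x => complex.Re (f x)))
          (Rintegral mu [set: T] (fun x => complex.Im (f x))).

Definition cinner (f g : T -> C) : C := cintegral (fun x => f x * conjc (g x)).

End complex_functions.

Definition dotv n (x y : 'cV[R]_n) : R := \sum_(i < n) x i ord0 * y i ord0.

Definition enorm n (x : 'cV[R]_n) : R := Num.sqrt (dotv x x).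

Definition mxopnorm n (A : 'M[R]_n) : R :=
  inf [set c | 0 <= c /\ forall x : 'cV[R]_n, enorm (A *m x) <= c * enorm x].

Definition cexpi (theta : R) : C := Complex (cos theta) (sin theta).

Section dimension.
Variable d : nat.

Definition tfshift (z : 'cV[R]_(d + d)) (f : 'cV[R]_d -> C) : 'cV[R]_d -> C :=
  fun t => cexpi (2 * pi * dotv t (dsubmx z)) * f (t - usubmx z).

Definition L2norm (f : 'cV[R]_d -> C) : \bar R := cLnorm (leb d) 2%:E f.

Definition L2 (f : 'cV[R]_d -> C) : Prop := cLp (leb d) 2%:E f.

Definition stft (g f : 'cV[R]_d -> C) (z : 'cV[R]_(d + d)) : C :=
  cinner (leb d) f (tfshift z g).

Definition gaussian (t : 'cV[R]_d) : C := Complex (expR (- pi * enorm t ^+ 2)) 0.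

Definition weight (s : R) (z : 'cV[R]_(d + d)) : R :=
  (1 + \sum_(i < d + d) `|z i ord0|) `^ s.

Definition M1 (s : R) (f : 'cV[R]_d -> C) : Prop :=
  L2 f /\
  cLp (leb (d + d)) 1%:E (fun z => stft gaussian f z * Complex (weight s z) 0).

Definition lattice_pt (L : 'M[R]_(d + d)) (k : 'cV[int]_(d + d)) :
  'cV[R]_(d + d) := L *m map_mx intr k.

Definition module_inner (L : 'M[R]_(d + d)) (f g : 'cV[R]_d -> C)
  (k : 'cV[int]_(d + d)) : C := cinner (leb d) f (tfshift (lattice_pt L k) g).

Definition L2op := ('cV[R]_d -> C) -> ('cV[R]_d -> C).

Definition opnorm (T : L2op) : \bar R :=
  ereal_inf [set c%:E | c in [set c : R | 0 <= c /\
    forall h, L2 h -> (L2norm (T h) <= c%:E * L2norm h)%E]].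

Definition integrated_partial (L : 'M[R]_(d + d)) (a : 'cV[int]_(d + d) -> C)
    (F : {fset 'cV[int]_(d + d)}) : L2op :=
  fun h t => \sum_(k <- F) a k * tfshift (lattice_pt L k) h t.

(* [T] is the unconditional sum of the operators [a k * pi(L k)] in operator
   norm. *)
Definition is_integrated (L : 'M[R]_(d + d)) (a : 'cV[int]_(d + d) -> C)
    (T : L2op) : Prop :=
  (forall h, L2 h -> L2 (T h)) /\
  opnorm (fun h t => T h t - integrated_partial L a F h t)
    @[F --> summability.totally] --> 0%E.

(* Such a [T] exists when [a] is summable, and is unique up to equality almost
   everywhere of its values on L^2; the default value [0] is used only when the
   sum does not converge. *)
Definition integrated (L : 'M[R]_(d + d)) (a : 'cV[int]_(d + d) -> C) : L2op :=
  xget (fun _ _ => 0) (is_integrated L a).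

Definition heisenberg_norm (L : 'M[R]_(d + d)) (f : 'cV[R]_d -> C) : \bar R :=
  ereal_inf [set (Num.sqrt c)%:E | c in [set c : R | 0 < c /\
    forall h, L2 h ->
      (\esum_(k in [set: 'cV[int]_(d + d)])
          (normc (cinner (leb d) h (tfshift (lattice_pt L k) f)) ^+ 2)%:E
        <= c%:E * L2norm h ^+ 2)%E]].

End dimension.

(* Hoelder conditions for a map defined on a subset of a space [V] whose norm
   is [N].  As [+oo - +oo = -oo] in [\bar R], taking [x = y] shows that a map
   satisfying [holder_on] is real-valued on [A]. *)
Definition holder_on (V : zmodType) (N : V -> R) (A : set V) (alpha : R)
    (F : V -> \bar R) : Prop :=
  exists2 c, 0 < c & forall x y, A x -> A y ->
    (`|F x - F y| <= (c * N (x - y) `^ alpha)%:E)%E.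

Definition locally_holder (V : zmodType) (N : V -> R) (D : set V) (alpha : R)
    (F : V -> \bar R) : Prop :=
  forall x, D x -> exists2 r, 0 < r &
    holder_on N (D `&` [set y | N (y - x) < r]) alpha F.

Definition GL n : set 'M[R]_n := [set L | L \in unitmx].

End time_frequency.

(* Main.v *)
Require Import Defs.
From mathcomp Require Import all_boot all_order all_algebra finmap.
From mathcomp Require Import complex.
From mathcomp Require Import all_classical all_reals all_analysis.
From mathcomp Require Import measurable_realfun gauss_integral.
From mathcomp Require Import zify ring lra.

(** The norm of [integrated L a] can be read off from finitely supported sequences.
    Composing two time-frequency shifts of the lattice [L Z^n], with [n = 2d],
    produces a phase, and the resulting twisted convolution by [a] has the
    sesquilinear form [gram L a].  Let [gramnorm L a] be the least [M] for which
    this form is bounded by [M] times the norms of its arguments.  It equals the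
    operator norm ([opnorm_integrated]), for two reasons.  Testing the form on the
    orbit of a function, cut off to a large box, recovers the matrix coefficients of
    the operator up to the boundary of the box, so the operator norm is at most
    [gramnorm] ([gram_bound_op]).  Conversely, averaging the matrix coefficients of
    the operator over all characters of [Z^n] leaves the form; since [L] is
    invertible, each character is implemented by conjugation with a time-frequency
    shift and none increases the norm ([op_bound_gram]).  Moreover, when the
    coefficients are [module_inner L f f], the form is the inner product of two
    synthesised functions, so [gramnorm] is the optimal Bessel constant of the
    system, that is, the square of the module norm ([heisenberg_gramnorm]).

    It remains to compare the forms for two matrices at distance [e], and there are
    two things to change.

    With the coefficients fixed, only the phases change.  On a window of side [N]
    the two phases differ by a coboundary, up to an error of size [e * N] times the
    norm of the argument of the coefficient ([windowed_gram]).  Averaging over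
    all positions of the window costs a boundary term of size [1 / N].  With [N] of
    order [e^(-1/2)] both errors have order [e^(1/2)], at the price of a first
    moment of the coefficients ([gram_bound_lattice]).

    With the phases fixed, the coefficients change by [O(e)] in [l^1].  To see this,
    and the first moment above, the coefficients are expanded in Gaussians: by the
    orthogonality relations of the short-time Fourier transform ([moyal]) the number
    [<f, pi(w) h>] is the integral of [V f (z)] times the conjugate of [V h (z')]
    against an explicit Gaussian kernel in [w], [z] and [z']
    ([inner_tfshift_expansion]).  The increments of this kernel and its sums over
    the lattice grow at most quadratically in [z] and [z'] ([kernel_lipschitz],
    [weighted_lattice_sum]), which is what the weight of order two pays for
    ([module_inner_wl1], [module_inner_diff]).  The orthogonality relations rest on
    Fourier inversion for integrable functions with integrable transform, proved by
    Gaussian regularisation ([fourier_inversion]).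

    Together these estimates give [gramnorm_holder].  For the module norm a square
    root has to be taken; it is harmless because [gramnorm] is bounded below by the
    squared norm of [f] ([gramnorm_ge]). *)

Set Implicit Arguments.
Unset Strict Implicit.
Unset Printing Implicit Defensive.
Import Order.TTheory GRing.Theory Num.Theory.
Import numFieldNormedType.Exports.

Local Open Scope classical_set_scope.
Local Open Scope ring_scope.
Local Open Scope complex_scope.

Local Notation normc := (@ComplexField.Normc.normc _).
Local Notation Re := complex.Re.
Local Notation Im := complex.Im.
#[local] Arguments ComplexField.Normc.normc : simpl never.

(** * Complex-valued functions and their integrals *)

Section complex_numbers.
Context {R : realType}.
Implicit Types (z w : R[i]) (a b : R).

Lemma ReD z w : Re (z + w) = Re z + Re w. Proof. by case: z; case: w. Qed.
Lemma ImD z w : Im (z + w) = Im z + Im w. Proof. by case: z; case: w. Qed.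
Lemma ReN z : Re (- z) = - Re z. Proof. by case: z. Qed.
Lemma ImN z : Im (- z) = - Im z. Proof. by case: z. Qed.
Lemma ReB z w : Re (z - w) = Re z - Re w. Proof. by rewrite ReD ReN. Qed.
Lemma ReM z w : Re (z * w) = Re z * Re w - Im z * Im w.
Proof. by case: z; case: w. Qed.
Lemma ImM z w : Im (z * w) = Re z * Im w + Im z * Re w.
Proof. by case: z => ? ?; case: w. Qed.
Lemma ReJ z : Re (conjc z) = Re z. Proof. by case: z. Qed.
Lemma ImJ z : Im (conjc z) = - Im z. Proof. by case: z. Qed.
Lemma ReZ a z : Re (a%:C * z) = a * Re z.
Proof. by rewrite ReM /= mul0r subr0. Qed.
Lemma ImZ a z : Im (a%:C * z) = a * Im z.
Proof. by rewrite ImM /= mul0r addr0. Qed.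

Lemma Re_sum I (r : seq I) (P : pred I) (F : I -> R[i]) :
  Re (\sum_(i <- r | P i) F i) = \sum_(i <- r | P i) Re (F i).
Proof. by elim/big_rec2 : _ => // i y z _ <-; rewrite ReD. Qed.
Lemma conjc_sum I (r : seq I) (P : pred I) (F : I -> R[i]) :
  conjc (\sum_(i <- r | P i) F i) = \sum_(i <- r | P i) conjc (F i).
Proof. exact: rmorph_sum. Qed.
Lemma conjcM z w : conjc (z * w) = conjc z * conjc w.
Proof. exact: rmorphM. Qed.

Lemma complex_ext z w : Re z = Re w -> Im z = Im w -> z = w.
Proof. by case: z => a b; case: w => c d /= -> ->. Qed.

Lemma normcE2 z : normc z ^+ 2 = Re z ^+ 2 + Im z ^+ 2.
Proof. by case: z => a b /=; rewrite sqr_sqrtr// addr_ge0// sqr_ge0. Qed.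

Lemma normc_ge0 z : 0 <= normc z.
Proof. by case: z => a b /=; rewrite sqrtr_ge0. Qed.

Lemma normcJ z : normc (conjc z) = normc z.
Proof. by case: z => a b; rewrite /ComplexField.Normc.normc /= sqrrN. Qed.

Lemma normcM z w : normc (z * w) = normc z * normc w.
Proof. exact: ComplexField.Normc.normcM. Qed.

Lemma normcR a : normc a%:C = `|a|.
Proof. by rewrite /ComplexField.Normc.normc /= expr0n/= addr0 sqrtr_sqr. Qed.

Lemma normc_sum I (r : seq I) (P : pred I) (F : I -> R[i]) :
  normc (\sum_(i <- r | P i) F i) <= \sum_(i <- r | P i) normc (F i).
Proof.
elim/big_rec2 : _ => [|i x y _ h]; first by rewrite ComplexField.Normc.normc0.
by apply: (le_trans (le_normcD _ _)); rewrite lerD2l.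
Qed.

Lemma mulJc z : z * conjc z = (normc z ^+ 2)%:C.
Proof.
by rewrite normcE2; case: z => a b; apply: complex_ext => /=; ring.
Qed.

Lemma ler_abs_Re z : `|Re z| <= normc z.
Proof.
rewrite -ler_sqr ?nnegrE// ?normc_ge0//.
by rewrite real_normK ?num_real// normcE2 lerDl sqr_ge0.
Qed.

Lemma ler_abs_Im z : `|Im z| <= normc z.
Proof.
rewrite -ler_sqr ?nnegrE// ?normc_ge0//.
by rewrite real_normK ?num_real// normcE2 lerDr sqr_ge0.
Qed.

Lemma ler_Re z : Re z <= normc z.
Proof. exact: le_trans (ler_norm _) (ler_abs_Re _). Qed.

Lemma ler_normc_ReIm z : normc z <= `|Re z| + `|Im z|.
Proof.
rewrite -ler_sqr ?nnegrE// ?normc_ge0//.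
rewrite normcE2 sqrrD !real_normK ?num_real// -addrA [X in _ <= _ + X]addrC addrA.
by rewrite lerDl mulrn_wge0// mulr_ge0.
Qed.

Lemma normc_AMGM z w : Re (z * w) <= (normc z ^+ 2 + normc w ^+ 2) / 2.
Proof.
apply: (le_trans (ler_Re _)); rewrite normcM ler_pdivlMr//.
have := sqr_ge0 (normc z - normc w); nra.
Qed.

Lemma cexpiD a b : cexpi (a + b) = cexpi a * cexpi b.
Proof. by apply: complex_ext => /=; rewrite ?cosD ?sinD //; ring. Qed.

Lemma cexpi0 : cexpi (0 : R) = 1.
Proof. by rewrite /cexpi cos0 sin0. Qed.

Lemma cexpiN a : cexpi (- a) = conjc (cexpi a).
Proof. by rewrite /cexpi cosN sinN. Qed.

Lemma normc_cexpi a : normc (cexpi a) = 1.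
Proof. by rewrite /ComplexField.Normc.normc /= cos2Dsin2 sqrtr1. Qed.

Lemma cexpi_sum I (r : seq I) (P : pred I) (F : I -> R) :
  cexpi (\sum_(i <- r | P i) F i) = \prod_(i <- r | P i) cexpi (F i).
Proof. exact: (big_morph _ cexpiD cexpi0). Qed.

(** The chord between two points of the unit circle is twice the sine of half the
    angle, and the sine is at most its argument. *)
Lemma normc_cexpiB a b : normc (cexpi a - cexpi b) <= `|a - b|.
Proof.
wlog ab : a b / b < a.
  move=> H; have [ab|ba|->] := ltgtP a b.
  - by rewrite distrC -normcN opprB; exact: H.
  - exact: H.
  - by rewrite !subrr ComplexField.Normc.normc0 normr0.
rewrite -ler_sqr ?nnegrE// ?normc_ge0//.
rewrite real_normK ?num_real// normcE2 /=.
have -> : (cos a - cos b) ^+ 2 + (sin a - sin b) ^+ 2 = 4 * sin ((a - b) / 2) ^+ 2.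
  have h : cos (a - b) = 1 - 2 * sin ((a - b) / 2) ^+ 2.
    rewrite [in LHS](_ : a - b = ((a - b) / 2) + ((a - b) / 2)); last by field.
    by rewrite cosD -!expr2 cos2sin2; ring.
  have e : 4 * sin ((a - b) / 2) ^+ 2 = 2 - 2 * cos (a - b).
    by rewrite h; ring.
  rewrite e cosB; have := cos2Dsin2 a; have := cos2Dsin2 b; nra.
have : `|sin ((a - b) / 2)| <= (a - b) / 2.
  set x := (a - b) / 2; have x0 : 0 < x by rewrite divr_gt0// subr_gt0.
  have [c _] := @MVT R sin cos _ _ x0 (fun y _ => is_derive_sin y)
     (@continuous_subspaceT _ _ _ _ (@continuous_sin R)).
  rewrite sin0 !subr0 => ->.
  by rewrite normrM (gtr0_norm x0) ler_piMl ?(ltW x0)// cos_max.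
move=> /(lerXn2r 2); rewrite !nnegrE => /(_ (normr_ge0 _)).
have : 0 <= (a - b) / 2 by rewrite divr_ge0// subr_ge0 ltW.
move=> /[swap] /[apply]; rewrite real_normK ?num_real//; nra.
Qed.

End complex_numbers.

Section complex_measurable.
Context {R : realType} {dsp : measure_display} {T : measurableType dsp}.
Implicit Types f g : T -> R[i].

Lemma cmeasurableD f g : cmeasurable f -> cmeasurable g ->
  cmeasurable (fun x => f x + g x).
Proof.
move=> [a b] [c e]; split.
  by under eq_fun do rewrite ReD; exact: measurable_funD.
by under eq_fun do rewrite ImD; exact: measurable_funD.
Qed.

Lemma cmeasurableM f g : cmeasurable f -> cmeasurable g ->
  cmeasurable (fun x => f x * g x).
Proof.
move=> [a b] [c e]; split.
  under eq_fun do rewrite ReM.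
  by apply: measurable_funB; exact: measurable_funM.
under eq_fun do rewrite ImM.
by apply: measurable_funD; exact: measurable_funM.
Qed.

Lemma cmeasurableJ f : cmeasurable f -> cmeasurable (fun x => conjc (f x)).
Proof.
move=> [a b]; split; first by under eq_fun do rewrite ReJ.
by under eq_fun do rewrite ImJ; exact: measurableT_comp.
Qed.

Lemma cmeasurableN f : cmeasurable f -> cmeasurable (fun x => - f x).
Proof.
move=> [a b]; split; first by under eq_fun do rewrite ReN; exact: measurableT_comp.
by under eq_fun do rewrite ImN; exact: measurableT_comp.
Qed.

Lemma cmeasurable_cst (c : R[i]) : cmeasurable (fun _ : T => c).
Proof. by split; exact: measurable_cst. Qed.

Lemma cmeasurable_sum I (r : seq I) (P : pred I) (F : I -> T -> R[i]) :
  (forall i, P i -> cmeasurable (F i)) ->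
  cmeasurable (fun x => \sum_(i <- r | P i) F i x).
Proof.
move=> mF; elim: r => [|i r IH].
  by under eq_fun do rewrite big_nil; exact: cmeasurable_cst.
under eq_fun do rewrite big_cons.
by case: (boolP (P i)) => // Pi; apply: cmeasurableD => //; exact: mF.
Qed.

Lemma cmeasurable_real (f : T -> R) : measurable_fun setT f ->
  cmeasurable (fun x => (f x)%:C).
Proof. by move=> mf; split => //; exact: measurable_cst. Qed.

Lemma cmeasurable_cexpi (f : T -> R) : measurable_fun setT f ->
  cmeasurable (fun x => cexpi (f x)).
Proof.
move=> mf; split.
  apply: measurableT_comp mf; apply: continuous_measurable_fun.
  exact: continuous_cos.
apply: measurableT_comp mf; apply: continuous_measurable_fun.
exact: continuous_sin.
Qed.

Lemma measurable_normc f : cmeasurable f ->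
  measurable_fun setT (fun x => normc (f x)).
Proof.
move=> [a b]; rewrite (_ : (fun _ => _) =
    (fun x => Num.sqrt (Re (f x) ^+ 2 + Im (f x) ^+ 2))).
  apply: measurableT_comp.
    apply: continuous_measurable_fun; exact: sqrt_continuous.
  by apply: measurable_funD; apply: measurable_funX.
by apply/funext => x; case: (f x).
Qed.

Lemma measurable_normc2 f : cmeasurable f ->
  measurable_fun setT (fun x => normc (f x) ^+ 2).
Proof. by move=> mf; apply: measurable_funX; exact: measurable_normc. Qed.

End complex_measurable.

Lemma cmeasurable_comp {R : realType} {d1 d2} {T1 : measurableType d1}
    {T2 : measurableType d2} (f : T2 -> R[i]) (g : T1 -> T2) :
  cmeasurable f -> measurable_fun setT g -> cmeasurable (fun x => f (g x)).
Proof.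
move=> [a b] mg; split.
  exact: (measurableT_comp (f := fun x => Re (f x))).
exact: (measurableT_comp (f := fun x => Im (f x))).
Qed.

Section complex_integral.
Context {R : realType} {dsp : measure_display} {T : measurableType dsp}.
Variable mu : {measure set T -> \bar R}.
Implicit Types f g : T -> R[i].

Definition cintegrable f :=
  cmeasurable f /\ mu.-integrable setT (fun x => (normc (f x))%:E).

Lemma cintegrable_Re f : cintegrable f ->
  mu.-integrable setT (fun x => (Re (f x))%:E).
Proof.
move=> [[m1 m2] i]; apply: le_integrable i => //.
  exact/measurable_EFinP.
by move=> x _; rewrite lee_fin (ger0_norm (normc_ge0 _)) ler_abs_Re.
Qed.

Lemma cintegrable_Im f : cintegrable f ->
  mu.-integrable setT (fun x => (Im (f x))%:E).
Proof.
move=> [[m1 m2] i]; apply: le_integrable i => //.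
  exact/measurable_EFinP.
by move=> x _; rewrite lee_fin (ger0_norm (normc_ge0 _)) ler_abs_Im.
Qed.

Lemma cintegrable_le f (g : T -> R) : cmeasurable f ->
  mu.-integrable setT (fun x => (g x)%:E) ->
  (forall x, normc (f x) <= g x) -> cintegrable f.
Proof.
move=> mf ig fg; split => //; apply: le_integrable ig => //.
  by apply/measurable_EFinP; exact: measurable_normc.
move=> x _; rewrite lee_fin (ger0_norm (normc_ge0 _)).
by rewrite (le_trans (fg x))// ler_norm.
Qed.

Lemma cintegrable_lty f : cmeasurable f ->
  (\int[mu]_x (normc (f x))%:E < +oo)%E -> cintegrable f.
Proof.
move=> mf h; split => //; apply/integrableP; split.
  by apply/measurable_EFinP; exact: measurable_normc.
apply: le_lt_trans h; apply: ge0_le_integral => //=.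
- by apply/measurable_EFinP; apply: measurableT_comp => //; exact: measurable_normc.
- by apply/measurable_EFinP; exact: measurable_normc.
- by move=> x _; rewrite lee_fin ger0_norm// normc_ge0.
Qed.

Lemma cintegrableD f g : cintegrable f -> cintegrable g ->
  cintegrable (fun x => f x + g x).
Proof.
move=> [mf jf] [mg jg].
apply: (@cintegrable_le _ (fun x => normc (f x) + normc (g x))).
- exact: cmeasurableD.
- by under eq_fun do rewrite EFinD; exact: integrableD.
- by move=> x; exact: le_normcD.
Qed.

Lemma cintegrableN f : cintegrable f -> cintegrable (fun x => - f x).
Proof.
move=> [mf jf]; apply: (@cintegrable_le _ (fun x => normc (f x))) => //.
  exact: cmeasurableN.
by move=> x; rewrite normcN.
Qed.

Lemma cintegrableB f g : cintegrable f -> cintegrable g ->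
  cintegrable (fun x => f x - g x).
Proof. by move=> jf jg; apply: cintegrableD => //; exact: cintegrableN. Qed.

Lemma cintegrableMb f g (C : R) : cintegrable f -> cmeasurable g ->
  (forall x, normc (g x) <= C) -> cintegrable (fun x => g x * f x).
Proof.
move=> [mf jf] mg gC.
apply: (@cintegrable_le _ (fun x => C * normc (f x))).
- exact: cmeasurableM.
- by under eq_fun do rewrite EFinM; exact: integrableZl.
- by move=> x; rewrite normcM ler_wpM2r// normc_ge0.
Qed.

Lemma cintegrableZ (c : R[i]) f : cintegrable f ->
  cintegrable (fun x => c * f x).
Proof.
move=> jf; by apply: (@cintegrableMb _ (fun=> c) (normc c)) => //; exact: cmeasurable_cst.
Qed.

Lemma cintegrableJ f : cintegrable f -> cintegrable (fun x => conjc (f x)).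
Proof.
move=> [mf jf]; apply: (@cintegrable_le _ (fun x => normc (f x))) => //.
  exact: cmeasurableJ.
by move=> x; rewrite normcJ.
Qed.

Lemma cintegrable0 : cintegrable (fun=> 0).
Proof.
split; first exact: cmeasurable_cst.
by rewrite ComplexField.Normc.normc0; exact: integrable0.
Qed.

Lemma cintegrable_sum I (r : seq I) (P : pred I) (F : I -> T -> R[i]) :
  (forall i, P i -> cintegrable (F i)) ->
  cintegrable (fun x => \sum_(i <- r | P i) F i x).
Proof.
move=> jF; elim: r => [|i r IH].
  by under eq_fun do rewrite big_nil; exact: cintegrable0.
under eq_fun do rewrite big_cons.
by case: (boolP (P i)) => // Pi; apply: cintegrableD => //; exact: jF.
Qed.

Lemma eq_cintegral f g : (forall x, f x = g x) ->
  cintegral mu f = cintegral mu g.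
Proof. by move=> /funext ->. Qed.

Lemma cintegralD f g : cintegrable f -> cintegrable g ->
  cintegral mu (fun x => f x + g x) = cintegral mu f + cintegral mu g.
Proof.
move=> jf jg; apply: complex_ext => /=.
  under eq_Rintegral do rewrite ReD.
  by rewrite RintegralD//; exact: cintegrable_Re.
under eq_Rintegral do rewrite ImD.
by rewrite RintegralD//; exact: cintegrable_Im.
Qed.

Lemma cintegralZ (c : R[i]) f : cintegrable f ->
  cintegral mu (fun x => c * f x) = c * cintegral mu f.
Proof.
move=> jf; have [j1 j2] := (cintegrable_Re jf, cintegrable_Im jf).
have jZ (a : R) (h : T -> R) : mu.-integrable setT (fun x => (h x)%:E) ->
    mu.-integrable setT (fun x => (a * h x)%:E).
  by move=> jh; under eq_fun do rewrite EFinM; exact: integrableZl.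
apply: complex_ext; rewrite ?ReM ?ImM /=.
  under eq_Rintegral do rewrite ReM.
  by rewrite RintegralB ?RintegralZl//; exact: jZ.
under eq_Rintegral do rewrite ImM.
by rewrite RintegralD ?RintegralZl//; exact: jZ.
Qed.

Lemma cintegralJ f :
  cintegrable f -> cintegral mu (fun x => conjc (f x)) = conjc (cintegral mu f).
Proof.
move=> jf; apply: complex_ext; rewrite ?ReJ ?ImJ /=.
  by under eq_Rintegral do rewrite ReJ.
under eq_Rintegral do rewrite ImJ -mulN1r.
by rewrite RintegralZl ?mulN1r//; exact: cintegrable_Im.
Qed.

Lemma cintegralN f : cintegrable f ->
  cintegral mu (fun x => - f x) = - cintegral mu f.
Proof.
move=> jf; rewrite -[RHS]mulN1r -cintegralZ//.
by apply: eq_cintegral => x; rewrite mulN1r.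
Qed.

Lemma cintegralB f g : cintegrable f -> cintegrable g ->
  cintegral mu (fun x => f x - g x) = cintegral mu f - cintegral mu g.
Proof.
by move=> jf jg; rewrite cintegralD ?cintegralN//; exact: cintegrableN.
Qed.

Lemma cintegral0 : cintegral mu (fun=> 0) = 0.
Proof. by apply: complex_ext => /=; rewrite /Rintegral integral0. Qed.

Lemma cintegral_sum I (r : seq I) (P : pred I) (F : I -> T -> R[i]) :
  (forall i, P i -> cintegrable (F i)) ->
  cintegral mu (fun x => \sum_(i <- r | P i) F i x) =
  \sum_(i <- r | P i) cintegral mu (F i).
Proof.
move=> jF; elim: r => [|i r IH].
  rewrite big_nil -[RHS]cintegral0; apply: eq_cintegral => x.
  by rewrite big_nil.
rewrite big_cons -IH; case: ifPn => Pi; last first.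
  by apply: eq_cintegral => x; rewrite big_cons (negbTE Pi).
rewrite -cintegralD; [|exact: jF|exact: cintegrable_sum].
by apply: eq_cintegral => x; rewrite big_cons Pi.
Qed.

(** Multiplying by the conjugate of the integral turns its modulus into the real
    part of an integral, so that the real inequality applies. *)
Lemma le_normc_cintegral f : cintegrable f ->
  normc (cintegral mu f) <= Rintegral mu setT (fun x => normc (f x)).
Proof.
move=> jf; set I := cintegral mu f.
have [->|I0] := eqVneq I 0.
  rewrite ComplexField.Normc.normc0.
  by apply: Rintegral_ge0 => x _; exact: normc_ge0.
have nI : 0 < normc I.
  rewrite lt_neqAle normc_ge0 andbT eq_sym; apply: contra I0.
  by move=> /eqP/ComplexField.Normc.eq0_normc ->.
rewrite -(ler_pM2l nI) -expr2.
have -> : normc I ^+ 2 = Re (cintegral mu (fun x => conjc I * f x)).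
  by rewrite cintegralZ// -/I mulrC mulJc.
rewrite -RintegralZl//; last by case: jf.
apply: le_Rintegral => //.
- exact: (cintegrable_Re (cintegrableZ _ jf)).
- exact: (integrableZl measurableT (normc I) jf.2).
- by move=> x _; rewrite (le_trans (ler_Re _))// normcM normcJ.
Qed.

Lemma ae_eq_cintegral f g : cmeasurable f -> cmeasurable g ->
  {ae mu, forall x, f x = g x} -> cintegral mu f = cintegral mu g.
Proof.
move=> [m1 m2] [m3 m4] h; apply: complex_ext; congr fine.
  apply: ae_eq_integral => //; [exact/measurable_EFinP..|].
  by apply: filterS h => x -> _.
apply: ae_eq_integral => //; [exact/measurable_EFinP..|].
by apply: filterS h => x -> _.
Qed.

(** Convergence is expressed on real and imaginary parts; every passage to the limit
    below uses it in this form. *)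
Lemma cdominated (F : nat -> T -> R[i]) f (g : T -> R) :
  (forall n, cmeasurable (F n)) ->
  (forall x, Re (F n x) @[n --> \oo] --> Re (f x)) ->
  (forall x, Im (F n x) @[n --> \oo] --> Im (f x)) ->
  mu.-integrable setT (fun x => (g x)%:E) ->
  (forall n x, normc (F n x) <= g x) ->
  [/\ cintegrable f,
    Re (cintegral mu (F n)) @[n --> \oo] --> Re (cintegral mu f) &
    Im (cintegral mu (F n)) @[n --> \oo] --> Im (cintegral mu f)].
Proof.
move=> mF c1 c2 ig Fg.
have mf : cmeasurable f.
  split.
    exact: (measurable_fun_cvg (fun n => (mF n).1) (fun x _ => c1 x)).
  exact: (measurable_fun_cvg (fun n => (mF n).2) (fun x _ => c2 x)).
have dom (h : nat -> T -> R) (h' : T -> R) :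
    (forall n, measurable_fun setT (h n)) -> measurable_fun setT h' ->
    (forall x, h n x @[n --> \oo] --> h' x) ->
    (forall n x, `|h n x| <= g x) ->
    mu.-integrable setT (fun x => (h' x)%:E) /\
    Rintegral mu setT (h n) @[n --> \oo] --> Rintegral mu setT h'.
  move=> mh mh' hh hg.
  have hE x : (h n x)%:E @[n --> \oo] --> (h' x)%:E.
    by apply: cvg_EFin; [exact: nearW|exact: hh].
  have [j _ l] := @dominated_convergence _ T R mu setT measurableT
    (fun n x => (h n x)%:E) (fun x => (h' x)%:E) (fun x => (g x)%:E)
    (fun n => (measurable_EFinP _ _).2 (mh n)) ((measurable_EFinP _ _).2 mh')
    (aeW _ (fun x _ => hE x)) ig
    (aeW _ (fun x n _ => hg n x)).
  split => //; apply: fine_cvg; rewrite /Rintegral fineK//.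
  exact: integrable_fin_num.
have [i1 l1] := dom _ _ (fun n => (mF n).1) mf.1 c1
  (fun n x => le_trans (ler_abs_Re _) (Fg n x)).
have [i2 l2] := dom _ _ (fun n => (mF n).2) mf.2 c2
  (fun n x => le_trans (ler_abs_Im _) (Fg n x)).
split => //; apply: (@cintegrable_le _ (fun x => `|Re (f x)| + `|Im (f x)|)) => //.
  under eq_fun do rewrite EFinD.
  by apply: integrableD => //; exact: integrable_norm.
by move=> x; exact: ler_normc_ReIm.
Qed.

End complex_integral.

(** * Changes of variables *)

Section change_of_variables.
Context {R : realType} {d1 d2 : measure_display}.
Context {T1 : measurableType d1} {T2 : measurableType d2}.
Variables (m1 : {measure set T1 -> \bar R}) (m2 : {measure set T2 -> \bar R}).
Variables (phi : T1 -> T2) (k : R).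
Hypotheses (mphi : measurable_fun setT phi) (k0 : 0 < k).
Hypothesis cov : forall f : T2 -> \bar R, measurable_fun setT f ->
  (forall x, (0 <= f x)%E) ->
  (\int[m1]_x f (phi x) = k%:E * \int[m2]_y f y)%E.

(** The changes of variables used below (affine maps, stacking two blocks, splitting
    off a coordinate) are first established for nonnegative functions, in the form
    of [cov]; this section carries such a formula over to complex functions. *)
Lemma cov_cintegrable (f : T2 -> R[i]) :
  cintegrable m2 f -> cintegrable m1 (fun x => f (phi x)).
Proof.
move=> [mf jf]; apply: cintegrable_lty; first exact: cmeasurable_comp.
rewrite (cov (f := fun y => (normc (f y))%:E)).
- apply: lte_mul_pinfty => //; first by rewrite lee_fin ltW.
  case/integrableP : jf => _; under eq_integral do rewrite gee0_abs ?lee_fin ?normc_ge0//.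
  by [].
- by apply/measurable_EFinP; exact: measurable_normc.
- by move=> y; rewrite lee_fin normc_ge0.
Qed.

Lemma cov_cintegrable_inv (f : T2 -> R[i]) : cmeasurable f ->
  cintegrable m1 (fun x => f (phi x)) -> cintegrable m2 f.
Proof.
move=> mf [_ jf]; apply: cintegrable_lty => //.
have h : (k%:E * \int[m2]_y (normc (f y))%:E < +oo)%E.
  rewrite -(cov (f := fun y => (normc (f y))%:E)).
  - case/integrableP : jf => _; under eq_integral do rewrite gee0_abs ?lee_fin ?normc_ge0//.
    by [].
  - by apply/measurable_EFinP; exact: measurable_normc.
  - by move=> y; rewrite lee_fin normc_ge0.
rewrite ltey; apply/eqP => e; move: h; rewrite e gt0_muley ?lte_fin//.
Qed.

Lemma cov_Rintegral (h : T2 -> R) : m2.-integrable setT (fun x => (h x)%:E) ->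
  Rintegral m1 setT (fun x => h (phi x)) = k * Rintegral m2 setT h.
Proof.
move=> jh; have mh := measurable_int _ jh.
rewrite /Rintegral integralE [in RHS]integralE.
have j1 := integrable_pos_fin_num measurableT jh.
have j2 := integrable_neg_fin_num measurableT jh.
rewrite (_ : (\int[m1]_x ((fun x => (h (phi x))%:E)^\+ x) =
    k%:E * \int[m2]_x ((fun x => (h x)%:E)^\+ x))%E); last first.
  rewrite -cov//; [|exact: measurable_funepos].
  by apply: eq_integral => x _; rewrite !funeposE.
rewrite (_ : (\int[m1]_x ((fun x => (h (phi x))%:E)^\- x) =
    k%:E * \int[m2]_x ((fun x => (h x)%:E)^\- x))%E); last first.
  rewrite -cov//; [|exact: measurable_funeneg].
  by apply: eq_integral => x _; rewrite !funenegE.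
rewrite -(fineK j1) -(fineK j2) -!EFinM -!EFinB /=; ring.
Qed.

Lemma cov_cintegral (f : T2 -> R[i]) : cintegrable m2 f ->
  cintegral m1 (fun x => f (phi x)) = k%:C * cintegral m2 f.
Proof.
move=> jf; apply: complex_ext; rewrite ?ReZ ?ImZ.
  by rewrite -cov_Rintegral//; exact: cintegrable_Re.
by rewrite -cov_Rintegral//; exact: cintegrable_Im.
Qed.

End change_of_variables.

Section lebesgue_cV.
Context {R : realType}.
Local Notation lebR := (@lebesgue_measure R).
Local Open Scope ereal_scope.

Lemma lebS_integral n (f : 'cV[R]_n.+1 -> \bar R) : measurable_fun setT f ->
  (forall x, 0 <= f x) ->
  \int[leb n.+1]_v f v = \int[lebR]_x \int[leb n]_v f (cV_cons (x, v)).
Proof.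
move=> mf f0.
rewrite (_ : \int[leb n.+1]_v f v =
    \int[pushforward (lebR \x leb n) (@cV_cons R n)]_v f v)//.
rewrite ge0_integral_pushforward//; last exact: measurable_cV_cons.
rewrite preimage_setT fubini_tonelli1//; last by move=> x; exact: f0.
by apply: measurableT_comp => //; exact: measurable_cV_cons.
Qed.

Lemma measurable_affine n (c : R) (a : 'cV[R]_n) :
  measurable_fun setT (fun v : 'cV[R]_n => (c *: v + a)%R).
Proof.
apply: measurable_fun_cV => i; under eq_fun do rewrite !mxE.
by apply: measurable_funD => //; apply: measurable_funM => //; exact: measurable_coord_cV.
Qed.

(** The rescaled image measure and the Lebesgue measure agree on half-open
    intervals. *)
Lemma lebR_affine (c a : R) (f : R -> \bar R) : (0 < c)%R ->
  measurable_fun setT f -> (forall x, 0 <= f x) ->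
  \int[lebR]_x f (c * x + a)%R = (c^-1)%:E * \int[lebR]_x f x.
Proof.
move=> c0 mf f0.
pose phi x : measurableTypeR R := (c * x + a)%R.
have mphi : measurable_fun setT (phi : measurableTypeR R -> measurableTypeR R).
  by apply: measurable_funD => //; exact: measurable_funM.
have c0' : (0 <= c^-1)%R by rewrite invr_ge0 ltW.
have unq (A : set R) : measurable A ->
    lebR A = mscale (NngNum (ltW c0)) (pushforward lebR phi) A.
  move=> mA; apply: lebesgue_measure_unique => //= _ [[l r]] _ <-.
  rewrite /mscale/= /pushforward/=.
  rewrite (_ : phi @^-1` _ = `](l - a) / c, (r - a) / c]%classic)%R; last first.
    apply/seteqP; split => x; rewrite /= !in_itv/= /phi.
      by rewrite ltr_pdivrMr// ler_pdivlMr// ltrBlDr lerBrDr ![(x * c)%R]mulrC.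
    by rewrite ltr_pdivrMr// ler_pdivlMr// ltrBlDr lerBrDr ![(x * c)%R]mulrC.
  rewrite !lebesgue_measure_itv/= !lte_fin ltr_pM2r ?invr_gt0// ltrD2r.
  case: ifPn => _; last by rewrite mule0.
  by rewrite -!EFinD -EFinM; congr EFin; field; rewrite gt_eqF.
transitivity (\int[pushforward lebR phi]_x f x).
  rewrite ge0_integral_pushforward//.
rewrite [in RHS](eq_measure_integral (mscale (NngNum (ltW c0)) (pushforward lebR phi))) /=.
  rewrite ge0_integral_mscale//= muleA -EFinM mulVf ?mul1e//.
  by rewrite gt_eqF.
by move=> A mA _; exact: unq.
Qed.

(** By Tonelli each coordinate contributes one factor [c^-1]. *)
Lemma leb_affine n (c : R) (a : 'cV[R]_n) (f : 'cV[R]_n -> \bar R) : (0 < c)%R ->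
  measurable_fun setT f -> (forall x, 0 <= f x) ->
  \int[leb n]_v f (c *: v + a)%R = (c ^- n)%:E * \int[leb n]_v f v.
Proof.
move=> c0; elim: n a f => [|n IH] a f mf f0.
  rewrite expr0 invr1 mul1e; apply: eq_integral => v _.
  by congr f; apply/colP => -[].
have mF : measurable_fun setT (fun v : 'cV[R]_n.+1 => f (c *: v + a)%R).
  by apply: (measurableT_comp (f := f)) => //; exact: measurable_affine.
rewrite lebS_integral// (lebS_integral mf)//.
pose a' : 'cV[R]_n := (\col_j a (lift ord0 j) ord0)%R.
have e x v : (c *: cV_cons (x, v) + a = cV_cons (c * x + a ord0 ord0, c *: v + a'))%R.
  apply/colP => i; rewrite !mxE; case: unliftP => [j|] -> /=; by rewrite ?mxE.
under eq_integral do under eq_integral do rewrite e.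
have mcons (x : R) : measurable_fun setT (fun v : 'cV[R]_n => cV_cons (x, v)).
  apply: (measurableT_comp (@measurable_cV_cons R n)); exact: measurable_pair1.
pose G (x : measurableTypeR R) := \int[leb n]_v f (cV_cons (x, v)).
have mG : measurable_fun setT G.
  apply: (@measurable_fun_fubini_tonelli_F _ _ _ _ _ (leb n) (f \o @cV_cons R n));
    last by move=> ?; exact: f0.
  by apply: measurableT_comp => //; exact: measurable_cV_cons.
have G0 x : 0 <= G x by exact: integral_ge0.
have GE x : \int[leb n]_v f (cV_cons (x, v)) = G x by [].
have GcE x : \int[leb n]_v f (cV_cons ((c * x + a ord0 ord0)%R, (c *: v + a')%R))
    = (c ^- n)%:E * G (c * x + a ord0 ord0)%R.
  rewrite (IH a' (fun v => f (cV_cons (c * x + a ord0 ord0, v))%R))//.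
  by apply: (measurableT_comp (f := f)).
clearbody G.
under eq_integral do rewrite GcE.
under [in RHS]eq_integral do rewrite GE.
have mG' : measurable_fun setT (fun x : measurableTypeR R => G (c * x + a ord0 ord0)%R).
  apply: (measurableT_comp (f := G)) => //.
  by apply: measurable_funD => //; exact: measurable_funM.
rewrite ge0_integralZl//; last by rewrite lee_fin invr_ge0 exprn_ge0// ltW.
by rewrite (lebR_affine _ c0 mG G0) muleA -EFinM -invfM exprSr.
Qed.

Lemma measurable_col_mx n m : measurable_fun setT
  (fun p : 'cV[R]_n * 'cV[R]_m => col_mx p.1 p.2).
Proof.
apply: measurable_fun_cV => i; under eq_fun do rewrite mxE.
case: (fintype.split i) => j.
  exact: (measurableT_comp (measurable_coord_cV j)).
exact: (measurableT_comp (measurable_coord_cV j)).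
Qed.

Lemma measurable_usubmx n m :
  measurable_fun setT (fun z : 'cV[R]_(n + m) => usubmx z).
Proof.
apply: measurable_fun_cV => i; under eq_fun do rewrite mxE.
exact: measurable_coord_cV.
Qed.

Lemma measurable_dsubmx n m :
  measurable_fun setT (fun z : 'cV[R]_(n + m) => dsubmx z).
Proof.
apply: measurable_fun_cV => i; under eq_fun do rewrite mxE.
exact: measurable_coord_cV.
Qed.

(** Induction on the first block, as [leb] is built by splitting off one coordinate
    at a time. *)
Lemma leb_add n m (f : 'cV[R]_(n + m) -> \bar R) : measurable_fun setT f ->
  (forall x, 0 <= f x) ->
  \int[leb (n + m)]_v f v = \int[leb n]_x \int[leb m]_y f (col_mx x y).
Proof.
elim: n f => [|n IH] f mf f0.
  rewrite /= integral_dirac//; last first.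
    apply: (@measurable_fun_fubini_tonelli_F _ _ _ _ _ (leb m)
      (fun p : 'cV[R]_0 * 'cV[R]_m => f (col_mx p.1 p.2))).
    - by apply: measurableT_comp => //; exact: measurable_col_mx.
    - by move=> ?; exact: f0.
  rewrite diracT mul1e; apply: eq_integral => y _; congr f; apply/colP => i.
  by have e : i = rshift 0 i; [exact/val_inj | rewrite [in RHS]e col_mxEd].
have e x (v : 'cV[R]_n) (y : 'cV[R]_m) :
    cV_cons (x, col_mx v y) = col_mx (cV_cons (x, v)) y :> 'cV[R]_(n.+1 + m).
  apply/colP => i; case: (split_ordP i) => j ->; rewrite ?col_mxEu ?col_mxEd.
    rewrite !mxE; case: (unliftP ord0 j) => [k|] -> /=.
      rewrite (_ : lshift m (lift ord0 k) = lift ord0 (lshift m k)); last exact: val_inj.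
      by rewrite liftK /= col_mxEu.
    rewrite (_ : lshift m ord0 = ord0); last exact: val_inj.
    by rewrite unlift_none.
  rewrite mxE (_ : rshift n.+1 j = lift ord0 (rshift n j)); last exact: val_inj.
  by rewrite liftK /= col_mxEd.
have mcons (x : R) : measurable_fun setT (fun v : 'cV[R]_(n + m) => cV_cons (x, v)).
  apply: (measurableT_comp (@measurable_cV_cons R (n + m))); exact: measurable_pair1.
have mf' : measurable_fun setT (f : 'cV[R]_(n + m).+1 -> \bar R) by exact: mf.
rewrite (@lebS_integral (n + m)%N f mf')// lebS_integral; last first.
- by move=> x; exact: integral_ge0.
- apply: (@measurable_fun_fubini_tonelli_F _ _ _ _ _ (leb m)
      (fun p : 'cV[R]_n.+1 * 'cV[R]_m => f (col_mx p.1 p.2))).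
  + by apply: measurableT_comp => //; exact: measurable_col_mx.
  + by move=> ?; exact: f0.
apply: eq_integral => x _.
rewrite (IH (fun v => f (cV_cons (x, v))))//; last first.
  by apply: (measurableT_comp (f := f)).
by apply: eq_integral => v _; apply: eq_integral => y _; rewrite e.
Qed.

End lebesgue_cV.

(** * Square-integrable functions *)

(** The right side is minimal relative to the left at [t = a^-1], which gives the
    product; for [a = 0] large values of [t] force [Z = 0]. *)
Lemma amgm_opt {R : realType} (Z a b : R) :
  (forall t : R, t * Z <= (t ^+ 2 * Z * a + b) / 2) ->
  0 <= Z -> 0 <= a -> 0 <= b -> Z <= a * b.
Proof.
move=> key Z0 a0 b0.
have [->|Zn] := eqVneq Z 0; first by rewrite mulr_ge0.
have Zp : 0 < Z by rewrite lt_neqAle eq_sym Zn Z0.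
have [a00|an] := eqVneq a 0.
  have := key ((b + 1) / Z); rewrite a00 mulr0 add0r -mulrA mulVf ?mulr1//; lra.
have ap : 0 < a by rewrite lt_neqAle eq_sym an a0.
have := key a^-1.
have -> : a^-1 ^+ 2 * Z * a = a^-1 * Z by field.
rewrite [_ * Z]mulrC => h.
have : Z / a <= b by lra.
by rewrite ler_pdivrMr// mulrC.
Qed.

Section square_integrable.
Context {R : realType} {dsp : measure_display} {T : measurableType dsp}.
Variable mu : {measure set T -> \bar R}.
Implicit Types f g : T -> R[i].

Definition nrm2 f : R := Rintegral mu setT (fun x => normc (f x) ^+ 2).

Lemma nrm2_ge0 f : 0 <= nrm2 f.
Proof. by apply: Rintegral_ge0 => x _; exact: sqr_ge0. Qed.

Lemma cLnorm2E f :
  cLnorm mu 2%:E f = ((\int[mu]_x (normc (f x) ^+ 2)%:E) `^ 2^-1)%E.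
Proof.
rewrite /cLnorm unlock /=.
congr (_ `^ _)%E; apply: eq_integral => x _.
by rewrite ger0_norm ?normc_ge0// powR_mulrn// normc_ge0.
Qed.

Lemma cLp2P f : cLp mu 2%:E f <->
  cmeasurable f /\ mu.-integrable setT (fun x => (normc (f x) ^+ 2)%:E).
Proof.
have i0 : (0 <= \int[mu]_x (normc (f x) ^+ 2)%:E)%E.
  by apply: integral_ge0 => x _; rewrite lee_fin sqr_ge0.
split=> -[mf h]; split => //.
  apply/integrableP; split.
    by apply/measurable_EFinP; exact: measurable_normc2.
  under eq_integral do rewrite gee0_abs ?lee_fin ?sqr_ge0//.
  move: h; rewrite cLnorm2E.
  set I := (\int[mu]_x (normc (f x) ^+ 2)%:E)%E in i0 *.
  move: i0; case: I => [r _ _|_|//]; first by rewrite ltry.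
  by rewrite poweRyr ?invr_eq0 ?pnatr_eq0.
rewrite cLnorm2E.
have := integrable_fin_num measurableT h.
by move=> /fineK <-; rewrite poweR_EFin ltry.
Qed.

Lemma cLnorm2_nrm2 f : cLp mu 2%:E f -> cLnorm mu 2%:E f = (Num.sqrt (nrm2 f))%:E.
Proof.
move=> /cLp2P[mf h]; rewrite cLnorm2E.
have := integrable_fin_num measurableT h.
move=> /fineK <-; rewrite poweR_EFin; congr EFin.
by rewrite powR12_sqrt// nrm2_ge0.
Qed.

Lemma cLp2_cintegrableM f g : cLp mu 2%:E f -> cLp mu 2%:E g ->
  cintegrable mu (fun x => f x * conjc (g x)).
Proof.
move=> /cLp2P[mf jf] /cLp2P[mg jg].
apply: (@cintegrable_le _ _ _ _ _ (fun x => normc (f x) ^+ 2 + normc (g x) ^+ 2)).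
- by apply: cmeasurableM => //; exact: cmeasurableJ.
- by under eq_fun do rewrite EFinD; exact: integrableD.
- move=> x; rewrite normcM normcJ.
  have := sqr_ge0 (normc (f x) - normc (g x)).
  have := normc_ge0 (f x); have := normc_ge0 (g x); nra.
Qed.

Lemma cLp2D f g : cLp mu 2%:E f -> cLp mu 2%:E g -> cLp mu 2%:E (fun x => f x + g x).
Proof.
move=> /cLp2P[mf jf] /cLp2P[mg jg]; apply/cLp2P; split; first exact: cmeasurableD.
apply: (@le_integrable _ _ _ mu _ measurableT _
  (fun x => (2 * normc (f x) ^+ 2 + 2 * normc (g x) ^+ 2)%:E)).
- by apply/measurable_EFinP; apply: measurable_normc2; exact: cmeasurableD.
- move=> x _; rewrite lee_fin ger0_norm ?sqr_ge0//.
  apply: le_trans (ler_norm _).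
  have h := le_normcD (f x) (g x).
  have h0 := normc_ge0 (f x + g x).
  have := sqr_ge0 (normc (f x) - normc (g x)).
  have := normc_ge0 (f x); have := normc_ge0 (g x); nra.
- under eq_fun do rewrite EFinD !EFinM.
  by apply: integrableD => //; exact: integrableZl.
Qed.

Lemma cLp2M f g (C : R) : cLp mu 2%:E f -> cmeasurable g ->
  (forall x, normc (g x) <= C) -> cLp mu 2%:E (fun x => g x * f x).
Proof.
move=> /cLp2P[mf jf] mg gC; apply/cLp2P; split; first exact: cmeasurableM.
apply: (@le_integrable _ _ _ mu _ measurableT _
  (fun x => (C ^+ 2 * normc (f x) ^+ 2)%:E)).
- by apply/measurable_EFinP; apply: measurable_normc2; exact: cmeasurableM.
- move=> x _; have C0 : 0 <= C by exact: le_trans (normc_ge0 _) (gC x).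
  rewrite lee_fin !ger0_norm ?sqr_ge0 ?mulr_ge0 ?sqr_ge0 ?normc_ge0//.
  rewrite normcM exprMn ler_wpM2r ?sqr_ge0//.
  by rewrite ler_sqr ?nnegrE ?normc_ge0.
- by under eq_fun do rewrite EFinM; exact: integrableZl.
Qed.

Lemma cLp2Z (c : R[i]) f : cLp mu 2%:E f -> cLp mu 2%:E (fun x => c * f x).
Proof.
by move=> hf; apply: (@cLp2M f (fun=> c) (normc c)) => //; exact: cmeasurable_cst.
Qed.

Lemma cLp2_0 : cLp mu 2%:E (fun=> 0).
Proof.
apply/cLp2P; split; first exact: cmeasurable_cst.
by under eq_fun do rewrite ComplexField.Normc.normc0 expr0n/=; exact: integrable0.
Qed.

Lemma cLp2B f g : cLp mu 2%:E f -> cLp mu 2%:E g -> cLp mu 2%:E (fun x => f x - g x).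
Proof.
move=> hf hg; under eq_fun do rewrite -mulN1r.
by apply: cLp2D => //; exact: cLp2Z.
Qed.

Lemma cLp2_sum I (r : seq I) (F : I -> T -> R[i]) :
  (forall i, cLp mu 2%:E (F i)) ->
  cLp mu 2%:E (fun x => \sum_(i <- r) F i x).
Proof.
move=> jF; elim: r => [|i r IH].
  by under eq_fun do rewrite big_nil; exact: cLp2_0.
by under eq_fun do rewrite big_cons; exact: cLp2D.
Qed.

Lemma cinner_suml I (r : seq I) (a : I -> R[i]) (F : I -> T -> R[i]) g :
  (forall i, cLp mu 2%:E (F i)) -> cLp mu 2%:E g ->
  cinner mu (fun x => \sum_(i <- r) a i * F i x) g =
  \sum_(i <- r) a i * cinner mu (F i) g.
Proof.
move=> hF hg; rewrite /cinner.
under eq_cintegral.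
  move=> x; rewrite mulr_suml; under eq_bigr do rewrite -mulrA; over.
rewrite cintegral_sum => [|i _]; last exact: cintegrableZ (cLp2_cintegrableM _ _).
by apply: eq_bigr => i _; rewrite cintegralZ//; exact: cLp2_cintegrableM.
Qed.

Lemma cinner_conj f g : cLp mu 2%:E f -> cLp mu 2%:E g ->
  cinner mu g f = conjc (cinner mu f g).
Proof.
move=> hf hg; rewrite /cinner -cintegralJ; last exact: cLp2_cintegrableM.
by apply: eq_cintegral => x; rewrite conjcM conjcK mulrC.
Qed.

Lemma cinner_sumr I (r : seq I) (a : I -> R[i]) (F : I -> T -> R[i]) g :
  (forall i, cLp mu 2%:E (F i)) -> cLp mu 2%:E g ->
  cinner mu g (fun x => \sum_(i <- r) a i * F i x) =
  \sum_(i <- r) conjc (a i) * cinner mu g (F i).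
Proof.
move=> hF hg; rewrite cinner_conj//; last first.
  by apply: cLp2_sum => i; exact: cLp2Z.
rewrite cinner_suml// conjc_sum; apply: eq_bigr => i _.
by rewrite conjcM -cinner_conj.
Qed.

Lemma cinnerZl (c : R[i]) f g : cLp mu 2%:E f -> cLp mu 2%:E g ->
  cinner mu (fun x => c * f x) g = c * cinner mu f g.
Proof.
move=> hf hg; rewrite /cinner -cintegralZ; last exact: cLp2_cintegrableM.
by apply: eq_cintegral => x; rewrite mulrA.
Qed.

Lemma cinnerZr (c : R[i]) f g : cLp mu 2%:E f -> cLp mu 2%:E g ->
  cinner mu f (fun x => c * g x) = conjc c * cinner mu f g.
Proof.
move=> hf hg; rewrite /cinner -cintegralZ; last exact: cLp2_cintegrableM.
by apply: eq_cintegral => x; rewrite conjcM mulrCA.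
Qed.

Lemma cinnerBl f1 f2 g : cLp mu 2%:E f1 -> cLp mu 2%:E f2 -> cLp mu 2%:E g ->
  cinner mu (fun x => f1 x - f2 x) g = cinner mu f1 g - cinner mu f2 g.
Proof.
move=> h1 h2 hg; rewrite /cinner -cintegralB; [|exact: cLp2_cintegrableM..].
by apply: eq_cintegral => x; rewrite mulrBl.
Qed.

Lemma cinner_self f : cinner mu f f = (nrm2 f)%:C.
Proof.
rewrite /cinner (@eq_cintegral _ _ _ _ _ (fun x => (normc (f x) ^+ 2)%:C)).
  by apply: complex_ext => //=; rewrite /Rintegral integral0.
by move=> x; rewrite mulJc.
Qed.

Lemma Re_cinner_AMGM f g : cLp mu 2%:E f -> cLp mu 2%:E g ->
  Re (cinner mu f g) <= (nrm2 f + nrm2 g) / 2.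
Proof.
move=> hf hg; have hfg := cLp2_cintegrableM hf hg.
move/cLp2P : hf => [mf jf]; move/cLp2P : hg => [mg jg].
rewrite /= /nrm2 -RintegralD// mulrC -RintegralZl//; last exact: (integrableD measurableT jf jg).
apply: le_Rintegral => //; first exact: cintegrable_Re.
  apply: (integrableZl measurableT (2^-1) (f := fun x =>
    (normc (f x) ^+ 2 + normc (g x) ^+ 2)%:E)).
  by under eq_fun do rewrite EFinD; exact: integrableD.
by move=> x _; rewrite (le_trans (normc_AMGM _ _))// normcJ mulrC.
Qed.

Lemma nrm2Z (c : R[i]) f : cLp mu 2%:E f ->
  nrm2 (fun x => c * f x) = normc c ^+ 2 * nrm2 f.
Proof.
move=> /cLp2P[_ jf]; rewrite /nrm2 -RintegralZl//.
by apply: eq_Rintegral => x _; rewrite normcM exprMn.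
Qed.

(** Multiplying [f] by the conjugate of the inner product makes the latter real, and
    a further real factor optimises the arithmetic-geometric bound. *)
Lemma cauchy_schwarz f g : cLp mu 2%:E f -> cLp mu 2%:E g ->
  normc (cinner mu f g) ^+ 2 <= nrm2 f * nrm2 g.
Proof.
move=> hf hg; set z := cinner mu f g.
have key (t : R) : t * normc z ^+ 2 <= (t ^+ 2 * normc z ^+ 2 * nrm2 f + nrm2 g) / 2.
  have := Re_cinner_AMGM (cLp2Z (t%:C * conjc z) hf) hg.
  rewrite cinnerZl// nrm2Z// -/z normcM normcR normcJ exprMn real_normK ?num_real//.
  by rewrite -mulrA [conjc z * z]mulrC mulJc ReZ.
exact: (amgm_opt key (sqr_ge0 _) (nrm2_ge0 _) (nrm2_ge0 _)).
Qed.

(** Bounds on the norm are used in this linear form, which unlike the squared one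
    can be added over a finite sum. *)
Lemma Re_cinner_bound (M B : R) g F : 0 <= M -> 0 <= B ->
  cLp mu 2%:E g -> cLp mu 2%:E F ->
  nrm2 F <= M ^+ 2 * B -> Re (cinner mu F g) <= M / 2 * (B + nrm2 g).
Proof.
move=> M0 B0 hg hF h; apply: (le_trans (ler_Re _)).
have g0 := nrm2_ge0 g.
rewrite -ler_sqr ?nnegrE ?normc_ge0// ?mulr_ge0 ?addr_ge0 ?divr_ge0//.
apply: (le_trans (cauchy_schwarz hF hg)).
apply: (@le_trans _ _ (M ^+ 2 * B * nrm2 g)); first exact: ler_wpM2r.
have -> : (M / 2 * (B + nrm2 g)) ^+ 2 =
  M ^+ 2 * B * nrm2 g + M ^+ 2 * ((B - nrm2 g) / 2) ^+ 2 by field.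
by rewrite lerDl mulr_ge0// sqr_ge0.
Qed.

(** Testing against [F / M] recovers the squared bound from the linear one. *)
Lemma nrm2_bound (M B : R) F : 0 < M -> cLp mu 2%:E F ->
  (forall g, cLp mu 2%:E g -> Re (cinner mu F g) <= M / 2 * (B + nrm2 g)) ->
  nrm2 F <= M ^+ 2 * B.
Proof.
move=> M0 hF h; have := h _ (cLp2Z (M^-1)%:C hF).
rewrite cinnerZr// conjc_real ReZ cinner_self nrm2Z// normcR real_normK ?num_real//=.
rewrite -(ler_pM2l (mulr_gt0 M0 M0)) => e.
have : M * nrm2 F * 2 <= M * (M ^+ 2 * B + nrm2 F).
  move: e; have -> : M * M * (M^-1 * nrm2 F) = M * nrm2 F by field; rewrite gt_eqF.
  have -> : M * M * (M / 2 * (B + M^-1 ^+ 2 * nrm2 F)) =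
    M * (M ^+ 2 * B + nrm2 F) / 2 by field; rewrite gt_eqF.
  lra.
by rewrite -mulrA ler_pM2l//; lra.
Qed.

Lemma cinner_sum_fun I (s : seq I) (F : I -> T -> R[i]) g :
  (forall i, cLp mu 2%:E (F i)) -> cLp mu 2%:E g ->
  cinner mu (fun x => \sum_(i <- s) F i x) g = \sum_(i <- s) cinner mu (F i) g.
Proof.
move=> hF hg; have := @cinner_suml _ s (fun=> 1) F g hF hg.
under eq_bigr do rewrite mul1r; move=> <-; apply: eq_cintegral => x.
by under [in RHS]eq_bigr do rewrite mul1r.
Qed.

(** Minkowski's inequality, obtained without square roots by adding the linear forms
    of the bounds. *)
Lemma nrm2_sum I (s : seq I) (c : I -> R) (F : I -> T -> R[i]) (B M : R) :
  (forall i, cLp mu 2%:E (F i)) -> (forall i, 0 <= c i) -> 0 <= B ->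
  (forall i, nrm2 (F i) <= c i ^+ 2 * B) -> 0 < M -> \sum_(i <- s) c i <= M ->
  nrm2 (fun t => \sum_(i <- s) F i t) <= M ^+ 2 * B.
Proof.
move=> LF c0 B0 nF M0 cM; apply: nrm2_bound => //; first exact: cLp2_sum.
move=> g Lg; rewrite cinner_sum_fun// Re_sum.
apply: (@le_trans _ _ (\sum_(i <- s) c i / 2 * (B + nrm2 g))).
  by apply: ler_sum => i _; apply: Re_cinner_bound.
by rewrite -!mulr_suml ler_wpM2r ?addr_ge0 ?nrm2_ge0// ler_wpM2r.
Qed.

End square_integrable.

(** * Time-frequency shifts *)

Section bilinear.
Context {R : realType}.

Lemma dotvDl n (x y z : 'cV[R]_n) : dotv (x + y) z = dotv x z + dotv y z.
Proof. by rewrite /dotv -big_split; apply: eq_bigr => i _; rewrite mxE mulrDl. Qed.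
Lemma dotvDr n (x y z : 'cV[R]_n) : dotv z (x + y) = dotv z x + dotv z y.
Proof. by rewrite /dotv -big_split; apply: eq_bigr => i _; rewrite mxE mulrDr. Qed.
Lemma dotvNl n (x z : 'cV[R]_n) : dotv (- x) z = - dotv x z.
Proof. by rewrite /dotv -sumrN; apply: eq_bigr => i _; rewrite mxE mulNr. Qed.
Lemma dotvNr n (x z : 'cV[R]_n) : dotv z (- x) = - dotv z x.
Proof. by rewrite /dotv -sumrN; apply: eq_bigr => i _; rewrite mxE mulrN. Qed.
Lemma dotvC n (x z : 'cV[R]_n) : dotv x z = dotv z x.
Proof. by apply: eq_bigr => i _; rewrite mulrC. Qed.

Lemma measurable_dotv n d1 (T : measurableType d1) (x y : T -> 'cV[R]_n) :
  measurable_fun setT x -> measurable_fun setT y ->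
  measurable_fun setT (fun t => dotv (x t) (y t)).
Proof.
move=> mx my; apply: measurable_sum => i; apply: measurable_funM.
  exact: (measurableT_comp (measurable_coord_cV i)).
exact: (measurableT_comp (measurable_coord_cV i)).
Qed.

End bilinear.

Section time_frequency_shifts.
Context {R : realType} {d : nat}.
Local Notation C := R[i].
Local Notation ip := (@cinner R _ _ (leb d)).
Implicit Types (z w : 'cV[R]_(d + d)) (h u : 'cV[R]_d -> C).

(** The cocycle of the projective representation, see [tfshiftM]. *)
Definition pairing z w : R := dotv (usubmx z) (dsubmx w).

Lemma usubmxD (z w : 'cV[R]_(d + d)) : usubmx (z + w) = usubmx z + usubmx w.
Proof. exact: raddfD. Qed.
Lemma dsubmxD (z w : 'cV[R]_(d + d)) : dsubmx (z + w) = dsubmx z + dsubmx w.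
Proof. exact: raddfD. Qed.
Lemma usubmxN (z : 'cV[R]_(d + d)) : usubmx (- z) = - usubmx z.
Proof. exact: raddfN. Qed.
Lemma dsubmxN (z : 'cV[R]_(d + d)) : dsubmx (- z) = - dsubmx z.
Proof. exact: raddfN. Qed.

Lemma pairingDl z1 z2 w : pairing (z1 + z2) w = pairing z1 w + pairing z2 w.
Proof. by rewrite /pairing usubmxD dotvDl. Qed.
Lemma pairingDr z1 z2 w : pairing w (z1 + z2) = pairing w z1 + pairing w z2.
Proof. by rewrite /pairing dsubmxD dotvDr. Qed.
Lemma pairingNl z w : pairing (- z) w = - pairing z w.
Proof. by rewrite /pairing usubmxN dotvNl. Qed.
Lemma pairingNr z w : pairing w (- z) = - pairing w z.
Proof. by rewrite /pairing dsubmxN dotvNr. Qed.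
Lemma pairingBl z1 z2 w : pairing (z1 - z2) w = pairing z1 w - pairing z2 w.
Proof. by rewrite pairingDl pairingNl. Qed.
Lemma pairingBr z1 z2 w : pairing w (z1 - z2) = pairing w z1 - pairing w z2.
Proof. by rewrite pairingDr pairingNr. Qed.

Lemma tfshiftM z w h t :
  tfshift z (tfshift w h) t = cexpi (- (2 * pi * pairing z w)) * tfshift (z + w) h t.
Proof.
rewrite /tfshift /pairing usubmxD dsubmxD !mulrA -!cexpiD.
congr (cexpi _ * h _); last by rewrite opprD addrA.
by rewrite dotvDl dotvDr dotvNl; ring.
Qed.

Lemma tfshift0 h t : tfshift 0 h t = h t.
Proof.
rewrite /tfshift (_ : usubmx 0 = 0); last exact: raddf0.
rewrite (_ : dsubmx 0 = 0); last exact: raddf0.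
rewrite subr0 /dotv big1 ?mulr0 ?cexpi0 ?mul1r// => i _.
by rewrite mxE mulr0.
Qed.

Lemma tfshift_sum I (r : seq I) (a : I -> C) (F : I -> 'cV[R]_d -> C) z t :
  tfshift z (fun s => \sum_(i <- r) a i * F i s) t =
  \sum_(i <- r) a i * tfshift z (F i) t.
Proof. by rewrite /tfshift mulr_sumr; apply: eq_bigr => i _; rewrite mulrCA. Qed.

Lemma cmeasurable_tfshift z h : cmeasurable h -> cmeasurable (tfshift z h).
Proof.
move=> mh; apply: cmeasurableM.
  apply: cmeasurable_cexpi; apply: measurable_funM => //.
  by apply: measurable_dotv => //; exact: measurable_id.
apply: cmeasurable_comp => //.
by have := @measurable_affine R d 1 (- usubmx z); under eq_fun do rewrite scale1r.
Qed.

Lemma leb_translate n (a : 'cV[R]_n) (f : 'cV[R]_n -> \bar R) :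
  measurable_fun setT f -> (forall x, (0 <= f x)%E) ->
  (\int[leb n]_v f (v + a)%R = 1%:E * \int[leb n]_v f v)%E.
Proof.
move=> mf f0; have := leb_affine a ltr01 mf f0; rewrite expr1n invr1 => <-.
by apply: eq_integral => v _; rewrite scale1r.
Qed.

Lemma measurable_translate n (a : 'cV[R]_n) :
  measurable_fun setT (fun v : 'cV[R]_n => v + a).
Proof.
by have := @measurable_affine R n 1 a; under eq_fun do rewrite scale1r.
Qed.

Lemma cintegrable_translate n (a : 'cV[R]_n) (f : 'cV[R]_n -> C) :
  cintegrable (leb n) f -> cintegrable (leb n) (fun v => f (v + a)).
Proof.
exact: (cov_cintegrable (measurable_translate a) ltr01 (@leb_translate n a)).
Qed.

Lemma cintegral_translate n (a : 'cV[R]_n) (f : 'cV[R]_n -> C) :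
  cintegrable (leb n) f -> cintegral (leb n) (fun v => f (v + a)) = cintegral (leb n) f.
Proof.
move=> jf.
by rewrite (cov_cintegral (@leb_translate n a))// mul1r.
Qed.

Lemma normc_tfshift z h t : normc (tfshift z h t) = normc (h (t - usubmx z)).
Proof. by rewrite /tfshift normcM normc_cexpi mul1r. Qed.

Lemma L2_tfshift z h : L2 h -> L2 (tfshift z h).
Proof.
move=> /cLp2P[mh jh]; apply/cLp2P; split; first exact: cmeasurable_tfshift.
under eq_fun do rewrite normc_tfshift.
have j : cintegrable (leb d) (fun t => (normc (h t) ^+ 2)%:C).
  apply: (@cintegrable_le _ _ _ _ _ (fun t => normc (h t) ^+ 2)) => //.
    by apply: cmeasurable_real; exact: measurable_normc2.
  by move=> x; rewrite normcR ger0_norm ?sqr_ge0.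
exact: (cintegrable_Re (cintegrable_translate (- usubmx z) j)).
Qed.

Lemma ip_tfshift z h u : L2 h -> L2 u -> ip (tfshift z h) (tfshift z u) = ip h u.
Proof.
move=> hh hu; rewrite -[RHS](cintegral_translate (- usubmx z)); last first.
  exact: cLp2_cintegrableM.
apply: eq_cintegral => t; rewrite /tfshift conjcM mulrACA -cexpiN -cexpiD subrr.
by rewrite cexpi0 mul1r.
Qed.

Lemma nrm2_tfshift z h : L2 h -> nrm2 (leb d) (tfshift z h) = nrm2 (leb d) h.
Proof. by move=> hh; have := ip_tfshift z hh hh; rewrite !cinner_self => -[]. Qed.

Lemma ip_tfshift2 z w h u : L2 h -> L2 u ->
  ip (tfshift z h) (tfshift w u) =
  cexpi (2 * pi * pairing w (z - w)) * ip (tfshift (z - w) h) u.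
Proof.
move=> hh hu; rewrite -(ip_tfshift w (L2_tfshift (z - w) hh) hu).
rewrite -cinnerZl//; [|exact: L2_tfshift (L2_tfshift _ _)|exact: L2_tfshift].
apply: eq_cintegral => t; rewrite tfshiftM mulrA -cexpiD subrr cexpi0 mul1r.
by rewrite addrC subrK.
Qed.

(** Conjugation by a time-frequency shift acts on matrix coefficients through the
    symplectic form only; this is how characters get implemented. *)
Lemma ip_tfshift_conj z y u : L2 u ->
  ip (tfshift z (tfshift y u)) (tfshift y u) =
  cexpi (2 * pi * (pairing y z - pairing z y)) * ip (tfshift z u) u.
Proof.
move=> hu.
transitivity (cexpi (- (2 * pi * pairing z y)) * ip (tfshift (z + y) u) (tfshift y u)).
  rewrite -cinnerZl//; [|exact: L2_tfshift|exact: L2_tfshift].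
  by apply: eq_cintegral => t; rewrite tfshiftM.
rewrite ip_tfshift2// addrK mulrA -cexpiD; congr (cexpi _ * _); ring.
Qed.

(** The two functions are the images of [h] under the inverses of the shifts by [l]
    and by [k]. *)
Lemma ip_tfshift3 (m l k : 'cV[R]_(d + d)) h : L2 h ->
  ip (tfshift m (fun t => cexpi (- (2 * pi * pairing l l)) * tfshift (- l) h t))
     (fun t => cexpi (- (2 * pi * pairing k k)) * tfshift (- k) h t) =
  cexpi (2 * pi * (pairing m l - pairing l l + pairing k k - pairing k (k + m - l)))
   * ip (tfshift (k + m - l) h) h.
Proof.
move=> hh.
have -> : ip (tfshift m (fun t => cexpi (- (2 * pi * pairing l l)) * tfshift (- l) h t))
   (fun t => cexpi (- (2 * pi * pairing k k)) * tfshift (- k) h t) =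
   cexpi (2 * pi * (pairing m l - pairing l l + pairing k k)) *
   ip (tfshift (m - l) h) (tfshift (- k) h).
  rewrite -cinnerZl; [|exact: L2_tfshift..].
  apply: eq_cintegral => t.
  rewrite conjcM -cexpiN.
  transitivity (cexpi (- (2 * pi * pairing l l)) * tfshift m (tfshift (- l) h) t *
    (cexpi (- - (2 * pi * pairing k k)) * (tfshift (- k) h t)^*)).
    by congr (_ * _); rewrite /tfshift !mulrA; congr (_ * _); ring.
  rewrite tfshiftM pairingNr !mulrA [_ * cexpi (- - _)]mulrC !mulrA -!cexpiD.
  by congr (cexpi _ * _ * _); ring.
rewrite ip_tfshift2// mulrA -cexpiD opprK [m - l + k]addrC addrA.
by congr (cexpi _ * _); rewrite pairingNl; ring.
Qed.

End time_frequency_shifts.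

(** * Twisted convolution as a sesquilinear form *)

Lemma perm_big_map {V : nmodType} {I J : eqType} (s : seq I) (t : seq J)
    (P : pred I) (Q : pred J) (f : I -> J) (F : J -> V) :
  uniq s -> uniq t -> {in s &, injective f} ->
  (forall x, x \in s -> P x -> (f x \in t) && Q (f x)) ->
  (forall y, y \in t -> Q y -> exists2 x, (x \in s) && P x & y = f x) ->
  \sum_(x <- s | P x) F (f x) = \sum_(y <- t | Q y) F y.
Proof.
move=> us ut fI fP fQ.
rewrite -big_filter -[RHS]big_filter -(big_map f xpredT F).
apply: perm_big; apply: uniq_perm.
- rewrite map_inj_in_uniq ?filter_uniq// => x y.
  by rewrite !mem_filter => /andP[_ xs] /andP[_ ys]; exact: fI.
- exact: filter_uniq.
- move=> y; rewrite mem_filter; apply/mapP/andP => [[x]|[Qy yt]].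
    by rewrite mem_filter => /andP[Px xs] ->; have /andP[-> ->] := fP _ xs Px.
  have [x /andP[xs Px] ->] := fQ _ yt Qy.
  by exists x => //; rewrite mem_filter Px.
Qed.

Section gram_form.
Context {R : realType} {d : nat}.
Local Notation C := R[i].
Local Notation n := (d + d)%N.
Local Notation Z := 'cV[int]_n.
Implicit Types (L : 'M[R]_n) (a b : Z -> C) (k l m : Z) (D : seq Z).

Lemma lattice_ptD L k l : lattice_pt L (k + l) = lattice_pt L k + lattice_pt L l.
Proof. by rewrite /lattice_pt map_mxD mulmxDr. Qed.
Lemma lattice_ptN L k : lattice_pt L (- k) = - lattice_pt L k.
Proof. by rewrite /lattice_pt map_mxN mulmxN. Qed.
Lemma lattice_ptB L k l : lattice_pt L (k - l) = lattice_pt L k - lattice_pt L l.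
Proof. by rewrite lattice_ptD lattice_ptN. Qed.
Lemma lattice_pt0 L : lattice_pt L 0 = 0.
Proof. by rewrite /lattice_pt map_mx0 mulmx0. Qed.

Definition lpairing L k l : R := pairing (lattice_pt L k) (lattice_pt L l).

Lemma lpairingBl L k l m : lpairing L (k - l) m = lpairing L k m - lpairing L l m.
Proof. by rewrite /lpairing lattice_ptB pairingBl. Qed.
Lemma lpairingBr L k l m : lpairing L m (k - l) = lpairing L m k - lpairing L m l.
Proof. by rewrite /lpairing lattice_ptB pairingBr. Qed.

(** The matrix of twisted convolution by [a], for the cocycle of the lattice,
    restricted to the finite set [D]. *)
Definition gram L a D b b' : C :=
  \sum_(k <- D) \sum_(l <- D)
    b l * conjc (b' k) * (cexpi (- (2 * pi * lpairing L l (k - l))) * a (k - l)).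

(** By homogeneity this says that twisted convolution by [a] has norm at most [M];
    the arithmetic-geometric form is the one that survives sums and integrals. *)
Definition gram_bound L a (M : R) : Prop :=
  forall D b b', uniq D ->
    Re (gram L a D b b') <= M / 2 * \sum_(k <- D) (normc (b k) ^+ 2 + normc (b' k) ^+ 2).

Definition wl1 (w : Z -> R) a (S : R) : Prop :=
  forall s : seq Z, uniq s -> \sum_(k <- s) w k * normc (a k) <= S.

Local Notation l1 := (wl1 (fun=> 1)).

Lemma wl1_ge0 w a S : wl1 w a S -> 0 <= S.
Proof. by move=> /(_ [::] isT); rewrite big_nil. Qed.

Lemma gramD L a c D b b' :
  gram L (fun m => a m + c m) D b b' = gram L a D b b' + gram L c D b b'.
Proof.
rewrite /gram -big_split; apply: eq_bigr => k _; rewrite -big_split.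
by apply: eq_bigr => l _; rewrite !mulrDr.
Qed.

(** Schur's test: rows and columns of the matrix are translates of [a]. *)
Lemma Re_gram_l1 L a S D b b' : l1 a S -> uniq D ->
  Re (gram L a D b b') <= S / 2 * \sum_(k <- D) (normc (b k) ^+ 2 + normc (b' k) ^+ 2).
Proof.
move=> aS uD; rewrite /gram Re_sum.
have S0 := wl1_ge0 aS.
apply: (@le_trans _ _ (\sum_(k <- D) \sum_(l <- D)
    ((normc (b l) ^+ 2 + normc (b' k) ^+ 2) / 2 * normc (a (k - l))))).
  apply: ler_sum => k _; rewrite Re_sum; apply: ler_sum => l _.
  apply: (le_trans (ler_Re _)); rewrite !normcM normc_cexpi mul1r normcJ.
  apply: ler_wpM2r; first exact: normc_ge0.
  rewrite ler_pdivlMr//; have := sqr_ge0 (normc (b l) - normc (b' k)); nra.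
under eq_bigr do under eq_bigr do rewrite mulrDl mulrDl.
under eq_bigr do rewrite big_split/=.
rewrite big_split/= [in leRHS]big_split/= mulrDr; apply: lerD.
  rewrite exchange_big mulr_sumr; apply: ler_sum => l _ /=.
  rewrite -mulr_sumr [leRHS]mulrC -mulrA ler_wpM2l ?sqr_ge0//.
  rewrite mulrC ler_wpM2r//; have := aS [seq k - l | k <- D].
  rewrite big_map; under eq_bigr do rewrite mul1r; apply.
  by rewrite map_inj_uniq//; exact: addIr.
rewrite mulr_sumr; apply: ler_sum => k _ /=.
rewrite -mulr_sumr [leRHS]mulrC -mulrA ler_wpM2l ?sqr_ge0//.
rewrite mulrC ler_wpM2r//; have := aS [seq k - l | l <- D].
rewrite big_map; under eq_bigr do rewrite mul1r; apply.
by rewrite map_inj_uniq// => x y /addrI/oppr_inj.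
Qed.

Lemma gram_bound_perturb L a c M e :
  gram_bound L a M -> l1 (fun m => c m - a m) e -> gram_bound L c (M + e).
Proof.
move=> aM ce D b b' uD.
have -> : c = fun m => a m + (c m - a m) by apply/funext => m; rewrite addrC subrK.
rewrite gramD ReD mulrDl mulrDl; apply: lerD; first exact: aM.
exact: Re_gram_l1.
Qed.

Lemma gram_bound_ge0 L a M : gram_bound L a M -> 0 <= M.
Proof.
move=> /(_ [:: 0] (fun=> 1) (fun=> 0) isT).
rewrite /gram !big_seq1 conjc0 mulr0 mul0r ComplexField.Normc.normc1.
by rewrite ComplexField.Normc.normc0 /=; lra.
Qed.

End gram_form.

(** * Characters of the lattice *)

Section characters.
Context {R : realType}.

Lemma cexpi_eq1 (x : R) : 0 < x < 2 * pi -> cexpi x != 1.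
Proof.
move=> /andP[x0 x1]; apply/eqP => -[cx _].
have : cos x = 1 - 2 * sin (x / 2) ^+ 2.
  rewrite [in LHS](_ : x = (x / 2) + (x / 2)); last by field.
  by rewrite cosD -!expr2 cos2sin2; ring.
rewrite cx => h.
have : 0 < sin (x / 2) by apply: sin_gt0_pi; rewrite divr_gt0//= ltr_pdivrMr// mulrC.
by move=> s0; have := exprn_gt0 2 s0; lra.
Qed.

Lemma cexpi_natM (x : R) (j : nat) : cexpi (j%:R * x) = cexpi x ^+ j.
Proof.
elim: j => [|j IH]; first by rewrite mul0r cexpi0 expr0.
by rewrite -natr1 mulrDl mul1r cexpiD IH exprSr.
Qed.

Lemma cexpi_2pi_nat (j : nat) : cexpi (2 * pi * j%:R) = 1 :> R[i].
Proof.
rewrite mulrC cexpi_natM (_ : cexpi (2 * pi) = 1) ?expr1n//.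
by rewrite /cexpi mulrC mulr_natr cos2pi sin2pi.
Qed.

Lemma cexpi_2pi_int (j : int) : cexpi (2 * pi * j%:~R) = 1 :> R[i].
Proof.
case: j => j; first exact: cexpi_2pi_nat.
by rewrite NegzE mulrNz mulrN cexpiN cexpi_2pi_nat conjc1.
Qed.

Lemma sum_roots_of_unity (N : nat) (q : int) : (`|q| < N)%N ->
  \sum_(j < N) cexpi (2 * pi * (j%:R * (q%:~R / N%:R))) =
  (if q == 0 then N%:R else 0) :> R[i].
Proof.
move=> qN; have N0 : (N%:R : R) != 0 by rewrite pnatr_eq0; case: N qN.
have [->|q0] := eqVneq q 0.
  under eq_bigr do rewrite mul0r !mulr0 cexpi0.
  by rewrite sumr_const card_ord.
set z := cexpi (2 * pi * (q%:~R / N%:R)) : R[i].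
under eq_bigr do rewrite mulrCA cexpi_natM -/z.
have z1 : z != 1.
  have pos (x : int) : (0 < x) -> (`|x| < N)%N -> cexpi (2 * pi * (x%:~R / N%:R)) != 1 :> R[i].
    move=> x0 xN; apply: cexpi_eq1; rewrite !mulr_gt0 ?pi_gt0 ?ltr0z ?invr_gt0 ?ltr0n//=;
      last by case: N xN {qN N0 z}.
    rewrite -[ltRHS]mulr1 ltr_pM2l ?mulr_gt0 ?pi_gt0// ltr_pdivrMr ?mul1r//.
      by rewrite -(gtz0_abs x0) ltr_nat.
    by rewrite ltr0n; case: N xN {qN N0 z}.
  have [qp|qn|e] := ltgtP 0 q; [exact: pos|have := pos (- q)|by rewrite -e eqxx in q0].
  rewrite oppr_gt0 abszN => /(_ qn qN).
  rewrite mulrNz mulNr mulrN cexpiN -/z; apply: contra => /eqP ->.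
  by rewrite conjc1.
have := subrX1 z N; rewrite (_ : z ^+ N = 1).
  rewrite subrr => /esym/eqP; rewrite mulf_eq0 subr_eq0 (negbTE z1)/= => /eqP.
  by [].
by rewrite /z -cexpi_natM mulrCA [N%:R * _]mulrC divfK// cexpi_2pi_int.
Qed.

(** The sum factors into one geometric sum for each coordinate. *)
Lemma sum_characters n (N : nat) (q : 'cV[int]_n) :
  (forall i, `|q i ord0| < N)%N ->
  \sum_(j : {ffun 'I_n -> 'I_N})
    cexpi (2 * pi * \sum_(i < n) ((j i)%:R / N%:R * (q i ord0)%:~R)) =
  (if q == 0 then (N%:R) ^+ n else 0) :> R[i].
Proof.
move=> qN.
transitivity (\prod_(i < n) \sum_(x < N)
    cexpi (2 * pi * (x%:R * ((q i ord0)%:~R / N%:R))) : R[i]).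
  rewrite bigA_distr_bigA/=; apply: eq_bigr => j _.
  rewrite -cexpi_sum -mulr_sumr; congr (cexpi (_ * _)).
  by apply: eq_bigr => i _; rewrite -mulrA; congr (_ * _); rewrite mulrC.
under eq_bigr do rewrite sum_roots_of_unity//.
case: (altP eqP) => [->|q0].
  by under eq_bigr do rewrite mxE eqxx; rewrite prodr_const card_ord.
have [i qi] : exists i, q i ord0 != 0.
  by apply/existsP; apply: contraR q0; rewrite negb_exists => /forallP h;
     apply/eqP/colP => i; rewrite mxE; apply/eqP; rewrite -[_ == _]negbK.
by rewrite (bigD1 i)//= (negbTE qi) mul0r.
Qed.

End characters.

(** * Boxes in the lattice *)

Section boxes.
Context {R : realType}.
Variable n : nat.
Local Notation Z := 'cV[int]_n.
Implicit Types (k l m v : Z).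

Definition box_pt N (j : {ffun 'I_n -> 'I_N}) : Z := \col_i (j i : nat)%:Z.

Definition in_box N v : bool := [forall i, (0 <= v i ord0) && (v i ord0 < N%:Z)].

Definition norm1 v : R := \sum_(i < n) (`|v i ord0|%N)%:R.

Lemma norm1_ge0 v : 0 <= norm1 v.
Proof. by apply: sumr_ge0. Qed.

Lemma in_box_pt N j : in_box N (@box_pt N j).
Proof.
by apply/forallP => i; rewrite mxE ltz_nat ltn_ord andbT.
Qed.

Lemma in_boxP N v : in_box N v -> exists j, v = @box_pt N j.
Proof.
move=> /forallP h.
have vN i : (`|v i ord0| < N)%N.
  by have /andP[v0 vN] := h i; rewrite -ltz_nat gez0_abs.
exists [ffun i => Ordinal (vN i)]; apply/colP => i; rewrite !mxE ffunE /=.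
by have /andP[v0 _] := h i; rewrite gez0_abs.
Qed.

Lemma box_pt_inj N : injective (@box_pt N).
Proof.
move=> j j' /colP h; apply/ffunP => i; apply: val_inj.
by have := h i; rewrite !mxE => -[].
Qed.

Lemma card_box N : #|{: {ffun 'I_n -> 'I_N}}| = (N ^ n)%N.
Proof. by rewrite card_ffun !card_ord. Qed.

Lemma norm1_box N j : norm1 (@box_pt N j) <= n%:R * N%:R.
Proof.
rewrite -[n in leRHS]card_ord -sumr_const; rewrite mulr_suml.
apply: ler_sum => i _; rewrite mxE mul1r ler_nat absz_nat ltnW//.
Qed.

Lemma sum_box_translate {V : nmodType} N (D : seq Z) (F : Z -> V) (l : Z) :
  uniq D -> (forall v, in_box N v -> l + v \in D) ->
  \sum_(k <- D | in_box N (k - l)) F (k - l) = \sum_(j : {ffun 'I_n -> 'I_N}) F (box_pt j).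
Proof.
move=> uD lD.
rewrite -(big_map (fun k => k - l) (in_box N) F).
symmetry; apply: (@perm_big_map _ _ _ (index_enum _) [seq k - l | k <- D]
  xpredT (in_box N) (@box_pt N) F).
- exact: index_enum_uniq.
- by rewrite map_inj_uniq//; exact: addIr.
- by move=> ? ? _ _; exact: box_pt_inj.
- move=> j _ _; rewrite in_box_pt andbT; apply/mapP.
  exists (l + box_pt j); first exact/lD/in_box_pt.
  by rewrite addrC addKr.
- by move=> y _ /in_boxP[j ->]; exists j => //; rewrite mem_index_enum.
Qed.

Lemma sum_ltn N p : (\sum_(x < N) (x < p) <= p)%N.
Proof.
suff -> : (\sum_(x < N) (x < p) = minn N p)%N by rewrite geq_minr.
elim: N => [|N IH]; first by rewrite big_ord0 min0n.
rewrite big_ord_recr/= IH; case: (ltnP N p) => h; lia.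
Qed.

Lemma count_outside N (q : int) :
  (\sum_(x < N) ~~ ((0 <= x%:Z + q) && (x%:Z + q < N%:Z))%R <= `|q|)%N.
Proof.
case: q => p.
  rewrite (reindex_inj rev_ord_inj)/=; apply: leq_trans (sum_ltn N p).
  apply: leq_sum => x _; have := ltn_ord x.
  case: (ltnP x p) => [_ _|h xN]; first exact: leq_b1.
  by rewrite leqn0 eqb0 negbK; lia.
apply: leq_trans (sum_ltn N p.+1).
apply: leq_sum => x _; have := ltn_ord x.
case: (ltnP x p.+1) => [_ _|h xN]; first exact: leq_b1.
by rewrite leqn0 eqb0 negbK NegzE; lia.
Qed.

Lemma sum_coordinate N (i : 'I_n) (f : 'I_N -> R) :
  N%:R * \sum_(j : {ffun 'I_n -> 'I_N}) f (j i) = (N ^ n)%:R * \sum_(x < N) f x.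
Proof.
pose g (i' : 'I_n) (x : 'I_N) := if i' == i then f x else 1.
have -> : \sum_(j : {ffun 'I_n -> 'I_N}) f (j i) =
    \sum_(j : {ffun 'I_n -> 'I_N}) \prod_i' g i' (j i').
  apply: eq_bigr => j _; rewrite (bigD1 i)//= {1}/g eqxx big1 ?mulr1// => i' ii'.
  by rewrite /g (negbTE ii').
rewrite -(bigA_distr_bigA g) (bigD1 i)//= {1}/g eqxx.
rewrite [\prod_(i' < n | _) _](eq_bigr (fun=> N%:R)); last first.
  by move=> i' ii'; rewrite /g (negbTE ii') sumr_const card_ord.
rewrite prodr_const mulrCA mulrC -exprS natrX; congr (_ ^+ _ * _).
rewrite (_ : #|_| = n.-1); last first.
  by rewrite cardC1 card_ord.
by rewrite prednK//; exact: leq_ltn_trans (ltn_ord i).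
Qed.

(** A translation moves only a boundary layer out of the box: this is the Foelner
    property of [Z^n]. *)
Lemma folner_box N (m : Z) : (0 < N)%N ->
  \sum_(j : {ffun 'I_n -> 'I_N}) (~~ in_box N (box_pt j + m))%:R
  <= (N ^ n)%:R * (norm1 m / N%:R) :> R.
Proof.
move=> N0.
apply: (@le_trans _ _ (\sum_(j : {ffun 'I_n -> 'I_N}) \sum_(i < n)
   (~~ ((0 <= (j i : nat)%:Z + m i ord0) && ((j i : nat)%:Z + m i ord0 < N%:Z)))%:R)).
  apply: ler_sum => j _; rewrite /in_box negb_forall.
  case: (boolP [exists _, _]) => [/existsP[i hi]|_]; last exact: sumr_ge0.
  rewrite (bigD1 i)//= -[leLHS]addr0 lerD//; last exact: sumr_ge0.
  by move: hi; rewrite !mxE => ->.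
rewrite exchange_big/= mulrA /norm1 mulr_sumr mulr_suml; apply: ler_sum => i _.
rewrite -(ler_pM2l (_ : 0 < N%:R)) ?ltr0n//.
rewrite (sum_coordinate i (fun x : 'I_N =>
  (~~ ((0 <= (x : nat)%:Z + m i ord0) && ((x : nat)%:Z + m i ord0 < N%:Z)))%:R)).
rewrite [leRHS]mulrC divfK ?pnatr_eq0 -?lt0n// ler_wpM2l//.
by rewrite -natr_sum ler_nat count_outside.
Qed.

(** Without the phases this is the Foelner estimate; the phases are compared to [1]
    along the arc. *)
Lemma box_average N (m : Z) (theta : Z -> R) (t : R) : (0 < N)%N ->
  (forall j : {ffun 'I_n -> 'I_N}, `|theta (box_pt j)| <= t) ->
  normc (((N ^ n)%:R)^-1%:C * (\sum_(j : {ffun 'I_n -> 'I_N})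
     (in_box N (box_pt j + m))%:R * cexpi (theta (box_pt j))) - 1)
  <= norm1 m / N%:R + t.
Proof.
move=> N0 ht.
have V0 : 0 < (N ^ n)%:R :> R by rewrite ltr0n expn_gt0 N0.
have e : 1 = ((N ^ n)%:R)^-1%:C * \sum_(j : {ffun 'I_n -> 'I_N}) 1 :> R[i].
  rewrite sumr_const card_box -[X in _ * X](rmorph_nat (real_complex R)).
  by rewrite -rmorphM mulVf ?gt_eqF.
rewrite [X in _ - X]e -mulrBr -sumrB normcM normcR ger0_norm ?invr_ge0 ?(ltW V0)//.
rewrite mulrC ler_pdivrMr//; apply: (le_trans (normc_sum _ _ _)).
apply: (@le_trans _ _ (\sum_(j : {ffun 'I_n -> 'I_N})
    ((~~ in_box N (box_pt j + m))%:R + t))).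
  apply: ler_sum => j _; case: (in_box _ _) => /=.
    rewrite mul1r add0r (le_trans _ (ht j))// -[1]cexpi0.
    by rewrite (le_trans (normc_cexpiB _ _))// subr0.
  rewrite mul0r sub0r normcN ComplexField.Normc.normc1 lerDl.
  exact: le_trans (normr_ge0 _) (ht j).
rewrite big_split/= sumr_const card_box mulrDl lerD//.
  by rewrite mulrC folner_box.
by rewrite mulr_natr.
Qed.

End boxes.

(** * Transference between lattices *)

Section transference.
Context {R : realType} {d : nat}.
Local Notation C := R[i].
Local Notation n := (d + d)%N.
Local Notation Z := 'cV[int]_n.
Implicit Types (L : 'M[R]_n) (a b : Z -> C) (k l m : Z) (D : seq Z).
Local Notation norm1 := (@norm1 R n).

(** The positions of the window at which it meets [D]. *)
Definition diffs D N : seq Z :=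
  undup [seq l - box_pt j | l <- D, j <- enum {: {ffun 'I_n -> 'I_N}}].

Lemma diffs_uniq D N : uniq (diffs D N). Proof. exact: undup_uniq. Qed.

Lemma sum_window {V : nmodType} D N (F : Z -> V) l : l \in D ->
  \sum_(w <- diffs D N | in_box N (l - w)) F (l - w) =
  \sum_(j : {ffun 'I_n -> 'I_N}) F (box_pt j).
Proof.
move=> lD.
rewrite -(sum_box_translate (D := [seq l - w | w <- diffs D N]) (l := 0) F).
- by rewrite big_map; apply: eq_big => [w|w _]; rewrite subr0.
- by rewrite map_inj_uniq ?diffs_uniq// => x y /addrI/oppr_inj.
- move=> v /in_boxP[j ->]; rewrite add0r; apply/mapP.
  exists (l - box_pt j); last by rewrite opprB addrC subrK.
  by rewrite mem_undup; apply/allpairsP; exists (l, j); rewrite mem_enum.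
Qed.

(** On a window of side [N] around [w] the two cocycles differ by a coboundary,
    which is absorbed in the phases of the windowed sequences, up to an error
    bilinear in [l - w] and [k - l]. *)
Lemma windowed_gram (L L' : 'M[R]_n) a N D b b' : uniq D ->
  let delta k l := lpairing L' k l - lpairing L k l in
  let win w (c : Z -> C) l := (in_box N (l - w))%:R *
    cexpi (- (2 * pi * delta w l)) * c l in
  \sum_(w <- diffs D N) gram L' a D (win w b) (win w b') =
  gram L (fun m => a m * \sum_(j : {ffun 'I_n -> 'I_N})
      (in_box N (box_pt j + m))%:R * cexpi (- (2 * pi * delta (box_pt j) m))) D b b'.
Proof.
move=> uD delta win; rewrite /gram exchange_big; apply: eq_big_seq => k kD.
rewrite exchange_big; apply: eq_big_seq => l lD /=.
rewrite (mulrA (cexpi _)) mulrA [RHS]mulr_sumr.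
rewrite -(sum_window N (fun v => b l * conjc (b' k) *
  (cexpi (- (2 * pi * lpairing L l (k - l))) * a (k - l)) *
  ((in_box N (v + (k - l)))%:R * cexpi (- (2 * pi * delta v (k - l)))))lD).
rewrite [RHS]big_mkcond/=; apply: eq_bigr => w _.
rewrite /win; case: (in_box N (l - w)); last by rewrite !mul0r.
rewrite (_ : l - w + (k - l) = k - w); last first.
  by rewrite addrC addrA subrK.
rewrite mul1r conjcM conjcM conjc_nat; case: (in_box N (k - w)); last first.
  by rewrite /= !mul0r !mulr0 !mul0r.
rewrite (_ : true%:R = 1 :> C)// !mul1r -cexpiN.
transitivity (b l * conjc (b' k) * a (k - l) *
   (cexpi (- (2 * pi * delta w l)) * cexpi (- - (2 * pi * delta w k)) *
    cexpi (- (2 * pi * lpairing L' l (k - l))))); first by ring.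
rewrite -!cexpiD.
transitivity (b l * conjc (b' k) * a (k - l) *
   (cexpi (- (2 * pi * lpairing L l (k - l))) *
    cexpi (- (2 * pi * delta (l - w) (k - l))))); last by ring.
rewrite -cexpiD; congr (_ * cexpi _).
rewrite /delta !lpairingBl !lpairingBr; ring.
Qed.

(** Each point of [D] is covered by [N ^ n] positions of the window. *)
Lemma sum_win (D : seq Z) N (b : Z -> C) (theta : Z -> Z -> R) :
  \sum_(w <- diffs D N) \sum_(k <- D)
     normc ((in_box N (k - w))%:R * cexpi (theta w k) * b k) ^+ 2 =
  (N ^ n)%:R * \sum_(k <- D) normc (b k) ^+ 2.
Proof.
rewrite exchange_big/= mulr_sumr; apply: eq_big_seq => k kD.
rewrite -(card_box n N) -sum1_card natr_sum mulr_suml.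
under [RHS]eq_bigr do rewrite mul1r.
rewrite -(sum_window N (fun=> normc (b k) ^+ 2) kD) [RHS]big_mkcond/=.
apply: eq_bigr => w _; rewrite !normcM normc_cexpi mulr1.
case: (in_box _ _) => /=; first by rewrite ComplexField.Normc.normc1 mul1r.
by rewrite ComplexField.Normc.normc0 mul0r expr0n.
Qed.

Lemma gram_boundZ L a M (c : R) : 0 <= c -> gram_bound L a M ->
  gram_bound L (fun m => c%:C * a m) (c * M).
Proof.
move=> c0 aM D b b' uD.
have -> : gram L (fun m => c%:C * a m) D b b' = c%:C * gram L a D b b'.
  rewrite /gram mulr_sumr; apply: eq_bigr => k _; rewrite mulr_sumr.
  by apply: eq_bigr => l _; ring.
rewrite ReZ -!mulrA ler_wpM2l// mulrA; exact: aM.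
Qed.

Lemma gram_bound_window (L L' : 'M[R]_n) a M N : (0 < N)%N -> gram_bound L' a M ->
  gram_bound L (fun m => a m * ((((N ^ n)%:R)^-1)%:C * \sum_(j : {ffun 'I_n -> 'I_N})
      (in_box N (box_pt j + m))%:R *
      cexpi (- (2 * pi * (lpairing L' (box_pt j) m - lpairing L (box_pt j) m))))) M.
Proof.
move=> N0 aM.
have V0 : 0 < (N ^ n)%:R :> R by rewrite ltr0n expn_gt0 N0.
have -> : M = ((N ^ n)%:R)^-1 * ((N ^ n)%:R * M).
  by rewrite mulrA mulVf ?mul1r ?gt_eqF.
rewrite (_ : (fun _ => _) = fun m => (((N ^ n)%:R)^-1)%:C * (a m *
   \sum_(j : {ffun 'I_n -> 'I_N})
      (in_box N (box_pt j + m))%:R *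
      cexpi (- (2 * pi * (lpairing L' (box_pt j) m - lpairing L (box_pt j) m))))); last first.
  by apply/funext => m; rewrite mulrCA.
apply: gram_boundZ; first by rewrite invr_ge0 ltW.
move=> D b b' uD; rewrite -windowed_gram// Re_sum.
pose win (w : Z) (c : Z -> C) (l : Z) := (in_box N (l - w))%:R *
  cexpi (- (2 * pi * (lpairing L' w l - lpairing L w l))) * c l.
apply: (@le_trans _ _ (\sum_(w <- diffs D N)
   M / 2 * \sum_(k <- D) (normc (win w b k) ^+ 2 + normc (win w b' k) ^+ 2))).
  by apply: ler_sum => w _; exact: aM.
rewrite -mulr_sumr; under eq_bigr do rewrite big_split/=.
rewrite big_split/= /win !sum_win -mulrDr -big_split/=.
by rewrite le_eqVlt; apply/orP; left; apply/eqP; ring.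
Qed.

(** Averaging over windows of side [N] multiplies the coefficient at [m] by a number
    whose distance from [1] has two sources, both linear in [m]: the boundary layer
    of the window contributes [norm1 m / N], and the change of cocycle, of relative
    size [e], accumulates to [e * n * N * norm1 m] across it.  Taking [N] of order
    [e^(-1/2)] balances them; this is where the exponent one half comes from. *)
Lemma gram_bound_lattice (L L' : 'M[R]_n) a M S (e : R) N : (0 < N)%N -> 0 <= e ->
  (forall k l, `|lpairing L' k l - lpairing L k l| <= e * norm1 k * norm1 l) ->
  wl1 norm1 a S -> gram_bound L' a M ->
  gram_bound L a (M + (N%:R^-1 + 2 * pi * e * n%:R * N%:R) * S).
Proof.
move=> N0 e0 he aS aM.
apply: (gram_bound_perturb (gram_bound_window L N0 aM)) => s us.
apply: le_trans (ler_wpM2l _ (aS _ us)); last first.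
  by rewrite addr_ge0// ?invr_ge0// !mulr_ge0// pi_ge0.
rewrite mulr_sumr; apply: ler_sum => m _; rewrite mul1r.
rewrite -{1}[a m]mulr1 -mulrBr normcM -[normc (1 - _)]normcN opprB mulrC mulrA.
apply: ler_wpM2r; first exact: normc_ge0.
have := @box_average R n N m (fun v => - (2 * pi * (lpairing L' v m - lpairing L v m)))
  (2 * pi * e * n%:R * N%:R * norm1 m) N0.
move=> h; rewrite (_ : (_ + _) * norm1 m = norm1 m / N%:R + 2 * pi * e * n%:R * N%:R * norm1 m);
  last by ring.
apply: h => j.
rewrite normrN !normrM (ger0_norm (pi_ge0 _)) (ger0_norm (ler0n _ 2)).
rewrite -!mulrA ler_pM2l// ler_pM2l ?pi_gt0//.
apply: (le_trans (he _ _)); rewrite -mulrA ler_wpM2l// mulrA ler_wpM2r ?norm1_ge0//.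
exact: norm1_box.
Qed.

End transference.

(** * The form dominates the representation *)

Lemma ler_add_invn {R : realType} (x y c : R) :
  (forall N, (0 < N)%N -> x <= y + c / N%:R) -> x <= y.
Proof.
move=> h; rewrite leNgt; apply/negP => yx.
have e0 : 0 < x - y by rewrite subr_gt0.
pose N := (Num.truncn (`|c| / (x - y))).+1.
have := h N isT; rewrite leNgt => /negP; apply.
rewrite -ltrBrDl ltr_pdivrMr ?ltr0n//.
apply: (le_lt_trans (ler_norm c)).
rewrite mulrC -ltr_pdivrMr//.
exact: truncnS_gt.
Qed.

Section representations.
Context {R : realType} {d : nat}.
Local Notation C := R[i].
Local Notation n := (d + d)%N.
Local Notation Z := 'cV[int]_n.
Implicit Types (L : 'M[R]_n) (a : Z -> C) (k l m : Z) (D F : seq Z).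
Implicit Types (h u : 'cV[R]_d -> C).
Local Notation ip := (@cinner R _ _ (leb d)).
Local Notation n2 := (@nrm2 R _ _ (leb d)).
Local Notation norm1 := (@norm1 R n).
Local Notation shift L k := (tfshift (lattice_pt L k)).

(** At each [t] the form is tested on the values at [t] of the orbits of [h] and
    [u].  Integration over [t] turns products of these values into matrix
    coefficients, and the one at [m] occurs as often as the box meets its translate
    by [m]. *)
Lemma gram_shift_average L a F N h u : L2 h -> L2 u -> uniq F ->
  (forall m, m \notin F -> a m = 0) ->
  let D := [seq box_pt j | j <- enum {: {ffun 'I_n -> 'I_N}}] in
  cintegral (leb d) (fun t => gram L a D (fun l => conjc (shift L l u t))
     (fun k => conjc (shift L k h t))) =
  \sum_(m <- F) a m * ip (shift L m h) u *
    (\sum_(j : {ffun 'I_n -> 'I_N}) (in_box N (box_pt j + m))%:R).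
Proof.
move=> hh hu uF aF D.
have Lh k : L2 (shift L k h) by exact: L2_tfshift.
have Lu k : L2 (shift L k u) by exact: L2_tfshift.
have jj k l : cintegrable (leb d) (fun t => (cexpi (- (2 * pi * lpairing L l (k - l))) *
    a (k - l)) * (shift L k h t * conjc (shift L l u t))).
  exact: (@cintegrableZ _ _ _ (leb d) _ (fun t => shift L k h t * conjc (shift L l u t))
    (cLp2_cintegrableM (Lh k) (Lu l))).
transitivity (\sum_(k <- D) \sum_(l <- D) a (k - l) * ip (shift L (k - l) h) u).
  under eq_cintegral.
    move=> t; rewrite /gram; under eq_bigr do under eq_bigr do rewrite conjcK.
    under eq_bigr do under eq_bigr do rewrite mulrC [conjc _ * _]mulrC.
    over.
  rewrite cintegral_sum => [|k _]; last by apply: cintegrable_sum => l _; exact: jj.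
  apply: eq_bigr => k _; rewrite cintegral_sum => [|l _]; last exact: jj.
  apply: eq_bigr => l _; rewrite (@cintegralZ _ _ _ (leb d) _
    (fun t => shift L k h t * conjc (shift L l u t))); last first.
    exact: (cLp2_cintegrableM (Lh k) (Lu l)).
  rewrite -/(ip (shift L k h) (shift L l u)) ip_tfshift2// -lattice_ptB.
  rewrite -/(lpairing L l (k - l)) mulrCA !mulrA -cexpiD subrr cexpi0 mul1r.
  by rewrite mulrC.
have uD : uniq D by rewrite map_inj_uniq ?enum_uniq//; exact: box_pt_inj.
have inD v : (v \in D) = in_box N v.
  apply/mapP/idP => [[j _ ->]|/in_boxP[j ->]]; first exact: in_box_pt.
  by exists j; rewrite ?mem_enum.
rewrite exchange_big/= /D big_map -/D big_enum/=.
under [RHS]eq_bigr do rewrite mulr_sumr.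
rewrite [RHS]exchange_big/=; apply: eq_bigr => j _.
rewrite [RHS](eq_bigr (fun m => if in_box N (box_pt j + m) then a m * ip (shift L m h) u else 0));
  last by move=> m _; case: in_box; rewrite ?mulr1 ?mulr0.
rewrite -[RHS]big_mkcond/=.
rewrite (bigID (fun k => k - box_pt j \in F))/= [X in _ + X]big1 ?addr0; last first.
  by move=> k kF; rewrite aF ?mul0r.
apply: (perm_big_map (f := fun k => k - box_pt j) (fun m => a m * ip (shift L m h) u)) => //.
- by move=> x y _ _; exact: addIr.
- by move=> k; rewrite inD => kD ->; rewrite addrC subrK.
- move=> m mF jm; exists (box_pt j + m); last by rewrite addrC addKr.
  by rewrite inD jm addrC addKr.
Qed.

(** Testing the form on the orbit of a function, cut off to a large box, recovers
    the operator in the limit: the form dominates the representation. *)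
Lemma gram_bound_op L a F M h u : gram_bound L a M -> uniq F ->
  (forall m, m \notin F -> a m = 0) -> L2 h -> L2 u ->
  Re (\sum_(m <- F) a m * ip (shift L m h) u) <= M / 2 * (n2 h + n2 u).
Proof.
move=> aM uF aF hh hu.
pose c := \sum_(m <- F) norm1 m * normc (a m * ip (shift L m h) u).
apply: (@ler_add_invn _ _ _ c) => N N0.
pose D := [seq box_pt j | j <- enum {: {ffun 'I_n -> 'I_N}}].
have uD : uniq D by rewrite map_inj_uniq ?enum_uniq//; exact: box_pt_inj.
have V0 : 0 < (N ^ n)%:R :> R by rewrite ltr0n expn_gt0 N0.
have Lh k : L2 (shift L k h) by exact: L2_tfshift.
have Lu k : L2 (shift L k u) by exact: L2_tfshift.
have h1 : Re (\sum_(m <- F) a m * ip (shift L m h) u *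
    (\sum_(j : {ffun 'I_n -> 'I_N}) (in_box N (box_pt j + m))%:R)) <=
    (N ^ n)%:R * (M / 2 * (n2 h + n2 u)).
  rewrite -gram_shift_average//.
  have jr (v : 'cV[R]_d -> C) : L2 v ->
      (leb d).-integrable setT (fun t => (normc (v t) ^+ 2)%:E).
    by move=> /cLp2P[].
  have jk k : (leb d).-integrable setT (fun t =>
      (normc (shift L k u t) ^+ 2 + normc (shift L k h t) ^+ 2)%:E).
    by under eq_fun do rewrite EFinD; apply: integrableD => //; exact: jr.
  have js : (leb d).-integrable setT (fun t => (\sum_(k <- D)
      (normc (shift L k u t) ^+ 2 + normc (shift L k h t) ^+ 2))%:E).
    by under eq_fun do rewrite -sumEFin; exact: integrable_sum.
  apply: (@le_trans _ _ (Rintegral (leb d) setT (fun t => M / 2 * \sum_(k <- D)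
      (normc (shift L k u t) ^+ 2 + normc (shift L k h t) ^+ 2)))).
    apply: le_Rintegral => //.
    - have := @cintegrable_Re _ _ _ (leb d) (fun t => gram L a D
         (fun l => conjc (shift L l u t)) (fun k => conjc (shift L k h t))); apply.
      apply: cintegrable_sum => k _; apply: cintegrable_sum => l _.
      under eq_fun do rewrite conjcK mulrC [conjc _ * _]mulrC.
      exact: (@cintegrableZ _ _ _ (leb d) _ (fun t => shift L k h t * conjc (shift L l u t))
    (cLp2_cintegrableM (Lh k) (Lu l))).
    - exact: (integrableZl measurableT (M / 2) js).
    - move=> t _; apply: (le_trans (aM D _ _ uD)).
      by under eq_bigr do rewrite !normcJ.
  rewrite RintegralZl//.
  rewrite mulrCA ler_wpM2l ?divr_ge0 ?(gram_bound_ge0 aM)//.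
  rewrite /Rintegral; under eq_integral do rewrite -sumEFin.
  rewrite integral_sum//.
  rewrite (eq_bigr (fun=> (n2 h + n2 u)%:E)) => [|k _]; last first.
    have -> : (\int[leb d]_x (normc (shift L k u x) ^+ 2 + normc (shift L k h x) ^+ 2)%:E)%E
      = (Rintegral (leb d) setT (fun x => normc (shift L k u x) ^+ 2 + normc (shift L k h x) ^+ 2))%:E.
      by rewrite fineK//; exact: integrable_fin_num.
    congr EFin; rewrite RintegralD//; [|exact: jr..].
    by rewrite -/(n2 (shift L k u)) -/(n2 (shift L k h)) !nrm2_tfshift// addrC.
  rewrite sumEFin /= big_map big_enum/= sumr_const card_box mulr_natl//.
rewrite -(ler_pM2l V0) mulrDr.
apply: le_trans (lerD h1 (lexx _)).
rewrite /c mulr_suml mulr_sumr !Re_sum mulr_sumr -big_split/=.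
apply: ler_sum => m _; set z := a m * _; set X := \sum_j _.
rewrite -lerBlDl -ReZ -ReB [z * X]mulrC -mulrBl.
apply: (le_trans (ler_Re _)); rewrite normcM.
rewrite (_ : _ * (_ / _) = (N ^ n)%:R * (norm1 m / N%:R) * normc z); last by ring.
rewrite ler_wpM2r ?normc_ge0//.
have hb : normc (((N ^ n)%:R^-1)%:C * X - 1) <= norm1 m / N%:R.
  have := @box_average R n N m (fun=> 0) 0 N0.
  rewrite normr0 addr0 => /(_ (fun=> lexx _)).
  by under eq_bigr do rewrite cexpi0 mulr1.
rewrite -(ler_pM2l V0) in hb; apply: le_trans hb.
rewrite -{2}[(N ^ n)%:R]ger0_norm ?(ltW V0)// -normcR -normcM mulrBr mulrA.
rewrite -rmorphM mulfV ?gt_eqF// mul1r mulr1.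
by rewrite -normcN opprB.
Qed.

End representations.

(** * The representation dominates the form *)

Section dual_points.
Context {R : realType} {d : nat}.
Local Notation n := (d + d)%N.

Lemma dotv_split (x y : 'cV[R]_n) :
  dotv x y = dotv (usubmx x) (usubmx y) + dotv (dsubmx x) (dsubmx y).
Proof.
rewrite /dotv big_split_ord/=.
by congr (_ + _); apply: eq_bigr => i _; rewrite !mxE.
Qed.

Lemma dotv_mulmx (L : 'M[R]_n) (x y : 'cV[R]_n) :
  dotv x (L *m y) = dotv (L^T *m x) y.
Proof.
rewrite /dotv; under eq_bigr do rewrite mxE mulr_sumr.
rewrite exchange_big; apply: eq_bigr => j _; rewrite mxE mulr_suml.
by apply: eq_bigr => i _; rewrite mxE; ring.
Qed.

(** The left side is the symplectic form of [y] and [L k].  Since this form is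
    nondegenerate, [y] can be found by solving [L^T q = theta] and swapping the two
    halves of [q]. *)
Lemma character_point (L : 'M[R]_n) (theta : 'cV[R]_n) : L \in unitmx ->
  exists y : 'cV[R]_n, forall k : 'cV[int]_n,
    pairing y (lattice_pt L k) - pairing (lattice_pt L k) y =
    \sum_(i < n) theta i ord0 * (k i ord0)%:~R.
Proof.
move=> uL; pose q : 'cV[R]_n := invmx (L^T) *m theta.
exists (col_mx (dsubmx q) (- usubmx q)) => k.
rewrite /pairing col_mxKu col_mxKd dotvNr opprK [dotv (usubmx _) (usubmx _)]dotvC.
rewrite addrC -dotv_split /lattice_pt dotv_mulmx /q mulKVmx ?unitmx_tr//.
by apply: eq_bigr => i _; rewrite mxE.
Qed.

End dual_points.

Section representation_dominates_form.
Context {R : realType} {d : nat}.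
Local Notation C := R[i].
Local Notation n := (d + d)%N.
Local Notation Z := 'cV[int]_n.
Implicit Types (L : 'M[R]_n) (a b : Z -> C) (k l m : Z) (D F : seq Z).
Implicit Types (h u : 'cV[R]_d -> C).
Local Notation ip := (@cinner R _ _ (leb d)).
Local Notation n2 := (@nrm2 R _ _ (leb d)).
Local Notation shift L k := (tfshift (lattice_pt L k)).

(** The phase corrects the cocycle, which makes this the inverse of the unitary
    [shift L l]. *)
Definition inv_shift L l u : 'cV[R]_d -> C := fun t =>
  cexpi (- (2 * pi * lpairing L l l)) * tfshift (- lattice_pt L l) u t.

Definition orbit_sum L D (beta : Z -> C) u : 'cV[R]_d -> C := fun t =>
  \sum_(l <- D) beta l * inv_shift L l u t.

Lemma L2_inv_shift L l u : L2 u -> L2 (inv_shift L l u).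
Proof. by move=> hu; apply: cLp2Z; exact: L2_tfshift. Qed.

Lemma L2_orbit_sum L D beta u : L2 u -> L2 (orbit_sum L D beta u).
Proof.
by move=> hu; apply: cLp2_sum => l; apply: cLp2Z; exact: L2_inv_shift.
Qed.

Lemma ip_orbit_sum L D m (b b' : Z -> C) u y : L2 u ->
  ip (shift L m (orbit_sum L D b (tfshift y u))) (orbit_sum L D b' (tfshift y u)) =
  \sum_(l <- D) \sum_(k <- D) b l * conjc (b' k) *
    (cexpi (2 * pi * (lpairing L m l - lpairing L l l + lpairing L k k
       - lpairing L k (k + m - l))) * ip (shift L (k + m - l) u) u) *
    cexpi (2 * pi * (pairing y (lattice_pt L (k + m - l)) -
       pairing (lattice_pt L (k + m - l)) y)).
Proof.
move=> hu; have hyu : L2 (tfshift y u) by exact: L2_tfshift.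
have hi l : L2 (inv_shift L l (tfshift y u)) by exact: L2_inv_shift.
have -> : shift L m (orbit_sum L D b (tfshift y u)) =
    fun t => \sum_(l <- D) b l * shift L m (inv_shift L l (tfshift y u)) t.
  by apply/funext => t; rewrite /orbit_sum tfshift_sum.
rewrite cinner_suml; [|by move=> l; exact: L2_tfshift|exact: L2_orbit_sum].
apply: eq_bigr => l _; rewrite /orbit_sum cinner_sumr//; last exact: L2_tfshift.
rewrite mulr_sumr; apply: eq_bigr => k _.
rewrite /inv_shift /lpairing ip_tfshift3//.
rewrite -lattice_ptD -lattice_ptB ip_tfshift_conj//; ring.
Qed.

(** By hypothesis each [y j] implements a character of [Z^n], so that the average
    over [j] leaves only the terms with [k + m = l]. *)
Lemma orbit_sum_average L D m (b b' : Z -> C) u N (y : {ffun 'I_n -> 'I_N} -> 'cV[R]_n) :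
  uniq D -> L2 u ->
  (forall j k, pairing (y j) (lattice_pt L k) - pairing (lattice_pt L k) (y j) =
     \sum_(i < n) (j i)%:R / N%:R * (k i ord0)%:~R) ->
  (forall l k i, l \in D -> k \in D -> (`|(k + m - l)%R i ord0| < N)%N) ->
  \sum_j ip (shift L m (orbit_sum L D b (tfshift (y j) u)))
     (orbit_sum L D b' (tfshift (y j) u)) =
  (N%:R ^+ n * n2 u)%:C *
  \sum_(l <- D) \sum_(k <- D | k + m == l)
     b l * conjc (b' k) * cexpi (- (2 * pi * lpairing L k (l - k))).
Proof.
move=> uD hu hy hN.
under eq_bigr do rewrite ip_orbit_sum//.
rewrite exchange_big mulr_sumr; apply: eq_big_seq => l lD /=.
rewrite exchange_big mulr_sumr [RHS]big_mkcond/=; apply: eq_big_seq => k kD /=.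
rewrite -mulr_sumr; under eq_bigr do rewrite hy.
rewrite sum_characters; last by move=> i; exact: hN.
rewrite subr_eq0; case: eqP => [e|_]; last by rewrite mulr0.
rewrite e subrr lattice_pt0.
have -> : ip (tfshift 0 u) u = (n2 u)%:C.
  by rewrite -cinner_self; apply: eq_cintegral => t; rewrite tfshift0.
have -> : m = l - k by rewrite -e addrC addKr.
rewrite rmorphM rmorphXn rmorph_nat.
rewrite (_ : lpairing L k 0 = 0); last first.
  by have := lpairingBr L 0 0 k; rewrite subr0 => ->; rewrite subrr.
rewrite (_ : lpairing L (l - k) l - lpairing L l l + lpairing L k k - 0 =
  - lpairing L k (l - k)); last by rewrite lpairingBl lpairingBr; ring.
by rewrite mulrN; ring.
Qed.

Lemma nrm2_orbit_average L D (b : Z -> C) u N (y : {ffun 'I_n -> 'I_N} -> 'cV[R]_n) :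
  uniq D -> L2 u ->
  (forall j k, pairing (y j) (lattice_pt L k) - pairing (lattice_pt L k) (y j) =
     \sum_(i < n) (j i)%:R / N%:R * (k i ord0)%:~R) ->
  (forall l k i, l \in D -> k \in D -> (`|(k - l)%R i ord0| < N)%N) ->
  \sum_j n2 (orbit_sum L D b (tfshift (y j) u)) =
  N%:R ^+ n * n2 u * \sum_(l <- D) normc (b l) ^+ 2.
Proof.
move=> uD hu hy hN; apply: (@complexI R).
have := @orbit_sum_average L D 0 b b u N y uD hu hy.
under eq_bigr => j _.
  rewrite (_ : shift L 0 _ = orbit_sum L D b (tfshift (y j) u)); last first.
    by apply/funext => t; rewrite lattice_pt0 tfshift0.
  rewrite cinner_self; over.
rewrite -rmorph_sum => ->; last by move=> l k i lD kD; rewrite addr0; exact: hN.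
rewrite [RHS]rmorphM rmorph_sum; congr (_ * _); apply: eq_big_seq => l lD.
rewrite (big_rem l)//= addr0 eqxx big1_seq ?addr0 => [|k /andP[]].
  rewrite subrr (_ : lpairing L l 0 = 0) ?mulr0 ?oppr0 ?cexpi0 ?mulr1 ?mulJc//.
  by have := lpairingBr L 0 0 l; rewrite subr0 => ->; rewrite subrr.
by rewrite addr0 => /eqP ->; rewrite mem_rem_uniqF.
Qed.

Lemma exists_int_bound (s : seq int) : 
  exists2 N : nat, (0 < N)%N & forall q, q \in s -> (`|q| < N)%N.
Proof.
exists (\sum_(q <- s) `|q|).+1 => // q qs; rewrite ltnS (big_rem q)//=; exact: leq_addr.
Qed.

(** Averaging over all characters of [Z^n] projects the matrix coefficients of the
    representation onto those of the regular one; conjugation by time-frequency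
    shifts shows that no character can increase the norm. *)
Lemma op_bound_gram L a M D F (b b' : Z -> C) u : L \in unitmx -> L2 u -> 0 < n2 u ->
  uniq D -> uniq F -> (forall k l, k \in D -> l \in D -> l - k \in F) ->
  (forall h h', L2 h -> L2 h' ->
     Re (\sum_(m <- F) a m * ip (shift L m h) h') <= M / 2 * (n2 h + n2 h')) ->
  Re (gram L a D b b') <= M / 2 * \sum_(k <- D) (normc (b k) ^+ 2 + normc (b' k) ^+ 2).
Proof.
move=> uL hu u0 uD uF DF hM.
have [N N0 hN] := exists_int_bound (allpairs
   (fun (p : Z * Z * Z) (i : 'I_n) => (p.1.1 + p.2 - p.1.2)%R i ord0)
   [seq (q, m) | q <- [seq (k, l) | k <- D, l <- D], m <- 0 :: F] (enum 'I_n)).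
have {}hN m l k (i : 'I_n) : m \in 0 :: F -> l \in D -> k \in D ->
    (`|(k + m - l)%R i ord0| < N)%N.
  move=> mF lD kD; apply: hN.
  apply/allpairsP; exists (((k, l), m), i); split => //; last by rewrite mem_enum.
  by apply/allpairsP; exists ((k, l), m); split => //=; apply/allpairsP; exists (k, l).
have /choice[y hy] (j : {ffun 'I_n -> 'I_N}) : exists y : 'cV[R]_n, forall k,
    pairing y (lattice_pt L k) - pairing (lattice_pt L k) y =
     \sum_(i < n) (j i)%:R / N%:R * (k i ord0)%:~R.
  have [y hy] := character_point (\col_i ((j i)%:R / N%:R)) uL.
  by exists y => k; rewrite hy; apply: eq_bigr => i _; rewrite mxE.
pose V j := orbit_sum L D (fun l => conjc (b' l)) (tfshift (y j) u).
pose V' j := orbit_sum L D (fun l => conjc (b l)) (tfshift (y j) u).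
have LV j : L2 (V j) by apply: L2_orbit_sum; exact: L2_tfshift.
have LV' j : L2 (V' j) by apply: L2_orbit_sum; exact: L2_tfshift.
have c0 : 0 < N%:R ^+ n * n2 u by rewrite mulr_gt0// exprn_gt0// ltr0n.
rewrite -(ler_pM2l c0) -ReZ.
have -> : (N%:R ^+ n * n2 u)%:C * gram L a D b b' =
   \sum_j \sum_(m <- F) a m * ip (shift L m (V j)) (V' j).
  rewrite exchange_big/=.
  rewrite (eq_big_seq (fun m => a m * ((N%:R ^+ n * n2 u)%:C *
    \sum_(l <- D) \sum_(k <- D | k + m == l) conjc (b' l) * conjc (conjc (b k)) *
      cexpi (- (2 * pi * lpairing L k (l - k)))))); last first.
    move=> m mF; rewrite -mulr_sumr; congr (_ * _).
    apply: orbit_sum_average => // l k i lD kD.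
    by apply: hN => //; rewrite inE mF orbT.
  under [RHS]eq_bigr do rewrite mulrCA mulr_sumr.
  rewrite -mulr_sumr exchange_big/=; congr (_ * _).
  rewrite /gram; apply: eq_big_seq => l lD.
  under [RHS]eq_bigr do rewrite mulr_sumr big_mkcond/=.
  rewrite exchange_big/=; apply: eq_big_seq => k kD.
  rewrite (big_rem (l - k)) ?DF//= [k + (l - k)]addrC subrK eqxx.
  rewrite big1_seq ?addr0 => [|m]; last first.
    move=> /andP[_ mF]; case: eqP => // e; move: mF.
    by rewrite mem_rem_uniq// inE -e addrC addKr eqxx.
  rewrite conjcK; ring.
rewrite Re_sum.
apply: (@le_trans _ _ (\sum_j M / 2 * (n2 (V j) + n2 (V' j)))).
  by apply: ler_sum => j _; exact: hM.
rewrite -mulr_sumr big_split/= /V /V'.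
have hN0 l k (i : 'I_n) : l \in D -> k \in D -> (`|(k - l)%R i ord0| < N)%N.
  by move=> lD kD; rewrite -[k]addr0; apply: hN => //; exact: mem_head.
rewrite (nrm2_orbit_average _ uD hu hy hN0) (nrm2_orbit_average _ uD hu hy hN0).
rewrite -mulrDr mulrCA -big_split/= le_eqVlt; apply/orP; left; apply/eqP.
by congr (_ * (_ * _)); apply: eq_bigr => l _; rewrite !normcJ addrC.
Qed.

End representation_dominates_form.

(** * Absolutely convergent sums of time-frequency shifts *)

Section absolutely_summable.
Context {R : realType} {dsp : measure_display} {T : measurableType dsp}.
Variable mu : {measure set T -> \bar R}.
Local Notation C := R[i].
Local Notation n2 := (nrm2 mu).

Lemma einf_bound (u : nat -> \bar R) (x : \bar R) :
  (forall n, (u n <= x)%E) -> (limn_einf u <= x)%E.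
Proof.
move=> h; rewrite limn_einf_lim; apply: lime_le; first exact: is_cvg_einfs.
apply: nearW => n; apply: le_trans (h n); apply: ereal_inf_lbound.
by exists n => /=.
Qed.

(** A series of square integrable functions with summable norms converges almost
    everywhere by monotone convergence, and in norm by Fatou's lemma. *)
Lemma square_integrable_series (F : nat -> T -> C) (c : nat -> R) (B S : R) :
  (forall i, cLp mu 2%:E (F i)) -> (forall i, 0 <= c i) -> 0 <= B -> 0 < S ->
  (forall i, n2 (F i) <= c i ^+ 2 * B) -> (forall n, \sum_(i < n) c i <= S) ->
  exists2 G : T -> C, cLp mu 2%:E G & forall n (e : R), 0 < e ->
    (forall m, \sum_(n <= i < m) c i <= e) ->
    n2 (fun t => G t - \sum_(i < n) F i t) <= e ^+ 2 * B.
Proof.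
move=> LF c0 B0 S0 nF cS.
pose A n t : R := \sum_(i < n) normc (F i t).
pose P n t : C := \sum_(i < n) F i t.
have mF i : cmeasurable (F i) by case: (LF i).
have mA n : measurable_fun setT (A n).
  by apply: measurable_sum => i; exact: measurable_normc.
have mP n : cmeasurable (P n) by apply: cmeasurable_sum.
have A0 n t : 0 <= A n t by apply: sumr_ge0 => i _; exact: normc_ge0.
have ndA t m n : (m <= n)%N -> A m t <= A n t.
  move=> mn; rewrite /A -!(big_mkord xpredT (fun i => normc (F i t))).
  rewrite (big_cat_nat _ mn)//= lerDl; apply: sumr_ge0 => i _; exact: normc_ge0.
have intA n : (\int[mu]_t (A n t ^+ 2)%:E <= (S ^+ 2 * B)%:E)%E.
  have LN i : cLp mu 2%:E (fun t => (normc (F i t))%:C).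
    have /cLp2P[_ j] := LF i; apply/cLp2P; split.
      by apply: cmeasurable_real; exact: measurable_normc.
    by under eq_fun do rewrite normcR ger0_norm ?normc_ge0//.
  have nN i : n2 (fun t => (normc (F i t))%:C) = n2 (F i).
    by apply: eq_Rintegral => t _; rewrite normcR ger0_norm// normc_ge0.
  have h := @nrm2_sum _ _ _ mu _ (index_enum 'I_n) (fun i => c i)
    (fun (i : 'I_n) t => (normc (F i t))%:C) B S (fun i => LN i) (fun i => c0 i) B0.
  have {}h : n2 (fun t => \sum_(i < n) (normc (F i t))%:C) <= S ^+ 2 * B.
    by apply: h => [i| |]; [rewrite nN|exact: S0|exact: cS].
  have /cLp2P[_ j] : cLp mu 2%:E (fun t => \sum_(i < n) (normc (F i t))%:C).
    exact: cLp2_sum.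
  have -> : (\int[mu]_t (A n t ^+ 2)%:E = (n2 (fun t => \sum_(i < n) (normc (F i t))%:C))%:E)%E.
    rewrite fineK; last exact: integrable_fin_num.
    by apply: eq_integral => t _; rewrite -rmorph_sum normcR ger0_norm// A0.
  by rewrite lee_fin.
pose Ainf t := limn (fun n => (A n t ^+ 2)%:E).
have ndA2 t : nondecreasing_seq (fun n => (A n t ^+ 2)%:E : \bar R).
  by move=> m n mn; rewrite lee_fin ler_sqr ?nnegrE ?A0// ndA.
have mA2 n : measurable_fun setT (fun t => (A n t ^+ 2)%:E : \bar R).
  by apply/measurable_EFinP; exact: measurable_funX.
have cA t : (A n t ^+ 2)%:E @[n --> \oo] --> Ainf t.
  exact: ereal_nondecreasing_is_cvgn.
have A20 n t : (0 <= (A n t ^+ 2)%:E :> \bar R)%E by rewrite lee_fin sqr_ge0.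
have iA : mu.-integrable setT Ainf.
  have A00 t : (0 <= Ainf t)%E.
    by apply: lime_ge; [exact: cA|exact: nearW].
  have mAinf : measurable_fun setT Ainf.
    by apply: (emeasurable_fun_cvg _ _ mA2) => t _; exact: cA.
  apply/integrableP; split => //.
  under eq_integral do rewrite gee0_abs//.
  rewrite (@monotone_convergence _ _ _ mu setT measurableT (fun n t => (A n t ^+ 2)%:E)
    mA2 (fun n t _ => A20 n t) (fun t _ => ndA2 t)).
  apply: (@le_lt_trans _ _ (S ^+ 2 * B)%:E); last exact: ltry.
  apply: lime_le; last exact: nearW.
  apply: ereal_nondecreasing_is_cvgn => m n mn; apply: ge0_le_integral => //.
  by move=> t _; exact: ndA2.
have aeA : {ae mu, forall t, Ainf t \is a fin_num}.
  by have := integrable_ae measurableT iA; apply: filterS => t; apply.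
(* upper limits define a measurable function everywhere; off a null set the series
   converges and they are its sum *)
pose G t : C := Complex (fine (limn_esup (fun n => (Re (P n t))%:E)))
                        (fine (limn_esup (fun n => (Im (P n t))%:E))).
have mG : cmeasurable G.
  split; apply: (measurableT_comp (fine_measurable measurableT)) => /=;
    apply: measurable_fun_limn_esup => n; apply/measurable_EFinP; [exact: (mP n).1|exact: (mP n).2].
have good t : Ainf t \is a fin_num ->
   Re (P n t) @[n --> \oo] --> Re (G t) /\ Im (P n t) @[n --> \oo] --> Im (G t).
  move=> fA.
  have bA n : A n t <= 1 + fine (Ainf t).
    have : ((A n t ^+ 2)%:E <= Ainf t)%E.
      by rewrite /Ainf; apply: lime_ge; [exact: cA|exists n => // m nm; exact: ndA2].
    rewrite -(fineK fA) lee_fin; have := A0 n t; nra.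
  have cv (f : C -> R) (fD : forall z w, f (z + w) = f z + f w) (f0 : f 0 = 0) :
    (forall z, `|f z| <= normc z) ->
    f (P n t) @[n --> \oo] --> fine (limn_esup (fun n => (f (P n t))%:E)).
    move=> fn.
    have : cvgn (series (fun i => f (F i t))).
      apply: normed_cvg; apply: nondecreasing_is_cvgn.
        by apply: nondecreasing_series => *; exact: normr_ge0.
      exists (1 + fine (Ainf t)) => _ [n _ <-]; apply: le_trans (bA n).
      have -> : [normed series (fun i => f (F i t))] n = \sum_(i < n) `|f (F i t)|.
        by rewrite -(big_mkord xpredT (fun i => `|f (F i t)|)).
      by apply: ler_sum => i _; exact: fn.
    have -> : series (fun i => f (F i t)) = fun n => f (P n t).
      apply/funext => n; rewrite /series/= big_mkord /P.
      by elim/big_rec2 : _ => // i x y _ ->; rewrite fD.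
    move=> cf; have : (f (P n t))%:E @[n --> \oo] --> (limn (fun n => f (P n t)))%:E.
      by apply: cvg_EFin; [exact: nearW|exact: cf].
    by move=> /cvg_limn_einf_sup[_ ->]; exact: cf.
  by split; [apply: cv; [exact: ReD| |exact: ler_abs_Re]|
             apply: cv; [exact: ImD| |exact: ler_abs_Im]].
have key n (e : R) : 0 < e -> (forall m, \sum_(n <= i < m) c i <= e) ->
    (\int[mu]_t (normc (G t - P n t) ^+ 2)%:E <= (e ^+ 2 * B)%:E)%E.
  move=> e0 ce.
  pose f m t := (normc (P (n + m)%N t - P n t) ^+ 2)%:E.
  have mf m : measurable_fun setT (f m).
    apply/measurable_EFinP; apply: measurable_normc2.
    by apply: cmeasurableD => //; exact: cmeasurableN.
  have f0 m t : (0 <= f m t)%E by rewrite lee_fin sqr_ge0.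
  have -> : (\int[mu]_t (normc (G t - P n t) ^+ 2)%:E =
      \int[mu]_t limn_einf (f ^~ t))%E.
    apply: ge0_ae_eq_integral => //.
    - apply/measurable_EFinP; apply: measurable_normc2.
      by apply: cmeasurableD => //; exact: cmeasurableN.
    - under eq_fun do rewrite /limn_einf.
      apply: measurableT_comp => //; apply: measurable_fun_limn_esup => m.
      by apply: measurableT_comp.
    - by move=> t _; rewrite lee_fin sqr_ge0.
    - move=> t _; rewrite limn_einf_lim; apply: lime_ge; first exact: is_cvg_einfs.
      by apply: nearW => m; apply: le_ereal_inf_tmp => _ [k _ <-].
    apply: filterS aeA => t ft _; have [g1 g2] := good t ft.
    suff /cvg_limn_einf_sup[-> _] : f m t @[m --> \oo] --> (normc (G t - P n t) ^+ 2)%:E.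
      by [].
    apply: cvg_EFin; first exact: nearW.
    rewrite /comp /f /= normcE2; under eq_cvg do rewrite normcE2.
    have sh (g : nat -> R) (l : R) : g k @[k --> \oo] --> l -> g (n + m)%N @[m --> \oo] --> l.
      rewrite -(cvg_shiftn n) => h; rewrite (_ : (fun m => g (n + m)%N) = [sequence g (m + n)%N]_m)//.
      by apply/funext => m; rewrite addnC.
    apply: cvgD; rewrite expr2; under eq_cvg do rewrite expr2.
      have h : Re (P (n + m)%N t - P n t) @[m --> \oo] --> Re (G t - P n t).
        rewrite ReB; under eq_cvg do rewrite ReB.
        by apply: cvgB; [exact: (sh (fun k => Re (P k t)) _ g1)|exact: cvg_cst].
      exact: cvgM.
    have h : Im (P (n + m)%N t - P n t) @[m --> \oo] --> Im (G t - P n t).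
      rewrite ImD ImN; under eq_cvg do rewrite ImD ImN.
      by apply: cvgB; [exact: (sh (fun k => Im (P k t)) _ g2)|exact: cvg_cst].
    exact: cvgM.
  apply: (le_trans (fatou mu measurableT mf (fun m t _ => f0 m t))).
  apply: einf_bound => m.
  have PE t : P (n + m)%N t - P n t = \sum_(n <= i < n + m) F i t.
    rewrite /P -!(big_mkord xpredT (fun i => F i t)) (big_cat_nat _ (leq_addr m n))//=.
    by rewrite addrAC subrr add0r.
  have LS : cLp mu 2%:E (fun t => \sum_(n <= i < n + m) F i t) by exact: cLp2_sum.
  have /cLp2P[_ j] := LS.
  have -> : (\int[mu]_t f m t = (n2 (fun t => \sum_(n <= i < n + m) F i t))%:E)%E.
    rewrite fineK; last exact: integrable_fin_num.
    by apply: eq_integral => t _; rewrite /f PE.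
  by rewrite lee_fin; exact: (@nrm2_sum _ _ _ mu _ _ c).
have LGP n (e : R) : 0 < e -> (forall m, \sum_(n <= i < m) c i <= e) ->
    cLp mu 2%:E (fun t => G t - P n t).
  move=> e0 ce; apply/cLp2P.
  have m2 : cmeasurable (fun t => G t - P n t).
    by apply: cmeasurableD => //; exact: cmeasurableN.
  split => //; apply/integrableP; split.
    by apply/measurable_EFinP; exact: measurable_normc2.
  under eq_integral do rewrite gee0_abs ?lee_fin ?sqr_ge0//.
  exact: le_lt_trans (key n e e0 ce) (ltry _).
exists G.
  have := LGP 0 S S0; rewrite (_ : (fun t => G t - P 0 t) = G).
    by apply=> m; rewrite big_mkord.
  by apply/funext => t; rewrite /P big_ord0 subr0.
move=> n e e0 ce; rewrite -lee_fin.
have /cLp2P[_ j] := LGP n e e0 ce.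
apply: le_trans (key n e e0 ce).
rewrite fineK//; exact: integrable_fin_num.
Qed.

End absolutely_summable.

Section operator_norm.
Context {R : realType} {d : nat}.
Local Notation C := R[i].
Local Notation n := (d + d)%N.
Local Notation Z := 'cV[int]_n.
Implicit Types (L : 'M[R]_n) (a : Z -> C) (k m : Z).
Implicit Types (h u : 'cV[R]_d -> C).
Local Notation n2 := (@nrm2 R _ _ (leb d)).
Local Notation shift L k := (tfshift (lattice_pt L k)).
Local Notation l1 := (wl1 (fun=> 1)).

Lemma L2norm_le h u (c : R) : L2 h -> L2 u -> 0 <= c ->
  (L2norm u <= c%:E * L2norm h)%E = (n2 u <= c ^+ 2 * n2 h).
Proof.
move=> hh hu c0; rewrite /L2norm !cLnorm2_nrm2// -EFinM lee_fin.
rewrite -{1}(ger0_norm c0) -sqrtr_sqr -sqrtrM ?sqr_ge0// ler_sqrt//.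
by rewrite mulr_ge0 ?sqr_ge0 ?nrm2_ge0.
Qed.

Lemma opnorm_ge0 (T : @L2op R d) : (0 <= opnorm T)%E.
Proof. by apply: le_ereal_inf_tmp => _ [c [c0 _] <-]; rewrite lee_fin. Qed.

Lemma opnorm_le (T : @L2op R d) (c : R) : 0 <= c ->
  (forall h, L2 h -> L2 (T h)) -> (forall h, L2 h -> n2 (T h) <= c ^+ 2 * n2 h) ->
  (opnorm T <= c%:E)%E.
Proof.
move=> c0 LT hT; apply: ereal_inf_lbound; exists c => //; split => // h hh.
by rewrite L2norm_le//; [exact: hT|exact: LT].
Qed.

Lemma opnorm_lt (T : @L2op R d) (c : R) : (forall h, L2 h -> L2 (T h)) ->
  (opnorm T < c%:E)%E -> 0 <= c /\ forall h, L2 h -> n2 (T h) <= c ^+ 2 * n2 h.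
Proof.
move=> LT /ereal_inf_lt[_ [c' [c'0 hc'] <-]]; rewrite lte_fin => cc'.
have c0 := le_trans c'0 (ltW cc'); split => // h hh.
rewrite -L2norm_le//; last exact: LT.
apply: (le_trans (hc' h hh)); apply: lee_wpmul2r; last by rewrite lee_fin ltW.
by rewrite /L2norm cLnorm2_nrm2// lee_fin sqrtr_ge0.
Qed.

Lemma wl1_tail a S (e : R) : l1 a S -> 0 < e ->
  exists F0 : {fset Z}, forall s, uniq s -> (forall k, k \in s -> k \notin F0) ->
    \sum_(k <- s) normc (a k) <= e.
Proof.
move=> aS e0.
pose E := [set \sum_(k <- s) normc (a k) | s in [set s : seq Z | uniq s]].
have hE : has_sup E.
  split; first by exists (\sum_(k <- [::]) normc (a k)); exists [::].
  exists S => _ [s us <-]; have := aS s us.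
  by under eq_bigr do rewrite mul1r.
have [_ [s0 us0 <-] hs0] := sup_adherent e0 hE.
exists [fset k in s0]%fset => s us dis.
have : \sum_(k <- s0 ++ s) normc (a k) <= sup E.
  apply: ub_le_sup; first exact: hE.2.
  exists (s0 ++ s) => //=; rewrite cat_uniq us0 us andbT/=.
  apply/hasPn => k ks; have := dis k ks; by rewrite inE.
rewrite big_cat/=; lra.
Qed.

Lemma L2_integrated_partial L a F h : L2 h -> L2 (integrated_partial L a F h).
Proof. by move=> hh; apply: cLp2_sum => k; apply: cLp2Z; exact: L2_tfshift. Qed.

Lemma nrm2_shift_sum L a (s : seq Z) h (M : R) : L2 h -> 0 < M ->
  \sum_(k <- s) normc (a k) <= M ->
  n2 (fun t => \sum_(k <- s) a k * shift L k h t) <= M ^+ 2 * n2 h.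
Proof.
move=> hh M0 aM; apply: (@nrm2_sum _ _ _ _ _ s (fun k => normc (a k))
    (fun k t => a k * shift L k h t)) => //.
- by move=> k; apply: cLp2Z; exact: L2_tfshift.
- by move=> k; exact: normc_ge0.
- exact: nrm2_ge0.
- by move=> k; rewrite nrm2Z ?nrm2_tfshift//; exact: L2_tfshift.
Qed.

Lemma nrm2_triangle (x y B : R) (f g : 'cV[R]_d -> C) : 0 < x -> 0 < y -> 0 <= B ->
  L2 f -> L2 g -> n2 f <= x ^+ 2 * B -> n2 g <= y ^+ 2 * B ->
  n2 (fun t => f t + g t) <= (x + y) ^+ 2 * B.
Proof.
move=> x0 y0 B0 hf hg nf ng.
have := @nrm2_sum _ _ _ (leb d) bool [:: true; false] (fun i : bool => if i then x else y)
  (fun i : bool => if i then f else g) B (x + y).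
rewrite !big_cons !big_nil addr0 => h.
rewrite (_ : (fun t => f t + g t) =
  fun t => \sum_(i <- [:: true; false]) (if i then f else g) t); last first.
  by apply/funext => t; rewrite !big_cons big_nil addr0.
by apply: h => //; [case|case; rewrite ltW|case|rewrite addr_gt0].
Qed.

Lemma integrated_partial_sym_diff L a (F F0 : {fset Z}) (s : seq Z) h (e : R) : L2 h -> 0 < e ->
  uniq s -> {subset F0 <= F} -> {subset F0 <= s} ->
  (forall s, uniq s -> (forall k, k \in s -> k \notin F0) ->
    \sum_(k <- s) normc (a k) <= e) ->
  n2 (fun t => \sum_(k <- s) a k * shift L k h t - integrated_partial L a F h t)
  <= (e + e) ^+ 2 * n2 h.
Proof.
move=> hh e0 us F0F F0s tail.
pose s1 := [seq k <- s | k \notin F]; pose s2 := [seq k <- F | k \notin s].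
have -> : (fun t => \sum_(k <- s) a k * shift L k h t - integrated_partial L a F h t) =
    fun t => \sum_(k <- s1) a k * shift L k h t +
      \sum_(k <- s2) (- a k) * shift L k h t.
  apply/funext => t; rewrite /integrated_partial.
  rewrite (bigID (mem F) predT)/= [X in _ - X](bigID (mem s) predT)/= opprD addrACA.
  rewrite !big_filter; under [X in _ = _ + X]eq_bigr do rewrite mulNr.
  rewrite sumrN [X in X + _](_ : _ = 0) ?add0r//.
    apply/eqP; rewrite subr_eq0; apply/eqP.
    rewrite -big_filter -[RHS]big_filter; apply: perm_big; apply: uniq_perm.
    - exact: filter_uniq.
    - exact/filter_uniq/fset_uniq.
    - by move=> k; rewrite !mem_filter andbC.
have t1 : \sum_(k <- s1) normc (a k) <= e.
  apply: tail; first exact: filter_uniq.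
  by move=> k; rewrite mem_filter => /andP[kF _]; apply: contra kF; exact: F0F.
have t2 : \sum_(k <- s2) normc (- a k) <= e.
  under eq_bigr do rewrite normcN; apply: tail; first exact/filter_uniq/fset_uniq.
  by move=> k; rewrite mem_filter => /andP[kF _]; apply: contra kF; exact: F0s.
apply: nrm2_triangle => //; first exact: nrm2_ge0.
- by apply: cLp2_sum => k; apply: cLp2Z; exact: L2_tfshift.
- by apply: cLp2_sum => k; apply: cLp2Z; exact: L2_tfshift.
- exact: nrm2_shift_sum.
- exact: nrm2_shift_sum.
Qed.

(** The lattice is summed along an enumeration; any finite set containing [F0]
    differs from a long initial segment by points of the tail only. *)
Lemma exists_integrated_fun L a S h : l1 a S -> L2 h ->
  exists2 G : 'cV[R]_d -> C, L2 G &
    forall (F F0 : {fset Z}) (e : R), 0 < e -> {subset F0 <= F} ->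
    (forall s, uniq s -> (forall k, k \in s -> k \notin F0) ->
       \sum_(k <- s) normc (a k) <= e) ->
    n2 (fun t => G t - integrated_partial L a F h t) <= (e + (e + e)) ^+ 2 * n2 h.
Proof.
move=> aS hh.
pose pinv : nat -> option Z := pickle_inv.
have pinvK i k : pinv i = Some k -> choice.pickle k = i.
  by move=> e; have := @pickle_invK Z i; rewrite -/(pinv i) e.
pose F i t : C := if pinv i is Some k then a k * shift L k h t else 0.
pose c i : R := if pinv i is Some k then normc (a k) else 0.
pose en N : seq Z := pmap (pinv) (iota 0 N).
have en_uniq (m N : nat) : uniq (pmap (pinv) (iota m N)).
  elim: N m => //= N IH m; case E: (pinv m) => [k|] //=; rewrite IH andbT.
  rewrite mem_pmap; apply/mapP => -[j]; rewrite mem_iota => /andP[mj _] /esym.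
  move=> /pinvK im; move: mj; have := pinvK _ _ E; rewrite im => ->.
  by rewrite ltnn.
have sumF (m N : nat) t : \sum_(m <= i < m + N) F i t =
    \sum_(k <- pmap (pinv) (iota m N)) a k * shift L k h t.
  rewrite /index_iota addKn; elim: N m => [|N IH] m; first by rewrite !big_nil.
  by rewrite /= big_cons IH /F; case: (pinv m) => [k|]; rewrite ?big_cons ?add0r.
have sumc (m N : nat) : \sum_(m <= i < m + N) c i =
    \sum_(k <- pmap (pinv) (iota m N)) normc (a k).
  rewrite /index_iota addKn; elim: N m => [|N IH] m; first by rewrite !big_nil.
  by rewrite /= big_cons IH /c; case: (pinv m) => [k|]; rewrite ?big_cons ?add0r.
have S0 := wl1_ge0 aS.
have cS N : \sum_(i < N) c i <= S + 1.
  have := sumc 0%N N; rewrite add0n big_mkord => ->.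
  have := aS _ (en_uniq 0%N N); under eq_bigr do rewrite mul1r; lra.
have [|||||N|G LG hG] := @square_integrable_series _ _ _ (leb d) F c (n2 h) (S + 1).
- move=> i; rewrite /F; case: (pinv i) => [k|]; last exact: cLp2_0.
  by apply: cLp2Z; exact: L2_tfshift.
- by move=> i; rewrite /c; case: (pinv i) => [k|//]; exact: normc_ge0.
- exact: nrm2_ge0.
- by rewrite ltr_wpDl.
- move=> i; rewrite /F /c; case: (pinv i) => [k|].
    by rewrite nrm2Z ?nrm2_tfshift//; exact: L2_tfshift.
  rewrite expr0n/= mul0r /nrm2; under eq_Rintegral do rewrite ComplexField.Normc.normc0 expr0n/=.
  by rewrite /Rintegral integral0.
- exact: cS.
exists G => // F1 F0 e e0 F0F tail.
pose N := (\sum_(k <- F0) (choice.pickle k).+1)%N.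
have F0N k : k \in F0 -> (choice.pickle k < N)%N.
  by move=> kF; rewrite /N (big_rem k)//= leq_addr.
have enE k (m M' : nat) : (k \in pmap (pinv) (iota m M')) = (m <= choice.pickle k < m + M')%N.
  rewrite mem_pmap -mem_iota; apply/mapP/idP => [[i ii ik]|kk].
    by rewrite (pinvK i k).
  by exists (choice.pickle k) => //; rewrite /pinv pickleK_inv.
have := hG N e e0; rewrite (_ : (fun t => G t - \sum_(i < N) F i t) =
    fun t => G t - \sum_(k <- en N) a k * shift L k h t); last first.
  by apply/funext => t; have := sumF 0%N N t; rewrite add0n big_mkord => ->.
move=> h1; have {}h1 : n2 (fun t => G t - \sum_(k <- en N) a k * shift L k h t)
   <= e ^+ 2 * n2 h.
  apply: h1 => m; have [mN|Nm] := leqP m N; first by rewrite big_geq// ltW.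
  rewrite -(subnKC (ltnW Nm)) sumc; apply: tail; first exact: en_uniq.
  move=> k; rewrite enE => /andP[Nk _]; apply/negP => /F0N.
  by rewrite ltnNge Nk.
rewrite (_ : (fun t => _) = fun t =>
   (G t - \sum_(k <- en N) a k * shift L k h t) +
   (\sum_(k <- en N) a k * shift L k h t - integrated_partial L a F1 h t)); last first.
  by apply/funext => t; rewrite addrA subrK.
have LE : L2 (fun t => \sum_(k <- en N) a k * shift L k h t).
  by apply: cLp2_sum => k; apply: cLp2Z; exact: L2_tfshift.
apply: nrm2_triangle => //.
- by rewrite addr_gt0.
- exact: nrm2_ge0.
- exact: cLp2B.
- by apply: cLp2B => //; exact: L2_integrated_partial.
- apply: (@integrated_partial_sym_diff L a F1 F0) => //; first exact: en_uniq.
  by move=> k kF; rewrite enE/= add0n F0N.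
Qed.

Lemma exists_is_integrated L a S : l1 a S -> exists T, is_integrated L a T.
Proof.
move=> aS.
have /choice[G hG] (h : 'cV[R]_d -> C) : exists G, L2 h -> L2 G /\
    forall (F F0 : {fset Z}) (e : R), 0 < e -> {subset F0 <= F} ->
    (forall s, uniq s -> (forall k, k \in s -> k \notin F0) ->
       \sum_(k <- s) normc (a k) <= e) ->
    n2 (fun t => G t - integrated_partial L a F h t) <= (e + (e + e)) ^+ 2 * n2 h.
  have [hh|nh] := pselect (L2 h); last by exists h.
  by have [G LG hG] := @exists_integrated_fun L a S h aS hh; exists G.
have tF : ProperFilter (@summability.totally Z) := summability.totally_filter.
exists G; split; first by move=> h hh; exact: (hG h hh).1.
have opF (e : R) : 0 < e -> \forall F \near summability.totally,
    (opnorm (fun h t => (G h t - integrated_partial L a F h t)%R) <= e%:E)%E.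
  move=> e0; have e30 : 0 < e / 3 by rewrite divr_gt0.
  have [F0 tail] := wl1_tail aS e30.
  exists F0 => // F F0F; apply: opnorm_le; first exact: ltW.
    move=> h hh; apply: cLp2B; first exact: (hG h hh).1.
    exact: L2_integrated_partial.
  move=> h hh; have := (hG h hh).2 F F0 (e / 3) e30 _ tail.
  rewrite (_ : e / 3 + (e / 3 + e / 3) = e); last by field.
  by apply; move=> k kF0; exact: (fsubsetP F0F).
apply/fine_cvgP; split.
  apply: filterS (opF 1 ltr01) => F hF.
  rewrite ge0_fin_numE; last exact: opnorm_ge0.
  exact: le_lt_trans hF (ltry _).
apply/cvgrPdist_le => e e0; apply: filterS (opF e e0) => F hF.
rewrite sub0r normrN /= ger0_norm; last by rewrite fine_ge0// opnorm_ge0.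
rewrite -lee_fin fineK//.
rewrite ge0_fin_numE; last exact: opnorm_ge0.
exact: le_lt_trans hF (ltry _).
Qed.

End operator_norm.

(** * Operator norm and Bessel bound as norms of the form *)

Lemma sqrt_sqrD {R : realType} (x e : R) : 0 <= x -> 0 <= e ->
  Num.sqrt (x + e ^+ 2) <= Num.sqrt x + e.
Proof.
move=> x0 e0; rewrite -ler_sqr ?nnegrE ?addr_ge0 ?sqrtr_ge0//.
rewrite sqr_sqrtr ?addr_ge0 ?sqr_ge0// sqrrD sqr_sqrtr// addrAC lerDl.
by rewrite mulrn_wge0// mulr_ge0// sqrtr_ge0.
Qed.

Section norms.
Context {R : realType} {d : nat}.
Local Notation C := R[i].
Local Notation n := (d + d)%N.
Local Notation Z := 'cV[int]_n.
Implicit Types (L : 'M[R]_n) (a : Z -> C) (k l m : Z) (D : seq Z).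
Implicit Types (h u f : 'cV[R]_d -> C).
Local Notation ip := (@cinner R _ _ (leb d)).
Local Notation n2 := (@nrm2 R _ _ (leb d)).
Local Notation shift L k := (tfshift (lattice_pt L k)).
Local Notation l1 := (wl1 (fun=> 1)).

(** The norm of twisted convolution by [a] on square-summable sequences. *)
Definition gramnorm L a : R := inf [set M | gram_bound L a M].

Lemma gram_bound_l1 L a S : l1 a S -> gram_bound L a S.
Proof. by move=> aS D b b' uD; exact: Re_gram_l1. Qed.

Lemma gramnorm_le L a M : gram_bound L a M -> gramnorm L a <= M.
Proof.
by move=> h; apply: ge_inf => //; exists 0 => x /gram_bound_ge0.
Qed.

Lemma gram_bound_closed L a M : (forall e, 0 < e -> gram_bound L a (M + e)) ->
  gram_bound L a M.
Proof.
move=> h D b b' uD; apply/ler_addgt0Pr => e e0.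
set s := \sum_(k <- D) _.
have s0 : 0 <= s by apply: sumr_ge0 => k _; rewrite addr_ge0 ?sqr_ge0.
have e' : 0 < e / (s + 1) by rewrite divr_gt0// ltr_wpDl.
apply: (le_trans (h _ e' D b b' uD)); rewrite -/s !mulrDl lerD2l.
rewrite (_ : e / (s + 1) / 2 * s = e * (s / 2 / (s + 1))); last by ring.
by rewrite -[leRHS]mulr1 ler_pM2l// ler_pdivrMr ?ltr_wpDl//; lra.
Qed.

Lemma gramnorm_bound L a S : l1 a S -> gram_bound L a (gramnorm L a).
Proof.
move=> aS; apply: gram_bound_closed => e e0.
have hE : has_inf [set M | gram_bound L a M].
  split; first by exists S; exact: gram_bound_l1.
  by exists 0 => x /gram_bound_ge0.
have [M hM Me] := inf_adherent e0 hE.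
move=> D b b' uD; apply: (le_trans (hM D b b' uD)).
rewrite ler_wpM2r//.
  by apply: sumr_ge0 => k _; rewrite addr_ge0 ?sqr_ge0.
by rewrite ler_wpM2r// ltW.
Qed.

Lemma gramnorm_ge0 L a S : l1 a S -> 0 <= gramnorm L a.
Proof. by move=> /(gramnorm_bound L)/gram_bound_ge0. Qed.

Lemma ip_integrated_partial L a F h u : L2 h -> L2 u ->
  ip (integrated_partial L a F h) u = \sum_(m <- F) a m * ip (shift L m h) u.
Proof.
by move=> hh hu; rewrite /integrated_partial cinner_suml// => k; exact: L2_tfshift.
Qed.

Lemma l1_cutoff a (F F0 : {fset Z}) (e : R) : {subset F0 <= F} ->
  (forall s, uniq s -> (forall k, k \in s -> k \notin F0) ->
     \sum_(k <- s) normc (a k) <= e) ->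
  l1 (fun m => (if m \in F then a m else 0) - a m) e.
Proof.
move=> F0F tail s us; under eq_bigr do rewrite mul1r.
rewrite (bigID (mem F))/= big1 ?add0r => [|m mF]; last first.
  by rewrite mF subrr ComplexField.Normc.normc0.
rewrite -big_filter; under eq_big_seq.
  move=> m; rewrite mem_filter => /andP[mF _]; rewrite (negbTE mF) sub0r normcN; over.
apply: tail; first exact: filter_uniq.
by move=> k; rewrite mem_filter => /andP[kF _]; apply: contra kF; exact: F0F.
Qed.

(** The norm of the operator is that of the twisted convolution form: amenability
    of [Z^n] gives one inequality, invertibility of the lattice the other. *)
Lemma opnorm_integrated L a S u : L \in unitmx -> L2 u -> 0 < n2 u -> l1 a S ->
  opnorm (integrated L a) = (gramnorm L a)%:E.
Proof.
move=> uL hu u0 aS.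
have [LT cT] : is_integrated L a (integrated L a).
  by have [T hT] := exists_is_integrated L aS; apply: (xgetPex _ (ex_intro _ T hT)).
set T := integrated L a in LT cT *.
have tF : ProperFilter (@summability.totally Z) := summability.totally_filter.
(* the unconditional sum allows [F] to contain any prescribed finite set [G]: below,
   all differences of points of [D] *)
have approx (e : R) (G : {fset Z}) : 0 < e -> exists2 F : {fset Z}, {subset G <= F} &
   l1 (fun m => (if m \in F then a m else 0) - a m) e /\
   forall h, L2 h -> n2 (fun t => T h t - integrated_partial L a F h t) <= e ^+ 2 * n2 h.
  move=> e0; have [F0 tail] := wl1_tail aS e0.
  have h1 : \forall F \near summability.totally,
     (opnorm (fun h t => (T h t - integrated_partial L a F h t)%R) < e%:E)%E.
    have /fine_cvgP[fT /cvgrPdist_lt/(_ e e0)] := cT.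
    apply: filterS2 fT => F fT; rewrite sub0r normrN ger0_norm.
      by rewrite -lte_fin fineK.
    by rewrite fine_ge0// opnorm_ge0.
  have h2 : \forall F \near summability.totally, (F0 `|` G `<=` F)%fset.
    by exists (F0 `|` G)%fset.
  have [F [hF1 hF2]] := filter_ex (filterI h1 h2).
  exists F.
    by move=> k kG; apply: (fsubsetP hF2); rewrite in_fsetU kG orbT.
  split.
    apply: l1_cutoff tail => k kF; apply: (fsubsetP hF2); by rewrite in_fsetU kF.
  move=> h hh; have LD h' : L2 h' -> L2 (fun t => T h' t - integrated_partial L a F h' t).
    by move=> hh'; apply: cLp2B; [exact: LT|exact: L2_integrated_partial].
  by have [_] := opnorm_lt LD hF1; apply.
have gN := gramnorm_bound L aS; have N0 := gramnorm_ge0 L aS.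
set N := gramnorm L a in gN N0 *.
apply/eqP; rewrite eq_le; apply/andP; split.
  apply/lee_addgt0Pr => e e0; rewrite -EFinD.
  apply: opnorm_le => //; first by rewrite addr_ge0// ltW.
  move=> h hh; have e20 : 0 < e / 2 by rewrite divr_gt0.
  have [F _ [aF TF]] := approx (e / 2) fset0 e20.
  have gF := gram_bound_perturb gN aF.
  have LP := L2_integrated_partial L a F hh.
  have nP : n2 (integrated_partial L a F h) <= (N + e / 2) ^+ 2 * n2 h.
    apply: nrm2_bound => //; first by rewrite ltr_wpDl.
    move=> g Lg; rewrite ip_integrated_partial//.
    rewrite (eq_big_seq (fun m => (if m \in F then a m else 0) * ip (shift L m h) g)).
      apply: gram_bound_op => //; first exact: fset_uniq.
      by move=> m mF; rewrite (negbTE mF).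
    by move=> m mF; rewrite mF.
  rewrite (_ : T h = fun t => integrated_partial L a F h t +
    (T h t - integrated_partial L a F h t)); last first.
    by apply/funext => t; rewrite addrC subrK.
  rewrite (_ : N + e = (N + e / 2) + e / 2); last by field.
  apply: nrm2_triangle => //.
  - by rewrite ltr_wpDl.
  - exact: nrm2_ge0.
  - by apply: cLp2B => //; exact: LT.
  - exact: TF.
apply: le_ereal_inf_tmp => _ [c [c0 hc] <-]; rewrite lee_fin.
apply: gramnorm_le; apply: gram_bound_closed => e e0 D b b' uD.
have [F DF [aF TF]] := approx e [fset l - k | l in D, k in D]%fset e0.
apply: (@op_bound_gram R d L a (c + e) D F b b' u) => //.
- exact: fset_uniq.
- move=> k l kD lD; apply: DF; apply/imfset2P; exists l => //.
  by exists k.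
move=> h h' hh hh'; rewrite -ip_integrated_partial//.
have LP := L2_integrated_partial L a F hh.
rewrite (_ : integrated_partial L a F h = fun t => T h t -
    (T h t - integrated_partial L a F h t)); last first.
  by apply/funext => t; rewrite opprB addrC subrK.
have LTP : L2 (fun t => T h t - integrated_partial L a F h t).
  by apply: cLp2B => //; exact: LT.
rewrite cinnerBl//; last exact: LT.
rewrite ReB -ReN mulrDl mulrDl; apply: lerD.
  apply: Re_cinner_bound => //; [exact: nrm2_ge0|exact: LT|].
  by rewrite -L2norm_le//; [exact: hc|exact: LT].
have -> : - ip (fun t => T h t - integrated_partial L a F h t) h' =
   ip (fun t => - 1 * (T h t - integrated_partial L a F h t)) h'.
  by rewrite cinnerZl// mulN1r.
apply: Re_cinner_bound => //; [exact: ltW|exact: nrm2_ge0|exact: cLp2Z|].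
by rewrite nrm2Z// normcN ComplexField.Normc.normc1 expr1n mul1r; exact: TF.
Qed.

Lemma gram_module_inner L f D (b b' : Z -> C) : L2 f ->
  gram L (module_inner L f f) D b b' =
  ip (fun t => \sum_(l <- D) b l * shift L l f t)
     (fun t => \sum_(k <- D) b' k * shift L k f t).
Proof.
move=> hf; have Ls k : L2 (shift L k f) by exact: L2_tfshift.
rewrite cinner_suml//; last by apply: cLp2_sum => k; exact: (cLp2Z _ (Ls k)).
rewrite /gram exchange_big/=; apply: eq_bigr => l _.
rewrite (@cinner_sumr _ _ _ (leb d) _ D b' (fun k => shift L k f))//; last exact: Ls.
rewrite [RHS]mulr_sumr; apply: eq_bigr => k _.
rewrite -mulrA; congr (_ * (_ * _)).
transitivity (conjc (ip (shift L k f) (shift L l f))); last first.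
    by apply/esym; apply: cinner_conj; exact: Ls.
  rewrite ip_tfshift2// conjcM -cexpiN -lattice_ptB.
by rewrite -cinner_conj//; exact: L2_tfshift.
Qed.

(** Analysis and synthesis are adjoint, so the Bessel bound of the Gabor system is
    the bound of its Gram form. *)
Lemma bessel_gram_bound L f (c : R) : L2 f -> 0 < c ->
  (forall h, L2 h -> (\esum_(k in [set: Z])
          (normc (cinner (leb d) h (tfshift (lattice_pt L k) f)) ^+ 2)%:E
        <= c%:E * L2norm h ^+ 2)%E) <->
  gram_bound L (module_inner L f f) c.
Proof.
move=> hf c0; have Ls k : L2 (shift L k f) by exact: L2_tfshift.
have LS D (b : Z -> C) : L2 (fun t => \sum_(l <- D) b l * shift L l f t).
  by apply: cLp2_sum => l; exact: (cLp2Z _ (Ls l)).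
have nrmE h : L2 h -> (c%:E * L2norm h ^+ 2 = (c * n2 h)%:E)%E.
  move=> hh; rewrite /L2norm cLnorm2_nrm2// -EFin_expe -EFinM.
  by rewrite sqr_sqrtr ?nrm2_ge0.
split=> [bes D b b' uD|gb h hh].
  rewrite gram_module_inner//.
  have syn (b0 : Z -> C) : n2 (fun t => \sum_(l <- D) b0 l * shift L l f t) <=
      c * \sum_(l <- D) normc (b0 l) ^+ 2.
    set v := fun t => _; have Lv : L2 v by exact: LS.
    have hv : \sum_(k <- D) normc (ip v (shift L k f)) ^+ 2 <= c * n2 v.
      rewrite -lee_fin -nrmE//; apply: le_trans (bes v Lv).
      rewrite -sumEFin; apply: ereal_sup_ubound; exists [set` D].
        by split => //; exact: finite_seq.
      by rewrite -fsbig_seq.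
    have : n2 v <= \sum_(l <- D) (c * normc (b0 l) ^+ 2 +
        normc (ip v (shift L l f)) ^+ 2 / c) / 2.
      have -> : n2 v = Re (\sum_(l <- D) b0 l * ip (shift L l f) v).
        by rewrite -(@cinner_suml _ _ _ (leb d) _ D b0 (fun k => shift L k f))// cinner_self.
      rewrite Re_sum; apply: ler_sum => l _; apply: (le_trans (ler_Re _)).
      rewrite normcM (cinner_conj Lv (Ls l)) normcJ ler_pdivlMr//.
      set x := normc _; set y := normc _.
      have -> : c * x ^+ 2 + y ^+ 2 / c = (c * x - y) ^+ 2 / c + x * y * 2.
        by field; rewrite gt_eqF.
      by rewrite lerDr divr_ge0 ?sqr_ge0// ltW.
    rewrite -mulr_suml big_split/= -mulr_sumr -mulr_suml.
    have : (\sum_(i <- D) normc (ip v (shift L i f)) ^+ 2) / c <= n2 v.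
      by rewrite ler_pdivrMr// mulrC.
    lra.
  apply: (le_trans (Re_cinner_AMGM (LS D b) (LS D b'))).
  rewrite big_split/=; have := syn b; have := syn b'; lra.
rewrite nrmE//; apply: ge_ereal_sup => _ [X [fX _] <-].
have [s us ->] : exists2 s : seq Z, uniq s & X = [set` s].
  by exists (fset_set X); [exact: fset_uniq|rewrite fset_setK].
rewrite -fsbig_seq// sumEFin lee_fin.
pose b k := ip h (shift L k f); pose u t := \sum_(l <- s) b l * shift L l f t.
set S := \sum_(k <- s) _.
have S0 : 0 <= S by apply: sumr_ge0 => k _; exact: sqr_ge0.
have hu : ip h u = S%:C.
  rewrite /u cinner_sumr// rmorph_sum; apply: eq_bigr => k _.
  by rewrite -/(b k) mulrC mulJc.
have nu : n2 u <= c * S.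
  have := gb s b b us; rewrite gram_module_inner// cinner_self /= big_split/= -/S.
  by rewrite -/u; lra.
have := cauchy_schwarz hh (LS s b); rewrite -/u hu normcR (ger0_norm S0).
move=> cs; have h0 := nrm2_ge0 (leb d) h.
have [->|Sn] := eqVneq S 0; first by rewrite mulr_ge0// ltW.
have Sp : 0 < S by rewrite lt_neqAle eq_sym Sn.
rewrite -(ler_pM2l Sp) -expr2; apply: (le_trans cs).
by rewrite mulrA [leRHS]mulrC ler_wpM2l// [leRHS]mulrC.
Qed.

Lemma heisenberg_gramnorm L f S : L2 f -> l1 (module_inner L f f) S ->
  heisenberg_norm L f = (Num.sqrt (gramnorm L (module_inner L f f)))%:E.
Proof.
move=> hf aS; have gN := gramnorm_bound L aS; have N0 := gramnorm_ge0 L aS.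
set N := gramnorm _ _ in gN N0 *.
apply/eqP; rewrite eq_le; apply/andP; split.
  apply/lee_addgt0Pr => e e0; rewrite -EFinD.
  apply: (@le_trans _ _ (Num.sqrt (N + e ^+ 2))%:E); last first.
    by rewrite lee_fin sqrt_sqrD// ltW.
  have c0 : 0 < N + e ^+ 2 by rewrite ltr_wpDl// exprn_gt0.
  apply: ereal_inf_lbound; exists (N + e ^+ 2) => //; split => //.
  apply/(bessel_gram_bound L hf c0) => D b b' uD; apply: (le_trans (gN D b b' uD)).
  rewrite ler_wpM2r//.
    by apply: sumr_ge0 => k _; rewrite addr_ge0 ?sqr_ge0.
  by rewrite ler_wpM2r// lerDl sqr_ge0.
apply: le_ereal_inf_tmp => _ [c [c0 hc] <-]; rewrite lee_fin ler_sqrt; last exact: ltW.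
by apply: gramnorm_le; apply/bessel_gram_bound.
Qed.

(** The form is tested on the unit sequence at the origin.  This bounds the module
    norm away from zero, where the square root fails to be Lipschitz. *)
Lemma gramnorm_ge L f S : L2 f -> l1 (module_inner L f f) S ->
  n2 f <= gramnorm L (module_inner L f f).
Proof.
move=> hf aS; have gN := gramnorm_bound L aS.
have := gN [:: 0] (fun=> 1) (fun=> 1) isT.
rewrite gram_module_inner// !big_seq1 ComplexField.Normc.normc1 expr1n.
rewrite (_ : (fun t => \sum_(l <- [:: 0]) 1 * shift L l f t) = f); last first.
  by apply/funext => t; rewrite big_seq1 mul1r lattice_pt0 tfshift0.
by rewrite cinner_self /=; lra.
Qed.

End norms.

(** * Fubini for complex functions *)

Section complex_integrable.
Context {R : realType} {d1 : measure_display} {T : measurableType d1}.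
Variable mu : {measure set T -> \bar R}.

Lemma cintegrable_ReIm (f : T -> R[i]) :
  mu.-integrable setT (fun x => (Re (f x))%:E) ->
  mu.-integrable setT (fun x => (Im (f x))%:E) -> cintegrable mu f.
Proof.
move=> j1 j2; have m1 := measurable_int _ j1; have m2 := measurable_int _ j2.
apply: (@cintegrable_le _ _ _ _ _ (fun x => `|Re (f x)| + `|Im (f x)|)).
- by split; exact/measurable_EFinP.
- apply: (eq_integrable measurableT (fun x => `|(Re (f x))%:E| + `|(Im (f x))%:E|)%E) => //.
  by apply: (integrableD measurableT); exact: integrable_abse.
- by move=> x; exact: ler_normc_ReIm.
Qed.

Lemma integrable_fine (F : T -> \bar R) : mu.-integrable setT F ->
  mu.-integrable setT (fun x => (fine (F x))%:E) /\
  (\int[mu]_x (fine (F x))%:E = \int[mu]_x F x)%E.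
Proof.
move=> jF; have mF := measurable_int _ jF.
have mf : measurable_fun setT (fun x => (fine (F x))%:E).
  by apply/measurable_EFinP; exact: measurableT_comp.
have ae := integrable_ae measurableT jF.
split.
  apply: le_integrable jF => // x _.
  by case: (F x) => //=; rewrite normr0 leey.
apply: ae_eq_integral => //; apply: filterS ae => x /(_ I) h _.
by rewrite fineK.
Qed.

End complex_integrable.

Section complex_fubini.
Context {R : realType} {d1 d2 : measure_display}.
Context {T1 : measurableType d1} {T2 : measurableType d2}.
Variable m1 : {sigma_finite_measure set T1 -> \bar R}.
Variable m2 : {sigma_finite_measure set T2 -> \bar R}.
Implicit Types f : T1 * T2 -> R[i].

Let jF (h : T1 * T2 -> \bar R) : (m1 \x m2)%E.-integrable setT h ->
  m1.-integrable setT (fun x => (fine (\int[m2]_y h (x, y)))%:E) /\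
  (\int[m1]_x (fine (\int[m2]_y h (x, y)))%:E = \int[m1 \x m2]_z h z)%E.
Proof.
move=> jh; have [j e] := integrable_fine (integrable_fubini_F jh).
by split => //; rewrite e integral12_prod_meas1.
Qed.

Let jG (h : T1 * T2 -> \bar R) : (m1 \x m2)%E.-integrable setT h ->
  m2.-integrable setT (fun y => (fine (\int[m1]_x h (x, y)))%:E) /\
  (\int[m2]_y (fine (\int[m1]_x h (x, y)))%:E = \int[m1 \x m2]_z h z)%E.
Proof.
move=> jh; have mh := measurable_int _ jh.
have jh' : (m2 \x m1)%E.-integrable setT (fun p => h (p.2, p.1)).
  apply/integrable12ltyP.
    by apply: measurableT_comp => //; exact: measurable_swap.
  exact/(integrable21ltyP m1 m2 mh).
have [j e] := integrable_fine (integrable_fubini_F jh').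
by split => //; rewrite e integral21_prod_meas1.
Qed.

Lemma cintegrable_fubini1 f : cintegrable (m1 \x m2)%E f ->
  cintegrable m1 (fun x => cintegral m2 (fun y => f (x, y))).
Proof.
move=> jf; apply: cintegrable_ReIm.
  by have [] := jF (cintegrable_Re jf).
by have [] := jF (cintegrable_Im jf).
Qed.

Lemma cfubini1 f : cintegrable (m1 \x m2)%E f ->
  cintegral (m1 \x m2)%E f = cintegral m1 (fun x => cintegral m2 (fun y => f (x, y))).
Proof.
move=> jf; apply: complex_ext; rewrite /= /Rintegral; congr fine; apply/esym.
  by have [] := jF (cintegrable_Re jf).
by have [] := jF (cintegrable_Im jf).
Qed.

Lemma cfubini2 f : cintegrable (m1 \x m2)%E f ->
  cintegral (m1 \x m2)%E f = cintegral m2 (fun y => cintegral m1 (fun x => f (x, y))).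
Proof.
move=> jf; apply: complex_ext; rewrite /= /Rintegral; congr fine; apply/esym.
  by have [] := jG (cintegrable_Re jf).
by have [] := jG (cintegrable_Im jf).
Qed.

Lemma cfubini f : cintegrable (m1 \x m2)%E f ->
  cintegral m1 (fun x => cintegral m2 (fun y => f (x, y))) =
  cintegral m2 (fun y => cintegral m1 (fun x => f (x, y))).
Proof. by move=> jf; rewrite -cfubini1// cfubini2. Qed.

Lemma cintegrable_ae1 f : cintegrable (m1 \x m2)%E f ->
  {ae m1, forall x, cintegrable m2 (fun y => f (x, y))}.
Proof.
move=> jf.
have h1 := ae_integrable1 (cintegrable_Re jf).
have h2 := ae_integrable1 (cintegrable_Im jf).
by apply: filterS2 h1 h2 => x i1 i2; exact: cintegrable_ReIm.
Qed.

Lemma cintegrable_tensor (a : T1 -> R) (b : T2 -> R) f :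
  cmeasurable f ->
  m1.-integrable setT (fun x => (a x)%:E) -> m2.-integrable setT (fun y => (b y)%:E) ->
  (forall x y, normc (f (x, y)) <= a x * b y) -> cintegrable (m1 \x m2)%E f.
Proof.
move=> mf ja jb fab; split => //.
have mn : measurable_fun setT (fun z => (normc (f z))%:E).
  by apply/measurable_EFinP; exact: measurable_normc.
apply/(integrable12ltyP m1 m2 mn).
have ma := measurable_int _ ja; have mb := measurable_int _ jb.
have mab : measurable_fun setT (fun z : T1 * T2 => (`|a z.1| * `|b z.2|)%:E).
  apply/measurable_EFinP; apply: measurable_funM.
    apply: measurableT_comp => //; apply: measurableT_comp measurable_fst => //.
    exact/measurable_EFinP.
  apply: measurableT_comp => //; apply: measurableT_comp measurable_snd => //.
  exact/measurable_EFinP.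
apply: (@le_lt_trans _ _ (\int[m1]_x \int[m2]_y (`|a x| * `|b y|)%:E)%E).
  apply: ge0_le_integral => //.
  - by move=> x _; exact: integral_ge0.
  - apply: (measurable_fun_fubini_tonelli_F (fun z => `|(normc (f z))%:E|%E)) => //.
    exact: measurableT_comp.
  - apply: (measurable_fun_fubini_tonelli_F (fun z : T1 * T2 => (`|a z.1| * `|b z.2|)%:E)) => //.
  - move=> x _; apply: ge0_le_integral => //.
    + by apply: measurableT_comp => //; exact: (measurableT_comp mn (pair1_measurable x)).
    + exact: (measurableT_comp mab (pair1_measurable x)).
    + move=> y _; rewrite lee_fin ger0_norm ?normc_ge0// -normrM.
      exact: le_trans (fab x y) (ler_norm _).
have [/integrableP[_ Ia] /integrableP[_ Ib]] := (ja, jb).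
rewrite (_ : (\int[m1]_x _)%E = ((\int[m1]_x `|(a x)%:E|) * (\int[m2]_y `|(b y)%:E|))%E).
  by apply: lte_mul_pinfty => //; [exact: integral_ge0|
    rewrite ge0_fin_numE//; exact: integral_ge0].
have Ib0 : (\int[m2]_y `|(b y)%:E|)%E \is a fin_num by rewrite ge0_fin_numE//; exact: integral_ge0.
under eq_integral => x _.
  under eq_integral do rewrite EFinM.
  rewrite ge0_integralZl//; last first.
    by apply/measurable_EFinP; apply: measurableT_comp => //; exact/measurable_EFinP.
  over.
rewrite /= -(fineK Ib0) ge0_integralZr//.
- by apply/measurable_EFinP; apply: measurableT_comp => //; exact/measurable_EFinP.
- by rewrite lee_fin fine_ge0//; exact: integral_ge0.
Qed.

End complex_fubini.

Section leb_fubini.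
Context {R : realType}.

Lemma cov_cV_cons n (f : 'cV[R]_n.+1 -> \bar R) : measurable_fun setT f ->
  (forall x, (0 <= f x)%E) ->
  (\int[lebesgue_measure \x leb n]_p f (cV_cons p) = 1%:E * \int[leb n.+1]_v f v)%E.
Proof.
move=> mf f0; rewrite mul1e (_ : \int[leb n.+1]_v f v =
    \int[pushforward (lebesgue_measure \x leb n) (@cV_cons R n)]_v f v)%E//.
rewrite ge0_integral_pushforward//; exact: measurable_cV_cons.
Qed.

Lemma cov_col_mx n m (f : 'cV[R]_(n + m) -> \bar R) : measurable_fun setT f ->
  (forall x, (0 <= f x)%E) ->
  (\int[leb n \x leb m]_p f (col_mx p.1 p.2) = 1%:E * \int[leb (n + m)]_v f v)%E.
Proof.
move=> mf f0; rewrite mul1e leb_add//.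
rewrite (fubini_tonelli1 (fun p => f (col_mx p.1 p.2)))//.
by apply: measurableT_comp => //; exact: measurable_col_mx.
Qed.

Lemma cintegral_add n m (f : 'cV[R]_(n + m) -> R[i]) : cintegrable (leb (n + m)) f ->
  cintegral (leb (n + m)) f =
  cintegral (leb n) (fun x => cintegral (leb m) (fun y => f (col_mx x y))).
Proof.
move=> jf; rewrite -[LHS]mul1r -(cov_cintegral (@cov_col_mx n m) jf).
rewrite cfubini1//; exact: (cov_cintegrable (@measurable_col_mx R n m) ltr01 (@cov_col_mx n m)).
Qed.

Lemma cintegral_cons n (f : 'cV[R]_n.+1 -> R[i]) : cintegrable (leb n.+1) f ->
  cintegral (leb n.+1) f =
  cintegral lebesgue_measure (fun x => cintegral (leb n) (fun y => f (cV_cons (x, y)))).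
Proof.
move=> jf; rewrite -[LHS]mul1r -(cov_cintegral (@cov_cV_cons n) jf).
apply: cfubini1.
apply: (@cov_cintegrable R _ _ _ _ (lebesgue_measure \x leb n)%E (leb n.+1)
  (@cV_cons R n) 1) => //; [exact: measurable_cV_cons|exact: cov_cV_cons].
Qed.

End leb_fubini.

(** * Fourier transform of the Gaussian on the line *)

Section gaussian_line.
Context {R : realType}.
Local Notation mu := (@lebesgue_measure R).
Local Notation intg f := (mu.-integrable setT (fun t => (f t)%:E)).

Lemma is_derive_under_integral (f f' : R -> R -> R) (a : R) (G : R -> R) :
  (forall x, a - 1 < x < a + 1 -> intg (f x)) ->
  (forall x t, a - 1 < x < a + 1 -> is_derive x 1 (f ^~ t) (f' x t)) ->
  intg G -> (forall t, 0 <= G t) ->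
  (forall x t, a - 1 < x < a + 1 -> `|f' x t| <= G t) ->
  is_derive a 1 (fun x => Rintegral mu setT (f x)) (Rintegral mu setT (f' a)).
Proof.
move=> jf df jG G0 f'G.
have aI : a \in `](a - 1), (a + 1)[ by rewrite in_itv/= ltrBlDr !ltrDl ltr01.
have d1 x t : a - 1 < x < a + 1 -> partial1of2 f x t = f' x t.
  by move=> h; have := df _ t h => dh; rewrite partial1of2E derive_val.
have h3 x y : `](a - 1), (a + 1)[%classic x -> [set: R] y -> derivable (f ^~ y) x 1.
  by rewrite /= in_itv/= => h _; have := df _ y h => dh; exact: ex_derive.
have h4 x y : `](a - 1), (a + 1)[%classic x -> [set: R] y -> `|partial1of2 f x y| <= G y.
  by rewrite /= in_itv/= => h _; rewrite d1//; exact: f'G.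
have h2 x : `](a - 1), (a + 1)[%classic x -> mu.-integrable setT (EFin \o f x).
  by rewrite /= in_itv/= => h; exact: jf.
apply: DeriveDef; first exact: (derivable_under_integral measurableT aI h2 h3 G0 jG h4).
rewrite -derive1E (differentiation_under_integral measurableT aI h2 h3 G0 jG h4).
by apply: eq_Rintegral => t _; rewrite d1//; move: aI; rewrite in_itv.
Qed.

Lemma is_derive_ext (f g : R -> R) (x a b : R) : is_derive x (1 : R) f a ->
  (forall y, f y = g y) -> a = b -> is_derive x (1 : R) g b.
Proof. by move=> df /funext <- <-. Qed.

Lemma is_derive_affine (a c x : R) : is_derive x (1 : R) (fun y : R => y * a + c) a.
Proof.
have h := is_deriveD (is_deriveM (is_derive_id x 1) (is_derive_cst a x 1)) (is_derive_cst c x (1 : R)).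
by apply: (is_derive_ext h) => //; rewrite /GRing.scale/=; ring.
Qed.

Lemma is_derive_square (a c x : R) :
  is_derive x (1 : R) (fun y : R => (c + y) ^+ 2 * a) (2 * (c + x) * a).
Proof.
have h1 := is_deriveD (is_derive_cst c x 1) (is_derive_id x (1 : R)).
have h2 := is_deriveM (is_deriveM h1 h1) (is_derive_cst a x (1 : R)).
by apply: (is_derive_ext h2) => //; rewrite /GRing.scale/= !fctE/=; ring.
Qed.

Lemma integrable_gauss (c : R) : 0 < c -> intg (fun t => expR (- (c * t ^+ 2))).
Proof.
move=> c0; have s0 : 0 < Num.sqrt c by rewrite sqrtr_gt0.
have j : cintegrable mu (fun t : R => (gauss_fun t)%:C).
  apply: (@cintegrable_le R _ _ mu _ gauss_fun).
  - by apply: cmeasurable_real; exact: measurable_gauss_fun.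
  - exact: integrableT_gauss.
  - by move=> t; rewrite normcR ger0_norm// gauss_fun_ge0.
have m : measurable_fun setT (fun x : R => Num.sqrt c * x + 0).
  by apply: measurable_funD => //; exact: measurable_funM.
have i0 : 0 < (Num.sqrt c)^-1 by rewrite invr_gt0.
have := @cov_cintegrable R _ _ _ _ mu mu _ _ m i0 (fun f mf f0 => lebR_affine 0 s0 mf f0) _ j.
move=> /cintegrable_Re; apply: (eq_integrable measurableT) => t _ /=.
by rewrite addr0 /gauss_fun exprMn sqr_sqrtr// ltW.
Qed.

Lemma integrable_bounded (f G : R -> R) : measurable_fun setT f -> intg G ->
  (forall t, `|f t| <= G t) -> intg f.
Proof.
move=> mf jG fG; apply: le_integrable jG => //; first exact/measurable_EFinP.
by move=> t _; rewrite /= lee_fin; apply: (le_trans (fG t)); exact: ler_norm.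
Qed.

Lemma measurable_trig (b c : R) (h : R -> R) : continuous h ->
  measurable_fun setT (fun t : R => h (b * t + c)).
Proof.
move=> ch; apply: measurableT_comp; first exact: continuous_measurable_fun.
by apply: measurable_funD => //; exact: measurable_funM.
Qed.

Lemma measurable_gauss : measurable_fun setT (fun t : R => expR (- t ^+ 2)).
Proof. exact: measurable_gauss_fun. Qed.

Section phase.
Variable theta : R.

Let J b := Rintegral mu setT (fun t => expR (- t ^+ 2) * cos (b * t + theta)).
Let S b := Rintegral mu setT (fun t => t * expR (- t ^+ 2) * sin (b * t + theta)).

Let half t : (expR (- (2^-1 * t ^+ 2)) : R) * expR (- (2^-1 * t ^+ 2)) = expR (- t ^+ 2).
Proof. by rewrite -expRD; congr expR; field. Qed.

Let tbound (t : R) : `|t * expR (- t ^+ 2)| <= 2 * expR (- (2^-1 * t ^+ 2)).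
Proof.
rewrite normrM -half normrM mulrA (ger0_norm (expR_ge0 _)) ler_wpM2r ?expR_ge0//.
rewrite expRN ler_pdivrMr ?expR_gt0//.
have := expR_ge1Dx (2^-1 * t ^+ 2); have := sqr_ge0 (`|t| - 1).
by rewrite -[t ^+ 2]real_normK ?num_real//; have := normr_ge0 t; nra.
Qed.

Let jt : intg (fun t => 2 * expR (- (2^-1 * t ^+ 2))).
Proof.
have h : 0 < 2^-1 :> R by rewrite invr_gt0.
exact: (integrableZl measurableT 2 (integrable_gauss h)).
Qed.

Let trig1 (x : R) : `|sin x| <= 1 /\ `|cos x| <= 1.
Proof. by rewrite !ler_norml sin_geN1 sin_le1 cos_geN1 cos_le1. Qed.

Let mS (b : R) : measurable_fun setT (fun t : R => t * expR (- t ^+ 2) * sin (b * t + theta)).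
Proof.
apply: measurable_funM; last exact: (measurable_trig b theta (@continuous_sin R)).
by apply: measurable_funM => //; exact: measurable_gauss.
Qed.

Let iS (b : R) : intg (fun t => t * expR (- t ^+ 2) * sin (b * t + theta)).
Proof.
apply: (integrable_bounded (mS b) jt) => t.
rewrite normrM; apply: le_trans (tbound t); rewrite ler_piMr//.
by have [] := trig1 (b * t + theta).
Qed.

Let iG (h : R -> R) (b : R) : continuous h -> (forall x, `|h x| <= 1) ->
  intg (fun t => expR (- t ^+ 2) * h (b * t + theta)).
Proof.
move=> ch h1; apply: (@integrable_bounded _ (fun t => expR (- (1 * t ^+ 2)))).
- by apply: measurable_funM; [exact: measurable_gauss|exact: measurable_trig].
- exact: integrable_gauss.
- by move=> t; rewrite mul1r normrM ger0_norm ?expR_ge0// ler_piMr ?expR_ge0.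
Qed.

Let derivJ (b : R) : is_derive b 1 J (- S b).
Proof.
have -> : - S b = Rintegral mu setT (fun t => - (t * expR (- t ^+ 2) * sin (b * t + theta))).
  rewrite /S -[RHS](_ : Rintegral mu setT (fun t => - 1 * (t * expR (- t ^+ 2) * sin (b * t + theta))) = _).
    rewrite RintegralZl ?mulN1r//.
    exact: iS.
  by apply: eq_Rintegral => t _; rewrite mulN1r.
apply: (@is_derive_under_integral (fun b t => expR (- t ^+ 2) * cos (b * t + theta))
  (fun b t => - (t * expR (- t ^+ 2) * sin (b * t + theta))) _
  (fun t => 2 * expR (- (2^-1 * t ^+ 2)))).
- move=> x _; exact: (iG x (@continuous_cos R) (fun y => (trig1 y).2)).
- move=> x t _.
  have h := is_derive_affine t theta x.
  have hc := @is_derive1_comp _ cos (fun y => y * t + theta) x _ _ (is_derive_cos (x * t + theta)) h.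
  have hm := is_deriveM (is_derive_cst (expR (- t ^+ 2)) x (1 : R)) hc.
  by apply: (is_derive_ext hm) => //; rewrite /GRing.scale/=; ring.
- exact: jt.
- by move=> t; rewrite mulr_ge0// expR_ge0.
- move=> x t _; rewrite normrN normrM; apply: le_trans (tbound t); rewrite ler_piMr// ler_norml.
  by rewrite sin_geN1 sin_le1.
Qed.

Let shiftbound (s t : R) : -1 < s < 1 ->
  expR (- (2^-1 * (t + s) ^+ 2)) <= expR 2^-1 * expR (- (4^-1 * t ^+ 2)).
Proof.
move=> /andP[s1 s2]; rewrite -expRD ler_expR.
have : s ^+ 2 <= 1 by nra.
have := sqr_ge0 (t + 2 * s); nra.
Qed.

(** Integration by parts as the derivative at [s = 0] of the integral of a
    translate, which is constant in [s]. *)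
Let by_parts (b : R) : 2 * S b = b * J b.
Proof.
pose f s t := expR (- (t + s) ^+ 2) * sin (b * (t + s) + theta).
pose f' s t := - 2 * ((t + s) * expR (- (t + s) ^+ 2) * sin (b * (t + s) + theta)) +
  b * (expR (- (t + s) ^+ 2) * cos (b * (t + s) + theta)).
have iC := iG b (@continuous_cos R) (fun x => (trig1 x).2).
have iN := iG b (@continuous_sin R) (fun x => (trig1 x).1).
have shiftm (s : R) : measurable_fun setT (fun t : R => 1 * t + s).
  by apply: measurable_funD => //; exact: measurable_funM.
have tr (s : R) (h : R -> R) : intg h ->
    Rintegral mu setT (fun t => h (t + s)) = Rintegral mu setT h.
  move=> jh; have := @cov_Rintegral R _ _ _ _ mu mu _ _ (fun f mf f0 => lebR_affine s ltr01 mf f0) _ jh.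
  rewrite invr1 mul1r => <-; by apply: eq_Rintegral => t _; rewrite mul1r.
have jtr (s : R) (h : R -> R) : intg h -> intg (fun t => h (t + s)).
  move=> jh; have jc : cintegrable mu (fun t => (h t)%:C).
    by apply: cintegrable_ReIm => //=; exact: integrable0.
  have i0 : 0 < 1^-1 :> R by rewrite invr1.
  have := @cov_cintegrable R _ _ _ _ mu mu _ _ (shiftm s) i0 (fun f mf f0 => lebR_affine s ltr01 mf f0) _ jc.
  by move=> /cintegrable_Re; apply: (eq_integrable measurableT) => t _; rewrite mul1r.
have D : is_derive (0 : R) (1 : R) (fun s => Rintegral mu setT (f s)) (Rintegral mu setT (f' 0)).
  apply: (@is_derive_under_integral f f' _
     (fun t => (4 + `|b|) * (expR 2^-1 * expR (- (4^-1 * t ^+ 2))))).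
  - by move=> s _; exact: (jtr s _ iN).
  - move=> s t _.
    have h2 : is_derive s (1 : R) (fun y => b * (t + y) + theta) b.
      by apply: (is_derive_ext (is_derive_affine b (b * t + theta) s)) => // y; ring.
    have h3 : is_derive s (1 : R) (fun y => - (t + y) ^+ 2) (- 2 * (t + s)).
      by apply: (is_derive_ext (is_derive_square (- 1) t s)) => [y|]; ring.
    have hc := @is_derive1_comp _ sin (fun y => b * (t + y) + theta) s _ _ (is_derive_sin (b * (t + s) + theta)) h2.
    have he := @is_derive1_comp _ expR (fun y => - (t + y) ^+ 2) s _ _ (is_derive_expR (- (t + s) ^+ 2)) h3.
    by apply: (is_derive_ext (is_deriveM he hc)) => //; rewrite /f' /GRing.scale/=; ring.
  - have q : 0 < 4^-1 :> R by rewrite invr_gt0.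
    exact: (integrableZl measurableT (4 + `|b|)
      (integrableZl measurableT (expR 2^-1) (integrable_gauss q))).
  - by move=> t; rewrite !mulr_ge0 ?expR_ge0// addr_ge0.
  - move=> s t; rewrite sub0r add0r => s1.
    apply: (@le_trans _ _ ((4 + `|b|) * expR (- (2^-1 * (t + s) ^+ 2)))); last first.
      by rewrite ler_wpM2l ?addr_ge0//; exact: shiftbound.
    have [u1 u2] := trig1 (b * (t + s) + theta).
    apply: (le_trans (ler_normD _ _)); rewrite [leRHS]mulrDl; apply: lerD.
      rewrite normrM normrN (@ger0_norm _ 2)// (_ : 4 = 2 * 2 :> R); last by ring.
      rewrite -[leRHS]mulrA ler_wpM2l// normrM; apply: le_trans (tbound (t + s)); exact: ler_piMr.
    rewrite normrM ler_wpM2l// normrM ger0_norm ?expR_ge0//.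
    apply: (@le_trans _ _ (expR (- (t + s) ^+ 2))); first by rewrite ler_piMr ?expR_ge0.
    by rewrite ler_expR lerN2; have := sqr_ge0 (t + s); lra.
have C : is_derive (0 : R) (1 : R) (fun s => Rintegral mu setT (f s)) 0.
  rewrite (_ : (fun s => Rintegral mu setT (f s)) = cst (Rintegral mu setT (f 0))).
    exact: is_derive_cst.
  apply/funext => s; rewrite [LHS](tr s _ iN).
  by apply: eq_Rintegral => t _; rewrite /f addr0.
have := @derive_val _ _ _ _ _ _ _ D; rewrite (@derive_val _ _ _ _ _ _ _ C) => e.
have : Rintegral mu setT (f' 0) = - 2 * S b + b * J b.
  rewrite /f'; under eq_Rintegral do rewrite !addr0.
  rewrite RintegralD//; [|exact: (integrableZl measurableT (-2) (iS b))|
    exact: (integrableZl measurableT b iC)].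
  congr (_ + _); first exact: (RintegralZl _ measurableT (iS b)).
  exact: (RintegralZl _ measurableT iC).
by rewrite -e; lra.
Qed.

(** As a function of [b] the integral [J] solves [J' = - (b / 2) J], by
    differentiation under the integral sign and integration by parts.  The phase
    [theta] treats the cosine and the sine transform together. *)
Lemma gauss_fourier_line (b : R) :
  Rintegral mu setT (fun t => expR (- t ^+ 2) * cos (b * t + theta)) =
  Num.sqrt pi * cos theta * expR (- (b ^+ 2 / 4)).
Proof.
pose K (b : R) := J b * expR (b ^+ 2 / 4).
have dK (x : R) : is_derive x (1 : R) K 0.
  have h3 : is_derive x (1 : R) (fun y : R => y ^+ 2 / 4) (x / 2).
    by apply: (is_derive_ext (is_derive_square 4^-1 0 x)) => [y|]; field.
  have he := @is_derive1_comp _ expR (fun y => y ^+ 2 / 4) x _ _ (is_derive_expR (x ^+ 2 / 4)) h3.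
  apply: (is_derive_ext (is_deriveM (derivJ x) he)) => //.
  rewrite /GRing.scale/=; have := by_parts x; set e := expR _.
  by rewrite /K => /(congr1 (fun z => z * e)) q; lra.
have := is_derive_0_is_cst b 0 dK; rewrite /K expr0n mul0r expR0 mulr1 => e.
have J0 : J 0 = Num.sqrt pi * cos theta.
  rewrite /J; under eq_Rintegral do rewrite mul0r add0r.
  rewrite RintegralZr//; last by have := @integrable_gauss 1 ltr01; under eq_fun do rewrite mul1r.
  by congr (_ * _); rewrite /Rintegral; have := @integralT_gauss R; rewrite /gauss_fun => ->.
by rewrite -J0 -e -/(J b) -mulrA -expRD addrN expR0 mulr1.
Qed.

End phase.
End gaussian_line.

(** * Fourier transform of the Gaussian in several variables *)

Section gaussian_transform.
Context {R : realType}.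
Local Notation mu := (@lebesgue_measure R).

Definition gauss n (v : 'cV[R]_n) : R := expR (- (pi * dotv v v)).

Lemma gauss_ge0 n (v : 'cV[R]_n) : 0 <= gauss v.
Proof. exact: expR_ge0. Qed.

Lemma dotv_ge0 n (v : 'cV[R]_n) : 0 <= dotv v v.
Proof. by apply: sumr_ge0 => i _; rewrite -expr2 sqr_ge0. Qed.

Lemma gauss_le1 n (v : 'cV[R]_n) : gauss v <= 1.
Proof. by rewrite -expR0 ler_expR oppr_le0 mulr_ge0 ?pi_ge0// dotv_ge0. Qed.

Lemma normc_gauss n (v : 'cV[R]_n) : normc (gauss v)%:C = gauss v.
Proof. by rewrite normcR ger0_norm// gauss_ge0. Qed.

Lemma gaussianE d : @gaussian R d = fun t => (gauss t)%:C.
Proof.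
apply/funext => t; rewrite /gaussian /gauss /enorm sqr_sqrtr ?dotv_ge0//.
by rewrite mulNr.
Qed.

Lemma measurable_gauss_cV n : measurable_fun setT (@gauss n).
Proof.
apply: (@measurableT_comp _ _ _ _ _ _ (@expR R)) => //.
apply: (@measurableT_comp _ _ _ _ _ _ (@GRing.opp R)) => //.
by apply: measurable_funM => //; apply: measurable_dotv; exact: measurable_id.
Qed.

Lemma gauss_line_integrable : mu.-integrable setT (fun x : R => (expR (- (pi * x ^+ 2)))%:E).
Proof. by apply: integrable_gauss; exact: pi_gt0. Qed.

Lemma gauss_line_cintegrable : cintegrable mu (fun x : R => (expR (- (pi * x ^+ 2)))%:C).
Proof. by apply: cintegrable_ReIm => //=; [exact: gauss_line_integrable|exact: integrable0]. Qed.

Lemma gauss_fourier1 (r : R) :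
  cintegral mu (fun x : R => (expR (- (pi * x ^+ 2)))%:C * cexpi (2 * pi * (x * r))) =
  (expR (- (pi * r ^+ 2)))%:C.
Proof.
have p0 : 0 < pi :> R by exact: pi_gt0.
set s : R := Num.sqrt pi; have s0 : 0 < s by rewrite sqrtr_gt0.
have ss : s ^+ 2 = pi by rewrite sqr_sqrtr// ltW.
pose f (y : R) : R[i] := (expR (- y ^+ 2))%:C * cexpi (2 * s * r * y).
have jg : cintegrable mu (fun y : R => (expR (- y ^+ 2))%:C).
  apply: cintegrable_ReIm => //=; last exact: integrable0.
  by have := @integrable_gauss R 1 ltr01; under eq_fun do rewrite mul1r.
have jf : cintegrable mu f.
  rewrite /f; under eq_fun do rewrite mulrC.
  apply: (@cintegrableMb _ _ _ _ _ _ 1) => //; last by move=> x; rewrite normc_cexpi.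
  by apply: cmeasurable_cexpi; exact: measurable_funM.
have := @cov_cintegral R _ _ _ _ mu mu _ _ (fun f mf f0 => lebR_affine 0 s0 mf f0) _ jf.
have -> : cintegral mu f = (s * expR (- (pi * r ^+ 2)))%:C.
  have e : (2 * s * r) ^+ 2 / 4 = pi * r ^+ 2 by rewrite -ss; field.
  apply: complex_ext => /=.
    rewrite (_ : Rintegral _ _ _ = Rintegral mu setT
       (fun t => expR (- t ^+ 2) * cos (2 * s * r * t + 0))).
      by rewrite gauss_fourier_line e cos0 mulr1.
    by apply: eq_Rintegral => t _; rewrite addr0; ring.
  rewrite (_ : Rintegral _ _ _ = Rintegral mu setT
       (fun t => expR (- t ^+ 2) * cos (2 * s * r * t + - (pi / 2)))).
    by rewrite gauss_fourier_line cosN cos_pihalf mulr0 mul0r.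
  apply: eq_Rintegral => t _; rewrite cosD cosN sinN cos_pihalf sin_pihalf.
  by ring.
rewrite -rmorphM/= mulrA mulVf ?gt_eqF// mul1r => <-.
apply: eq_cintegral => x; rewrite /f addr0 exprMn ss; congr (_ * cexpi _).
by rewrite -ss; ring.
Qed.

Lemma dotv_cV_cons n (x : R) (v : 'cV[R]_n) (r : 'cV[R]_n.+1) :
  dotv (cV_cons (x, v)) r = x * r ord0 ord0 + dotv v (\col_j r (lift ord0 j) ord0).
Proof.
rewrite /dotv big_ord_recl; congr (_ + _); first by rewrite mxE unlift_none.
by apply: eq_bigr => j _; rewrite !mxE liftK.
Qed.

Lemma dotv_cV n (r : 'cV[R]_n.+1) : dotv r r =
  r ord0 ord0 ^+ 2 + dotv (\col_j r (lift ord0 j) ord0) (\col_j r (lift ord0 j) ord0).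
Proof.
rewrite /dotv big_ord_recl expr2; congr (_ + _).
by apply: eq_bigr => j _; rewrite !mxE.
Qed.

Lemma gauss_cV_cons n (x : R) (v : 'cV[R]_n) :
  gauss (cV_cons (x, v)) = expR (- (pi * x ^+ 2)) * gauss v.
Proof.
rewrite /gauss -expRD dotv_cV mxE unlift_none/=.
rewrite (_ : (\col_j _) = v); last by apply/colP => j; rewrite !mxE liftK.
by congr expR; ring.
Qed.

Lemma cmeasurable_gauss n : cmeasurable (fun v : 'cV[R]_n => (gauss v)%:C).
Proof. by apply: cmeasurable_real; exact: measurable_gauss_cV. Qed.

Lemma cmeasurable_character n (r : 'cV[R]_n) (c : R) :
  cmeasurable (fun v : 'cV[R]_n => cexpi (c * dotv v r)).
Proof.
apply: cmeasurable_cexpi; apply: measurable_funM => //.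
by apply: measurable_dotv => //; exact: measurable_id.
Qed.

Lemma gauss_cintegrable n : cintegrable (leb n) (fun v : 'cV[R]_n => (gauss v)%:C).
Proof.
elim: n => [|n IH].
  apply: cintegrable_lty; first exact: cmeasurable_gauss.
  rewrite integral_dirac//= ?diracT ?mul1e ?ltry//.
  by apply/measurable_EFinP; apply: measurable_normc; exact: cmeasurable_gauss.
apply: (@cov_cintegrable_inv R _ _ _ _ (lebesgue_measure \x leb n)%E (leb n.+1)
  (@cV_cons R n) 1) => //; [exact: cov_cV_cons|exact: cmeasurable_gauss|].
apply: (@cintegrable_tensor R _ _ _ _ mu (leb n) (fun x : R => expR (- (pi * x ^+ 2))) (@gauss n)).
- apply: (@cmeasurable_comp _ _ _ _ _ (fun v => (gauss v)%:C)); first exact: cmeasurable_gauss.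
  exact: measurable_cV_cons.
- exact: gauss_line_integrable.
- exact: cintegrable_Re IH.
- by move=> x y; rewrite normc_gauss gauss_cV_cons.
Qed.

Lemma gauss_integrable n : (leb n).-integrable setT (fun v : 'cV[R]_n => (gauss v)%:E).
Proof. exact: cintegrable_Re (gauss_cintegrable n). Qed.

Lemma gauss_character_cintegrable n (r : 'cV[R]_n) (c : R) :
  cintegrable (leb n) (fun v : 'cV[R]_n => (gauss v)%:C * cexpi (c * dotv v r)).
Proof.
under eq_fun do rewrite mulrC.
apply: (@cintegrableMb _ _ _ _ _ _ 1); [exact: gauss_cintegrable|exact: cmeasurable_character|].
by move=> x; rewrite normc_cexpi.
Qed.

Lemma gauss_fourier n (r : 'cV[R]_n) :
  cintegral (leb n) (fun v => (gauss v)%:C * cexpi (2 * pi * dotv v r)) = (gauss r)%:C.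
Proof.
elim: n r => [|n IH] r.
  have [/= m1 m2] := (gauss_character_cintegrable r (2 * pi)).1.
  have d0 (v w : 'cV[R]_0) : dotv v w = 0 by rewrite /dotv big_ord0.
  apply: complex_ext; rewrite /= /Rintegral integral_dirac//=; try exact/measurable_EFinP.
    by rewrite indicE in_setT mul1r/= /gauss !d0 !mulr0 oppr0 expR0 cos0 sin0; ring.
  by rewrite indicE in_setT mul1r/= /gauss !d0 !mulr0 oppr0 expR0 cos0 sin0; ring.
rewrite cintegral_cons; last exact: gauss_character_cintegrable.
set r' : 'cV[R]_n := \col_j r (lift ord0 j) ord0.
transitivity (cintegral mu (fun x : R => (gauss r')%:C *
    ((expR (- (pi * x ^+ 2)))%:C * cexpi (2 * pi * (x * r ord0 ord0))))).
  apply: eq_cintegral => x; rewrite [RHS]mulrC -IH -cintegralZ; last exact: gauss_character_cintegrable.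
  apply: eq_cintegral => v; rewrite gauss_cV_cons dotv_cV_cons mulrDr cexpiD rmorphM/=.
  by rewrite mulrACA.
rewrite cintegralZ ?gauss_fourier1; last first.
  under eq_fun do rewrite mulrC.
  apply: (@cintegrableMb _ _ _ _ _ _ 1); first exact: gauss_line_cintegrable.
    by apply: cmeasurable_cexpi; apply: measurable_funM => //; exact: measurable_funM.
  by move=> x; rewrite normc_cexpi.
rewrite -rmorphM/= /gauss -expRD; congr (expR _)%:C.
by rewrite [in RHS]dotv_cV -/r'; ring.
Qed.

Lemma gauss_mass n : Rintegral (leb n) setT (@gauss n) = 1.
Proof.
have d0 (v : 'cV[R]_n) : dotv v 0 = 0 by rewrite /dotv big1// => i _; rewrite mxE mulr0.
have /(congr1 (@complex.Re R)) := gauss_fourier (0 : 'cV[R]_n).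
rewrite /gauss d0 mulr0 oppr0 expR0 /= => <-; apply: eq_Rintegral => v _.
by rewrite d0 mulr0 cos0 sin0; ring.
Qed.

End gaussian_transform.

(** * Weak Fourier inversion *)

Section fourier.
Context {R : realType} {n : nat}.
Local Notation V := 'cV[R]_n.
Local Notation C := R[i].
Local Notation "'leb2'" := (leb n \x leb n)%E.

Definition fourier (h : V -> C) (w : V) : C :=
  cintegral (leb n) (fun t => h t * cexpi (- (2 * pi * dotv t w))).

Definition cofourier (h : V -> C) (w : V) : C :=
  cintegral (leb n) (fun t => h t * cexpi (2 * pi * dotv t w)).

Lemma cintegrable_character h (c : R) (w : V) : cintegrable (leb n) h ->
  cintegrable (leb n) (fun t => h t * cexpi (c * dotv t w)).
Proof.
move=> jh; under eq_fun do rewrite mulrC.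
apply: (@cintegrableMb _ _ _ _ _ _ 1) => //; first exact: cmeasurable_character.
by move=> x; rewrite normc_cexpi.
Qed.

Lemma normc_integral_character h (c : R) (w : V) : cintegrable (leb n) h ->
  normc (cintegral (leb n) (fun t => h t * cexpi (c * dotv t w))) <=
  Rintegral (leb n) setT (fun t => normc (h t)).
Proof.
move=> jh; apply: (le_trans (le_normc_cintegral (cintegrable_character c w jh))).
by under eq_Rintegral do rewrite normcM normc_cexpi mulr1.
Qed.

Lemma cmeasurable_fst (h : V -> C) : cmeasurable h -> cmeasurable (fun p : V * V => h p.1).
Proof. by move=> mh; apply: (cmeasurable_comp mh); exact: measurable_fst. Qed.

Lemma cmeasurable_snd (h : V -> C) : cmeasurable h -> cmeasurable (fun p : V * V => h p.2).
Proof. by move=> mh; apply: (cmeasurable_comp mh); exact: measurable_snd. Qed.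

Lemma cmeasurable_pairing_character (c : R) :
  cmeasurable (fun p : V * V => cexpi (c * dotv p.2 p.1)).
Proof.
apply: cmeasurable_cexpi; apply: measurable_funM => //.
by apply: measurable_dotv; [exact: measurable_snd|exact: measurable_fst].
Qed.

(** A Gaussian factor in [w] makes the integrand integrable on the product, so that
    Fubini applies; it is divided out afterwards. *)
Lemma cmeasurable_integral_character h (c : R) : cintegrable (leb n) h ->
  cmeasurable (fun w : V => cintegral (leb n) (fun t => h t * cexpi (c * dotv t w))).
Proof.
move=> jh.
have j : cintegrable leb2 (fun p => (gauss p.1)%:C * (h p.2 * cexpi (c * dotv p.2 p.1))).
  apply: (@cintegrable_tensor _ _ _ _ _ (leb n) (leb n) (@gauss R n) (fun t => normc (h t))).
  - apply: cmeasurableM; first exact: (cmeasurable_fst (@cmeasurable_gauss R n)).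
    by apply: cmeasurableM; [exact: (cmeasurable_snd jh.1)|exact: cmeasurable_pairing_character].
  - exact: gauss_integrable.
  - exact: jh.2.
  - by move=> x y; rewrite !normcM normc_cexpi mulr1 normc_gauss.
have [mj _] := cintegrable_fubini1 j.
have mi : cmeasurable (fun v : V => ((gauss v)^-1)%:C).
  apply: cmeasurable_real; rewrite (_ : (fun _ => _) = (fun v => expR (pi * dotv v v))).
    apply: (@measurableT_comp _ _ _ _ _ _ (@expR R)) => //.
    by apply: measurable_funM => //; apply: measurable_dotv; exact: measurable_id.
  by apply/funext => v; rewrite /gauss expRN invrK.
rewrite (_ : (fun w => _) = (fun w => ((gauss w)^-1)%:C *
    cintegral (leb n) (fun t => (gauss w)%:C * (h t * cexpi (c * dotv t w))))).
  exact: cmeasurableM.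
apply/funext => w; rewrite cintegralZ; last exact: cintegrable_character.
by rewrite mulrA -rmorphM/= mulVf ?mul1r// gt_eqF// expR_gt0.
Qed.

Lemma cov_scale (c : R) (a : V) : 0 < c ->
  forall f : V -> \bar R, measurable_fun setT f -> (forall x, (0 <= f x)%E) ->
  (\int[leb n]_v f (c *: v + a)%R = (c ^- n)%:E * \int[leb n]_v f v)%E.
Proof. by move=> c0 f mf f0; exact: leb_affine. Qed.

Lemma dotvZl (c : R) (v w : V) : dotv (c *: v) w = c * dotv v w.
Proof. by rewrite /dotv mulr_sumr; apply: eq_bigr => i _; rewrite mxE mulrA. Qed.
Lemma dotvZr (c : R) (v w : V) : dotv w (c *: v) = c * dotv w v.
Proof. by rewrite dotvC dotvZl dotvC. Qed.

Lemma gauss_scaled_cintegrable (c : R) (a : V) : 0 < c ->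
  cintegrable (leb n) (fun v => (gauss (c *: v + a))%:C).
Proof.
move=> c0; have i0 : 0 < c ^- n by rewrite invr_gt0 exprn_gt0.
exact: (cov_cintegrable (measurable_affine c a) i0 (cov_scale a c0) (gauss_cintegrable n)).
Qed.

Lemma gauss_dilated_cintegrable (c : R) : 0 < c ->
  cintegrable (leb n) (fun v : V => (gauss (c *: v))%:C).
Proof. by move=> c0; have := gauss_scaled_cintegrable 0 c0; under eq_fun do rewrite addr0. Qed.

Lemma gauss_scaled_fourier (c : R) (r : V) : 0 < c ->
  cintegral (leb n) (fun v => (gauss (c *: v))%:C * cexpi (2 * pi * dotv v r)) =
  (c ^- n * gauss (c^-1 *: r))%:C.
Proof.
move=> c0; have := gauss_fourier (c^-1 *: r) => h.
have := cov_cintegral (cov_scale 0 c0) (gauss_character_cintegrable (c^-1 *: r) (2 * pi)).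
rewrite h -rmorphM/= => <-; apply: eq_cintegral => v.
by rewrite addr0 dotvZl dotvZr mulVKf// gt_eqF.
Qed.

Lemma cvg_ReIm_scale (z : C) (u : nat -> R) (l : R) : u k @[k --> \oo] --> l ->
  Re (z * (u k)%:C) @[k --> \oo] --> Re (z * l%:C) /\
  Im (z * (u k)%:C) @[k --> \oo] --> Im (z * l%:C).
Proof.
move=> ul; split.
  by under eq_fun do rewrite mulrC ReZ; rewrite mulrC ReZ; exact: (cvgM ul (cvg_cst _)).
by under eq_fun do rewrite mulrC ImZ; rewrite mulrC ImZ; exact: (cvgM ul (cvg_cst _)).
Qed.

Section weak_inversion.
Variables (F : V -> C) (eta : V -> R) (K : R).
Hypotheses (jF : cintegrable (leb n) F) (jFh : cintegrable (leb n) (fourier F)).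
Hypotheses (jeta : (leb n).-integrable setT (fun t => (eta t)%:E)).
Hypotheses (etaK : forall t, `|eta t| <= K).
Hypothesis eta_cont : forall s r : V,
  eta (s + k.+1%:R^-1 *: r) @[k --> \oo] --> eta s.

Let meta : measurable_fun setT eta.
Proof. by apply/measurable_EFinP; exact: measurable_int jeta. Qed.

Let ceta : cintegrable (leb n) (fun t => (eta t)%:C).
Proof. by apply: cintegrable_ReIm => //=; exact: integrable0. Qed.

Let etah := cofourier (fun t => (eta t)%:C).
Let H := Rintegral (leb n) setT (fun t => normc (eta t)%:C).

Let etahH w : normc (etah w) <= H.
Proof. exact: normc_integral_character. Qed.

Let metah : cmeasurable etah.
Proof. exact: cmeasurable_integral_character. Qed.

Let B (c : R) (s : V) := Rintegral (leb n) setT (fun r => gauss r * eta (s + c *: r)).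

Let mshift (c : R) (s : V) : measurable_fun setT (fun r : V => eta (s + c *: r)).
Proof.
apply: (measurableT_comp meta); under eq_fun do rewrite addrC.
exact: measurable_affine.
Qed.

Let jB (c : R) (s : V) : cintegrable (leb n) (fun r => (gauss r * eta (s + c *: r))%:C).
Proof.
under eq_fun do rewrite rmorphM mulrC.
apply: (@cintegrableMb _ _ _ _ _ _ K); first exact: gauss_cintegrable.
  exact: cmeasurable_real.
by move=> x; rewrite normcR.
Qed.

Let cB (c : R) (s : V) : (B c s)%:C = cintegral (leb n) (fun r => (gauss r * eta (s + c *: r))%:C).
Proof. by apply: complex_ext => //=; rewrite /Rintegral integral0. Qed.

(** By Fubini and [gauss_scaled_fourier], the inverse transform of [etah] damped by
    a wide Gaussian is an average of [eta] over a narrow one. *)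
Let smoothed (c : R) (s : V) : 0 < c ->
  cintegral (leb n) (fun w => cexpi (- (2 * pi * dotv s w)) * ((gauss (c *: w))%:C * etah w))
  = (B c s)%:C.
Proof.
move=> c0.
pose f (p : V * V) := cexpi (- (2 * pi * dotv s p.1)) * ((gauss (c *: p.1))%:C *
  ((eta p.2)%:C * cexpi (2 * pi * dotv p.2 p.1))).
have jc := gauss_dilated_cintegrable c0; have mc := jc.1.
have jf : cintegrable leb2 f.
  apply: (@cintegrable_tensor _ _ _ _ _ (leb n) (leb n) (fun w => gauss (c *: w)) (fun t => normc (eta t)%:C)).
  - apply: cmeasurableM; last apply: cmeasurableM; last apply: cmeasurableM.
    + apply: (cmeasurable_fst (h := fun w => cexpi (- (2 * pi * dotv s w)))).
      by under eq_fun do rewrite dotvC -mulNr; exact: cmeasurable_character.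
    + exact: (cmeasurable_fst mc).
    + exact: (cmeasurable_snd ceta.1).
    + exact: cmeasurable_pairing_character.
  - exact: cintegrable_Re jc.
  - exact: ceta.2.
  - by move=> x y; rewrite !normcM !normc_cexpi mulr1 mul1r normc_gauss.
transitivity (cintegral (leb n) (fun w => cintegral (leb n) (fun t => f (w, t)))).
  apply: eq_cintegral => w; rewrite mulrA -cintegralZ; last exact: cintegrable_character.
  by apply: eq_cintegral => t; rewrite -mulrA.
rewrite cfubini//.
transitivity (cintegral (leb n) (fun t => (eta t)%:C * (c ^- n * gauss (c^-1 *: (t - s)))%:C)).
  apply: eq_cintegral => t; rewrite -gauss_scaled_fourier// -cintegralZ; last first.
    exact: (cintegrable_character (2 * pi) (t - s) jc).
  apply: eq_cintegral => w; rewrite /f/=.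
  have -> : cexpi (2 * pi * dotv w (t - s)) =
      cexpi (2 * pi * dotv t w) * cexpi (- (2 * pi * dotv s w)).
    by rewrite -cexpiD; congr cexpi; rewrite dotvDr dotvNr !(dotvC w); ring.
  by ring.
have ci0 : 0 < c^-1 by rewrite invr_gt0.
have jg : cintegrable (leb n) (fun t => (eta t)%:C * (gauss (c^-1 *: (t - s)))%:C).
  apply: (@cintegrableMb _ _ _ _ _ _ K); last by move=> t; rewrite normcR.
    by under eq_fun do rewrite scalerBr; exact: gauss_scaled_cintegrable.
  exact: ceta.1.
rewrite cB; have := cov_cintegral (cov_scale s c0) jg => h.
transitivity ((c ^- n)%:C * cintegral (leb n) (fun t => (eta t)%:C * (gauss (c^-1 *: (t - s)))%:C)).
  rewrite -cintegralZ//; apply: eq_cintegral => t; rewrite rmorphM/=; ring.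
rewrite -h; apply: eq_cintegral => r.
by rewrite addrK scalerA mulVf ?gt_eqF// scale1r rmorphM mulrC [c *: r + s]addrC.
Qed.

Let smoothed_inversion (c : R) : 0 < c ->
  cintegrable (leb n) (fun s => F s * (B c s)%:C) /\
  cintegral (leb n) (fun w => fourier F w * ((gauss (c *: w))%:C * etah w)) =
  cintegral (leb n) (fun s => F s * (B c s)%:C).
Proof.
move=> c0.
pose f (p : V * V) := (F p.1 * cexpi (- (2 * pi) * dotv p.2 p.1)) *
  ((gauss (c *: p.2))%:C * etah p.2).
have jc := gauss_dilated_cintegrable c0; have mc := jc.1.
have jf : cintegrable leb2 f.
  apply: (@cintegrable_tensor _ _ _ _ _ (leb n) (leb n) (fun t => normc (F t)) (fun w => H * gauss (c *: w))).
  - apply: cmeasurableM; apply: cmeasurableM.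
    + exact: (cmeasurable_fst jF.1).
    + exact: cmeasurable_pairing_character.
    + exact: (cmeasurable_snd mc).
    + exact: (cmeasurable_snd metah).
  - exact: jF.2.
  - exact: (integrableZl measurableT H (cintegrable_Re jc)).
  - move=> x y; rewrite !normcM !normc_cexpi mulr1 normc_gauss.
    by rewrite ler_wpM2l ?normc_ge0// mulrC ler_wpM2r// gauss_ge0.
have e s : cintegral (leb n) (fun w => f (s, w)) = F s * (B c s)%:C.
  rewrite -smoothed// -cintegralZ; last first.
    apply: (@cintegrableMb _ _ _ _ _ _ 1); last by move=> w; rewrite normc_cexpi.
      by under eq_fun do rewrite mulrC; exact: (@cintegrableMb _ _ _ _ _ _ H).
    by under eq_fun do rewrite dotvC -mulNr; exact: cmeasurable_character.
  by apply: eq_cintegral => w; rewrite /f/= mulNr (dotvC w s); ring.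
split.
  by have := cintegrable_fubini1 jf; under eq_fun do rewrite e.
transitivity (cintegral (leb n) (fun w => cintegral (leb n) (fun s => f (s, w)))).
  apply: eq_cintegral => w; rewrite mulrC /fourier -cintegralZ; last first.
    by under eq_fun do rewrite -mulNr; exact: cintegrable_character.
  by apply: eq_cintegral => t; rewrite /f/= mulNr mulrC (dotvC w t).
by rewrite -cfubini//; apply: eq_cintegral.
Qed.

Let delta k : R := k.+1%:R^-1.

Let delta_gt0 k : 0 < delta k. Proof. by rewrite invr_gt0. Qed.

Let gauss_delta (w : V) : gauss (delta k *: w) @[k --> \oo] --> (1 : R).
Proof.
have h : (delta k * (delta k * dotv w w)) @[k --> \oo] --> (0 * (0 * dotv w w) : R).
  apply: cvgM; first exact: cvg_harmonic.
  by apply: cvgM; [exact: cvg_harmonic|exact: cvg_cst].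
have {}h : (- (pi * (delta k * (delta k * dotv w w)))) @[k --> \oo] --> (0 : R).
  have := cvgN (cvgM (cvg_cst (pi : R)) h); rewrite mul0r mulr0 oppr0; exact.
rewrite -expR0; under eq_fun do rewrite /gauss dotvZl dotvZr.
exact: (continuous_cvg _ (@continuous_expR R 0) h).
Qed.

Let gauss_eta_le c s r : normc (gauss r * eta (s + c *: r))%:C <= K * gauss r.
Proof.
by rewrite normcR normrM mulrC (ger0_norm (gauss_ge0 _)) ler_wpM2r ?gauss_ge0.
Qed.

Let B_delta (s : V) : B (delta k) s @[k --> \oo] --> eta s.
Proof.
have [] := @cdominated R _ _ (leb n) (fun k r => (gauss r * eta (s + delta k *: r))%:C)
  (fun r => (gauss r * eta s)%:C) (fun r => K * gauss r).
- by move=> k; exact: (jB (delta k) s).1.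
- by move=> r; apply: cvgM; [exact: cvg_cst|exact: eta_cont].
- by move=> r; exact: cvg_cst.
- exact: (integrableZl measurableT K (gauss_integrable n)).
- by move=> k r; exact: gauss_eta_le.
move=> _ + _; rewrite (_ : cintegral _ _ = (eta s)%:C).
  by under eq_fun do rewrite -cB.
under eq_fun do rewrite rmorphM mulrC.
rewrite cintegralZ; last exact: gauss_cintegrable.
rewrite (_ : cintegral _ _ = 1) ?mulr1//.
by apply: complex_ext => /=; [exact: gauss_mass|rewrite /Rintegral integral0].
Qed.

Let B_le c s : `|B c s| <= K.
Proof.
rewrite -normcR cB; apply: (le_trans (le_normc_cintegral (jB c s))).
rewrite -[leRHS]mulr1 -(gauss_mass n) -RintegralZl//; last exact: gauss_integrable.
apply: le_Rintegral => //; first exact: (jB c s).2.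
exact: (integrableZl measurableT K (gauss_integrable n)).
Qed.

(** The factor [gauss (c *: w)] makes the double integral absolutely convergent and
    allows the exchange; [c] then tends to [0] by dominated convergence. *)
Lemma fourier_inversion_weak :
  cintegral (leb n) (fun s => F s * (eta s)%:C) =
  cintegral (leb n) (fun w => fourier F w * cofourier (fun t => (eta t)%:C) w).
Proof.
have jX : cintegrable (leb n) (fun w => fourier F w * etah w).
  by under eq_fun do rewrite mulrC; exact: (@cintegrableMb _ _ _ _ _ _ H).
have [] := @cdominated R _ _ (leb n)
  (fun k w => (fourier F w * etah w) * (gauss (delta k *: w))%:C)
  (fun w => (fourier F w * etah w) * 1%:C) (fun w => normc (fourier F w * etah w)).
- by move=> k; apply: cmeasurableM jX.1 _; exact: (gauss_dilated_cintegrable (delta_gt0 k)).1.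
- by move=> w; have [] := cvg_ReIm_scale (fourier F w * etah w) (@gauss_delta w).
- by move=> w; have [] := cvg_ReIm_scale (fourier F w * etah w) (@gauss_delta w).
- exact: jX.2.
- by move=> k w; rewrite normcM normc_gauss ler_piMr ?normc_ge0 ?gauss_le1.
move=> _ r1 i1.
have [] := @cdominated R _ _ (leb n)
  (fun k s => F s * (B (delta k) s)%:C)
  (fun s => F s * (eta s)%:C) (fun s => K * normc (F s)).
- by move=> k; exact: (smoothed_inversion (delta_gt0 k)).1.1.
- by move=> s; have [] := cvg_ReIm_scale (F s) (@B_delta s).
- by move=> s; have [] := cvg_ReIm_scale (F s) (@B_delta s).
- exact: (integrableZl measurableT K jF.2).
- by move=> k s; rewrite mulrC normcM normcR ler_wpM2r ?normc_ge0 ?B_le.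
move=> _ r2 i2.
have e k : cintegral (leb n) (fun w => (fourier F w * etah w) * (gauss (delta k *: w))%:C) =
    cintegral (leb n) (fun s => F s * (B (delta k) s)%:C).
  rewrite -(smoothed_inversion (delta_gt0 k)).2.
  by apply: eq_cintegral => w; ring.
have -> : cintegral (leb n) (fun w => fourier F w * cofourier (fun t => (eta t)%:C) w) =
    cintegral (leb n) (fun w => (fourier F w * etah w) * 1%:C).
  by apply: eq_cintegral => w; rewrite mulr1.
apply: complex_ext.
  by move: r1; under eq_fun do rewrite e; move=> r1; exact: (cvg_unique _ r2 r1).
by move: i1; under eq_fun do rewrite e; move=> i1; exact: (cvg_unique _ i2 i1).
Qed.

End weak_inversion.
End fourier.

(** * Fourier inversion almost everywhere *)

Section orthants.
Context {R : realType} {n : nat}.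
Local Notation V := 'cV[R]_n.

Definition orthant (a : V) : set V := [set t | forall i, t i ord0 < a i ord0].
Let G := [set orthant a | a in [set: V]].

Lemma measurable_orthant a : measurable (orthant a).
Proof.
rewrite (_ : orthant a = \bigcap_(i in [set: 'I_n])
    ((fun t : V => t i ord0) @^-1` `]-oo, a i ord0[%classic)).
  apply: fin_bigcap_measurable => [|i _]; first exact: finite_finset.
  by rewrite -[X in measurable X]setTI; apply: (@measurable_coord_cV _ R n i measurableT).
apply/seteqP; split=> t /= h i; first by move=> _; rewrite /= in_itv/= h.
by have := h i I; rewrite /= in_itv.
Qed.

Lemma orthants_generate : @measurable _ V = <<s G >>.
Proof.
apply/seteqP; split; last first.
  apply: smallest_sub; first exact: sigma_algebra_measurable.
  by move=> _ [a _ <-]; exact: measurable_orthant.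
have mcoord (i : 'I_n) : measurable_fun [set: g_sigma_algebraType G]
    ((fun t : V => t i ord0) : g_sigma_algebraType G -> R).
  apply: (measurability _ (RGenInftyO.measurableE R)) => _ [_ [x ->] <-].
  rewrite setTI (_ : _ @^-1` _ =
     \bigcup_k orthant (\col_j (if j == i then x else k%:R))).
    apply: (@bigcupT_measurable _ (g_sigma_algebraType G)) => k.
    by apply: sub_sigma_algebra; exists (\col_j (if j == i then x else k%:R)).
  apply/seteqP; split => t /=; rewrite in_itv/=.
    move=> tx; pose S := \sum_j `|t j ord0|.
    exists (Num.truncn S).+1 => // j; rewrite mxE; case: eqVneq => [->//|_].
    apply: le_lt_trans (truncnS_gt S); apply: (le_trans (ler_norm _)).
    by rewrite /S (bigD1 j)//= lerDl sumr_ge0.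
  by move=> [k _ /(_ i)]; rewrite mxE eqxx.
apply: smallest_sub => /=; first exact: smallest_sigma_algebra.
move=> A; rewrite -bigcup_seq/= => -[i _ [B mB <-]] /=.
by have := mcoord i measurableT B mB; rewrite setTI.
Qed.

Lemma orthants_setI : setI_closed G.
Proof.
move=> _ _ [a _ <-] [b _ <-]; exists (\col_i Num.min (a i ord0) (b i ord0)) => //.
apply/seteqP; split => t /= h.
  by split=> i; have := h i; rewrite mxE lt_min => /andP[].
by move=> i; rewrite mxE lt_min h.1 h.2.
Qed.

(** Orthants are stable under intersection and generate the Borel sets, and the sets
    on which [h] has integral zero form a Dynkin class. *)
Lemma ae_eq0_of_orthants (h : V -> R) :
  (leb n).-integrable setT (fun t => (h t)%:E) ->
  (\int[leb n]_t (h t)%:E = 0)%E ->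
  (forall a, \int[leb n]_(t in orthant a) (h t)%:E = 0)%E ->
  {ae leb n, forall t, h t = 0}.
Proof.
move=> jh hT ha; have mh := measurable_int _ jh.
pose P (A : set V) := (\int[leb n]_(t in A) (h t)%:E = 0)%E.
have sub (A : set V) : measurable A -> (leb n).-integrable A (fun t => (h t)%:E).
  by move=> mA; exact: (integrableS measurableT mA).
have key A : measurable A -> P A.
  move=> mA; have := mA; rewrite orthants_generate; move: A mA.
  suff : forall S, <<s G >> S -> P S by move=> H A mA; exact: H.
  apply: (dynkin_induction orthants_generate orthants_setI hT).
  - by move=> _ [a _ <-]; exact: ha.
  - move=> A mA PA; have : P (A `|` ~` A) by rewrite setUv.
    rewrite /P integral_setU//; first by rewrite [X in (X + _)%E]PA add0e.
    + exact: measurableC.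
    + by rewrite setUv; apply: measurable_int jh.
    + by apply/eqP; rewrite setICr.
  - move=> F mF tF PF; rewrite /P integral_bigcup//; first by rewrite eseries0// => i _ _; exact: PF.
    by apply: sub; exact: bigcupT_measurable.
have H : ae_eq (leb n) setT (fun t => (h t)%:E) (cst 0%E).
  by apply: integral_ae_eq => // E _ mE; rewrite integral0; exact: key.
by apply: filterS H => t /(_ I) [].
Qed.

End orthants.

Section inversion.
Context {R : realType} {n : nat}.
Local Notation V := 'cV[R]_n.
Local Notation C := R[i].

Definition clip (x : R) : R := Num.min 1 (Num.max 0 x).

Lemma clip_ge0 x : 0 <= clip x.
Proof. by rewrite /clip le_min ler01 le_max lexx. Qed.
Lemma clip_le1 x : clip x <= 1.
Proof. by rewrite /clip ge_min lexx. Qed.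
Lemma continuous_clip : continuous clip.
Proof.
move=> x; have h : {for x, continuous ((cst 1 : R -> R^o) \min ((cst 0 : R -> R^o) \max id))}.
  apply: continuous_min; first exact: cst_continuous.
  by apply: continuous_max; [exact: cst_continuous|exact: cvg_id].
exact: h.
Qed.

(** Continuous functions that converge to the indicator of an orthant: weak
    inversion asks for continuous test functions. *)
Definition ramp (a : V) (k : nat) (t : V) : R :=
  \prod_(i < n) clip (k%:R * (a i ord0 - t i ord0)).

Lemma ramp_ge0 a k t : 0 <= ramp a k t.
Proof. by apply: prodr_ge0 => i _; exact: clip_ge0. Qed.
Lemma ramp_le1 a k t : ramp a k t <= 1.
Proof. by apply: prodr_ile1 => i _; rewrite clip_ge0 clip_le1. Qed.

Lemma measurable_ramp a k : measurable_fun setT (ramp a k).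
Proof.
apply: measurable_prod => i _.
apply: measurableT_comp; first by apply: continuous_measurable_fun; exact: continuous_clip.
apply: measurable_funM => //; apply: measurable_funB => //; exact: measurable_coord_cV.
Qed.

Lemma ramp_cvg a t : ramp a k t @[k --> \oo] --> (\1_(orthant a) t : R).
Proof.
have [ta|ta] := pselect (orthant a t); last first.
  rewrite indicE memNset//; apply: cvg_near_cst; apply: nearW => k.
  have [i tai] : exists i, a i ord0 <= t i ord0.
    by apply: contrapT => h; apply: ta => i; rewrite ltNge; apply/negP => ai; apply: h; exists i.
  rewrite /ramp (bigD1 i)//= (_ : clip _ = 0) ?mul0r//.
  rewrite /clip max_l ?min_r//; by rewrite mulr_ge0_le0// subr_le0.
rewrite indicE mem_set//; apply: cvg_near_cst.
pose S := \sum_(i < n) (a i ord0 - t i ord0)^-1.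
near=> k; rewrite /ramp big1// => i _.
have ai : 0 < a i ord0 - t i ord0 by rewrite subr_gt0; exact: ta.
have : 1 <= k%:R * (a i ord0 - t i ord0).
  rewrite -ler_pdivrMr// mul1r; apply: (@le_trans _ _ S).
    rewrite /S (bigD1 i)//= lerDl sumr_ge0// => j _; rewrite invr_ge0 subr_ge0 ltW//; exact: ta.
  by near: k; exact: nbhs_infty_ger.
by move=> h; rewrite /clip max_r ?min_l//; exact: le_trans h.
Unshelve. all: by end_near. Qed.

Lemma ramp_directional a k (s r : V) :
  ramp a k (s + j.+1%:R^-1 *: r) @[j --> \oo] --> ramp a k s.
Proof.
rewrite /ramp; apply: cvg_big => [|i _]; first exact: mul_continuous.
apply: (continuous_cvg _ (@continuous_clip _)).
apply: cvgM; first exact: cvg_cst.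
apply: cvgB; first exact: cvg_cst.
under eq_fun do rewrite !mxE.
have h : (s i ord0 + j.+1%:R^-1 * r i ord0) @[j --> \oo] --> s i ord0 + 0 * r i ord0.
  apply: cvgD; first exact: cvg_cst.
  by apply: cvgM; [exact: cvg_harmonic|exact: cvg_cst].
by rewrite mul0r addr0 in h.
Qed.

Variable F : V -> C.
Hypotheses (jF : cintegrable (leb n) F) (jFh : cintegrable (leb n) (fourier F)).

Let Phi := cofourier (fourier F).
Let H := Rintegral (leb n) setT (fun t => normc (fourier F t)).
Let mPhi : cmeasurable Phi. Proof. exact: cmeasurable_integral_character. Qed.
Let PhiH t : normc (Phi t) <= H. Proof. exact: normc_integral_character. Qed.

Let D t := (F t - Phi t) * (gauss t)%:C.

Let jFg : cintegrable (leb n) (fun t => F t * (gauss t)%:C).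
Proof.
under eq_fun do rewrite mulrC.
apply: (@cintegrableMb _ _ _ _ _ _ 1) => //; first exact: cmeasurable_gauss.
by move=> t; rewrite normc_gauss gauss_le1.
Qed.

Let jPg : cintegrable (leb n) (fun t => Phi t * (gauss t)%:C).
Proof. by apply: (@cintegrableMb _ _ _ _ _ _ H) => //; exact: gauss_cintegrable. Qed.

Let jD : cintegrable (leb n) D.
Proof. by rewrite /D; under eq_fun do rewrite mulrBl; exact: cintegrableB. Qed.

Let weak (chi : V -> R) : measurable_fun setT chi -> (forall t, 0 <= chi t <= 1) ->
  (forall s r : V, chi (s + k.+1%:R^-1 *: r) @[k --> \oo] --> chi s) ->
  cintegral (leb n) (fun t => D t * (chi t)%:C) = 0.
Proof.
move=> mchi chi01 cchi.
have nchi t : normc (chi t)%:C <= 1.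
  by have /andP[c0 c1] := chi01 t; rewrite normcR ger0_norm.
have mc : cmeasurable (fun t => (chi t)%:C) by exact: cmeasurable_real.
pose eta t := gauss t * chi t.
have ceta : cintegrable (leb n) (fun t => (eta t)%:C).
  rewrite /eta; under eq_fun do rewrite rmorphM mulrC.
  by apply: (@cintegrableMb _ _ _ _ _ _ 1) => //; exact: gauss_cintegrable.
have eta1 t : `|eta t| <= 1.
  have /andP[c0 c1] := chi01 t.
  by rewrite normrM !ger0_norm ?gauss_ge0// mulr_ile1 ?gauss_ge0 ?gauss_le1.
have eta_cont (s r : V) : eta (s + k.+1%:R^-1 *: r) @[k --> \oo] --> eta s.
  apply: cvgM; last exact: cchi.
  have dcv (u v : V) : dotv (s + k.+1%:R^-1 *: r) (s + k.+1%:R^-1 *: r) @[k --> \oo] --> dotv s s.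
    rewrite /dotv; apply: cvg_big => [|i _]; first exact: add_continuous.
    have h : (s i ord0 + j.+1%:R^-1 * r i ord0) @[j --> \oo] --> s i ord0 + 0 * r i ord0.
      apply: cvgD; first exact: cvg_cst.
      by apply: cvgM; [exact: cvg_harmonic|exact: cvg_cst].
    rewrite mul0r addr0 in h; under eq_fun do rewrite !mxE.
    exact: (cvgM h h).
  apply: (continuous_cvg _ (@continuous_expR _ _)); apply: cvgN.
  by apply: cvgM; [exact: cvg_cst|exact: dcv].
have main := fourier_inversion_weak jF jFh (cintegrable_Re ceta) eta1 eta_cont.
have fub : cintegral (leb n) (fun w => fourier F w * cofourier (fun t => (eta t)%:C) w) =
    cintegral (leb n) (fun t => Phi t * (eta t)%:C).
  pose f (p : V * V) := fourier F p.1 * ((eta p.2)%:C * cexpi (2 * pi * dotv p.2 p.1)).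
  have jf : cintegrable (leb n \x leb n)%E f.
    apply: (@cintegrable_tensor _ _ _ _ _ (leb n) (leb n) (fun t => normc (fourier F t)) (fun t => normc (eta t)%:C)).
    - apply: cmeasurableM; last apply: cmeasurableM.
      + exact: (cmeasurable_fst jFh.1).
      + exact: (cmeasurable_snd ceta.1).
      + exact: cmeasurable_pairing_character.
    - exact: jFh.2.
    - exact: ceta.2.
    - by move=> x y; rewrite !normcM normc_cexpi mulr1.
  transitivity (cintegral (leb n) (fun w => cintegral (leb n) (fun t => f (w, t)))).
    by apply: eq_cintegral => w; rewrite -cintegralZ; last exact: cintegrable_character.
  rewrite cfubini//; apply: eq_cintegral => t; rewrite mulrC -cintegralZ; last first.
    exact: cintegrable_character.
  by apply: eq_cintegral => w; rewrite /f/= (dotvC w t); ring.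
transitivity (cintegral (leb n) (fun t => F t * (eta t)%:C - Phi t * (eta t)%:C)).
  by apply: eq_cintegral => t; rewrite /D /eta rmorphM/=; ring.
rewrite cintegralB; last 2 first.
- under eq_fun do rewrite /eta rmorphM mulrA mulrC.
  exact: (@cintegrableMb _ _ _ _ _ _ 1).
- under eq_fun do rewrite /eta rmorphM mulrA mulrC.
  exact: (@cintegrableMb _ _ _ _ _ _ 1).
by rewrite main fub subrr.
Qed.

(** Weak inversion, applied to ramps, shows that the difference of [F] and its
    double transform has integral zero over every orthant.  A Gaussian weight is
    included because the double transform is merely bounded. *)
Lemma fourier_inversion : {ae leb n, forall t, F t = cofourier (fourier F) t}.
Proof.
have DT : cintegral (leb n) D = 0.
  rewrite -[RHS](@weak (cst 1)) //.
  - by apply: eq_cintegral => t; rewrite mulr1.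
  - by move=> t; rewrite ler01 lexx.
  - by move=> s r; exact: cvg_cst.
have Dorth a : cintegral (leb n) (fun t => D t * (\1_(orthant a) t)%:C) = 0.
  have [] := @cdominated R _ _ (leb n) (fun k t => D t * (ramp a k t)%:C)
     (fun t => D t * (\1_(orthant a) t)%:C) (fun t => normc (D t)).
  - by move=> k; apply: cmeasurableM jD.1 _; apply: cmeasurable_real; exact: measurable_ramp.
  - by move=> t; have [] := cvg_ReIm_scale (D t) (@ramp_cvg a t).
  - by move=> t; have [] := cvg_ReIm_scale (D t) (@ramp_cvg a t).
  - exact: jD.2.
  - move=> k t; rewrite normcM normcR ger0_norm ?ramp_ge0// ler_piMr ?normc_ge0 ?ramp_le1//.
  have e k : cintegral (leb n) (fun t => D t * (ramp a k t)%:C) = 0.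
    apply: weak; first exact: measurable_ramp.
      by move=> t; rewrite ramp_ge0 ramp_le1.
    exact: ramp_directional.
  move=> _ r1 i1; apply: complex_ext.
    by move: r1; under eq_fun do rewrite e; move=> r1; exact: (cvg_unique _ r1 (cvg_cst _)).
  by move: i1; under eq_fun do rewrite e; move=> i1; exact: (cvg_unique _ i1 (cvg_cst _)).
have orth (h : V -> R) : (leb n).-integrable setT (fun t => (h t)%:E) ->
    forall a, (\int[leb n]_(t in orthant a) (h t)%:E =
       (Rintegral (leb n) setT (fun t => h t * \1_(orthant a) t))%:E)%E.
  move=> jh a; have mh := measurable_int _ jh; rewrite integral_mkcond /Rintegral.
  have jr : (leb n).-integrable setT (fun t => (h t * \1_(orthant a) t)%:E).
    apply: le_integrable jh => //.
      apply/measurable_EFinP; apply: measurable_funM; first exact/measurable_EFinP.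
      by apply: measurable_indic; exact: measurable_orthant.
    move=> t _; rewrite /= lee_fin normrM ler_piMr// indicE; by case: (_ \in _); rewrite ?normr1 ?normr0.
  rewrite fineK; last exact: integrable_fin_num.
  apply: eq_integral => t _; rewrite patchE indicE; by case: ifP; rewrite ?mulr1 ?mulr0.
have zero (h : V -> R) : (leb n).-integrable setT (fun t => (h t)%:E) ->
    Rintegral (leb n) setT h = 0 ->
    (forall a, Rintegral (leb n) setT (fun t => h t * \1_(orthant a) t) = 0) ->
    {ae leb n, forall t, h t = 0}.
  move=> jh h0 ha; apply: ae_eq0_of_orthants => //.
    by rewrite -(fineK (integrable_fin_num measurableT jh)) -[fine _]/(Rintegral (leb n) setT h) h0.
  by move=> a; rewrite orth// ha.
have r0 : {ae leb n, forall t, Re (D t) = 0}.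
  apply: zero; first exact: cintegrable_Re.
    by have := congr1 (@complex.Re R) DT.
  move=> a; have := congr1 (@complex.Re R) (Dorth a) => /= <-.
  by apply: eq_Rintegral => t _; rewrite mulrC -ReZ mulrC.
have i0 : {ae leb n, forall t, Im (D t) = 0}.
  apply: zero; first exact: cintegrable_Im.
    by have := congr1 (@complex.Im R) DT.
  move=> a; have := congr1 (@complex.Im R) (Dorth a) => /= <-.
  by apply: eq_Rintegral => t _; rewrite mulrC -ImZ mulrC.
apply: filterS2 r0 i0 => t rt it.
have : D t = 0 by exact: complex_ext.
move=> /eqP; rewrite mulf_eq0 subr_eq0 => /orP[/eqP//|/eqP/(congr1 (@complex.Re R))/= g0].
by have := @expR_gt0 R (- (pi * dotv t t)); rewrite -[expR _]/(gauss t) g0 ltxx.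
Qed.

End inversion.

(** * Orthogonality relations of the short-time Fourier transform *)

Section parseval.
Context {R : realType} {n : nat}.
Local Notation V := 'cV[R]_n.
Local Notation C := R[i].

(** By Fubini the left side is the integral of the conjugate of [U] against the
    double transform of [F], to which inversion applies. *)
Lemma parseval (F U : V -> C) : cintegrable (leb n) F -> cintegrable (leb n) (fourier F) ->
  cintegrable (leb n) U -> cmeasurable (fun t => F t * conjc (U t)) ->
  cintegral (leb n) (fun w => fourier F w * conjc (fourier U w)) =
  cintegral (leb n) (fun t => F t * conjc (U t)).
Proof.
move=> jF jFh jU mFU; have jJ := cintegrableJ jU.
pose f (p : V * V) := fourier F p.1 * (conjc (U p.2) * cexpi (2 * pi * dotv p.2 p.1)).
have jf : cintegrable (leb n \x leb n)%E f.
  apply: (@cintegrable_tensor _ _ _ _ _ (leb n) (leb n) (fun t => normc (fourier F t)) (fun t => normc (U t))).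
  - apply: cmeasurableM; last apply: cmeasurableM.
    + exact: (cmeasurable_fst jFh.1).
    + exact: (cmeasurable_snd jJ.1).
    + exact: cmeasurable_pairing_character.
  - exact: jFh.2.
  - exact: jU.2.
  - by move=> x y; rewrite !normcM normc_cexpi mulr1 normcJ.
transitivity (cintegral (leb n) (fun w => cintegral (leb n) (fun t => f (w, t)))).
  apply: eq_cintegral => w; rewrite /fourier -cintegralJ; last first.
    by under eq_fun do rewrite -mulNr; exact: cintegrable_character.
  rewrite -cintegralZ; last first.
    by apply: cintegrableJ; under eq_fun do rewrite -mulNr; exact: cintegrable_character.
  by apply: eq_cintegral => t; rewrite conjcM -cexpiN opprK.
rewrite cfubini//.
transitivity (cintegral (leb n) (fun t => conjc (U t) * cofourier (fourier F) t)).
  apply: eq_cintegral => t; rewrite -cintegralZ; last exact: cintegrable_character.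
  by apply: eq_cintegral => w; rewrite /f/= (dotvC w t); ring.
apply: ae_eq_cintegral => //.
  by apply: cmeasurableM jJ.1 _; exact: cmeasurable_integral_character.
by apply: filterS (fourier_inversion jF jFh) => t <-; rewrite mulrC.
Qed.

End parseval.

Section moyal.
Context {R : realType} {d : nat}.
Local Notation V := 'cV[R]_d.
Local Notation C := R[i].
Local Notation g := (@gaussian R d).
Local Notation ip := (cinner (leb d)).
Local Notation n2 := (nrm2 (leb d)).

Lemma gauss_even (t : V) : gauss (- t) = gauss t.
Proof. by rewrite /gauss dotvNl dotvNr opprK. Qed.

Lemma L2_gaussian : L2 g.
Proof.
apply/cLp2P; rewrite gaussianE; split; first exact: cmeasurable_gauss.
apply: le_integrable (gauss_integrable d) => //.
  by apply/measurable_EFinP; apply: measurable_normc2; exact: cmeasurable_gauss.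
move=> t _; rewrite normc_gauss /= lee_fin !ger0_norm ?gauss_ge0 ?sqr_ge0//.
by rewrite expr2 ler_piMl ?gauss_ge0 ?gauss_le1.
Qed.

Lemma gauss_square_integrable : (leb d).-integrable setT (fun t : V => (gauss t ^+ 2)%:E).
Proof.
have /cLp2P[_] := L2_gaussian; rewrite gaussianE.
by under eq_fun do rewrite normc_gauss.
Qed.

Lemma nrm2_gaussianE : n2 g = Rintegral (leb d) setT (fun t : V => gauss t ^+ 2).
Proof. by rewrite gaussianE; apply: eq_Rintegral => t _; rewrite normc_gauss. Qed.

Lemma stft_fourier (f : V -> C) x w :
  stft g f (col_mx x w) = fourier (fun t => f t * (gauss (t - x))%:C) w.
Proof.
apply: eq_cintegral => t; rewrite /tfshift col_mxKu col_mxKd gaussianE conjcM -cexpiN.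
by rewrite conjc_real; ring.
Qed.

Lemma cintegrable_windowed (f : V -> C) x : L2 f ->
  cintegrable (leb d) (fun t => f t * (gauss (t - x))%:C).
Proof.
move=> hf; have := cLp2_cintegrableM hf (L2_tfshift (col_mx x 0) L2_gaussian).
have d0 (v : V) : dotv v 0 = 0 by rewrite /dotv big1// => i _; rewrite mxE mulr0.
rewrite gaussianE /tfshift col_mxKu col_mxKd.
by under eq_fun do rewrite d0 mulr0 cexpi0 mul1r conjc_real.
Qed.

Lemma normc_stft (f : V -> C) z : L2 f ->
  normc (stft g f z) <= Num.sqrt (n2 f * n2 g).
Proof.
move=> hf; rewrite -ler_sqr ?nnegrE ?normc_ge0 ?sqrtr_ge0//.
have K0 : 0 <= n2 f * n2 g by rewrite mulr_ge0 ?nrm2_ge0.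
rewrite (sqr_sqrtr K0) -[X in _ <= _ * X](nrm2_tfshift z L2_gaussian).
by apply: cauchy_schwarz => //; exact: L2_tfshift L2_gaussian.
Qed.

Let shift_sub_measurable : measurable_fun setT (fun p : V * V => p.2 - p.1).
Proof.
apply: measurable_fun_cV => i; under eq_fun do rewrite !mxE.
apply: measurable_funB; apply: (measurableT_comp (measurable_coord_cV i)).
  exact: measurable_snd.
exact: measurable_fst.
Qed.

Lemma measurable_gauss_diff : measurable_fun setT (fun p : V * V => gauss (p.2 - p.1)).
Proof. exact: (measurableT_comp (@measurable_gauss_cV R d) shift_sub_measurable). Qed.

Lemma integral_gauss_square_translate (t : V) :
  (\int[leb d]_x ((gauss (t - x) ^+ 2)%:E) = (n2 g)%:E)%E.
Proof.
have fn := integrable_fin_num measurableT gauss_square_integrable.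
have -> : ((n2 g)%:E = 1%:E * \int[leb d]_v ((gauss v ^+ 2)%:E))%E.
  by rewrite mul1e -[RHS](fineK fn) nrm2_gaussianE.
rewrite -(leb_translate (- t) (f := fun v : V => (gauss v ^+ 2)%:E)).
- by apply: eq_integral => x _; rewrite -gauss_even opprB.
- exact: measurable_int gauss_square_integrable.
- by move=> x; rewrite lee_fin sqr_ge0.
Qed.

Lemma cintegrable_convolution (h : V -> C) : cintegrable (leb d) h ->
  cintegrable (leb d \x leb d)%E (fun p : V * V => h p.2 * (gauss (p.2 - p.1) ^+ 2)%:C).
Proof.
move=> jh.
have mf : cmeasurable (fun p : V * V => h p.2 * (gauss (p.2 - p.1) ^+ 2)%:C).
  apply: cmeasurableM; first exact: (cmeasurable_snd jh.1).
  by apply: cmeasurable_real; apply: measurable_funX; exact: measurable_gauss_diff.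
split => //.
have mn : measurable_fun setT (fun p : V * V => (normc (h p.2 * (gauss (p.2 - p.1) ^+ 2)%:C))%:E).
  by apply/measurable_EFinP; exact: measurable_normc.
apply/(integrable21ltyP (leb d) (leb d) mn) => /=.
have [mh /integrableP[_ Ih]] := jh.
rewrite (_ : (\int[leb d]_y _)%E = ((n2 g)%:E * \int[leb d]_t `|(normc (h t))%:E|)%E).
  by apply: lte_mul_pinfty => //; rewrite lee_fin nrm2_ge0.
rewrite -ge0_integralZl//; last 2 first.
- by apply/measurable_EFinP; apply: measurableT_comp => //; exact: measurable_normc.
- by rewrite lee_fin nrm2_ge0.
apply: eq_integral => t _; rewrite muleC -(integral_gauss_square_translate t).
rewrite -ge0_integralZl//.
- apply: eq_integral => x _; rewrite normcM normcR.
  by rewrite /= -EFinM normrM normr_id (ger0_norm (sqr_ge0 _)).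
- apply/measurable_EFinP; apply: measurable_funX.
  apply: (measurableT_comp (@measurable_gauss_cV R d)).
  apply: measurable_fun_cV => i; under eq_fun do rewrite !mxE.
  by apply: measurable_funB => //; exact: measurable_coord_cV.
- by move=> x _; rewrite lee_fin sqr_ge0.
Qed.

(** At fixed position [x] the transform is a Fourier transform in the frequency, so
    that [parseval] applies for almost every [x]; integration over [x] then
    leaves the squared norm of the window.  Integrability of [stft g f] is what inversion
    requires at almost every [x]. *)
Lemma moyal (f u : V -> C) : L2 f -> L2 u ->
  cintegrable (leb (d + d)) (stft g f) -> cmeasurable (stft g u) ->
  cintegral (leb (d + d)) (fun z => stft g f z * conjc (stft g u z)) =
  (n2 g)%:C * ip f u.
Proof.
move=> hf hu jf mu.
pose K := Num.sqrt (n2 u * n2 g).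
have jfu : cintegrable (leb (d + d)) (fun z => stft g f z * conjc (stft g u z)).
  under eq_fun do rewrite mulrC.
  apply: (@cintegrableMb _ _ _ _ _ _ K) => //; first exact: cmeasurableJ.
  by move=> z; rewrite normcJ; exact: normc_stft.
have pushes h : cintegrable (leb (d + d)) h ->
    cintegrable (leb d \x leb d)%E (fun p : V * V => h (col_mx p.1 p.2)).
  exact: (cov_cintegrable (@measurable_col_mx R d d) ltr01 (@cov_col_mx R d d)).
pose h t := f t * conjc (u t).
have jh : cintegrable (leb d) h by exact: cLp2_cintegrableM.
have jc := cintegrable_convolution jh.
rewrite cintegral_add//.
transitivity (cintegral (leb d) (fun x => cintegral (leb d) (fun t => h t * (gauss (t - x) ^+ 2)%:C))).
  apply: ae_eq_cintegral.
  - exact: (cintegrable_fubini1 (pushes _ jfu)).1.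
  - exact: (cintegrable_fubini1 jc).1.
  apply: filterS (cintegrable_ae1 (pushes _ jf)) => x jx.
  pose win (k : V -> C) (t : V) := k t * (gauss (t - x))%:C.
  transitivity (cintegral (leb d) (fun w => fourier (win f) w * conjc (fourier (win u) w))).
    by apply: eq_cintegral => w; rewrite !stft_fourier.
  rewrite parseval.
  - apply: eq_cintegral => t; rewrite /win conjcM conjc_real /h rmorphXn/=; ring.
  - exact: cintegrable_windowed.
  - by move: jx => /=; under eq_fun do rewrite stft_fourier.
  - exact: cintegrable_windowed.
  - have [m1 _] := cintegrable_windowed x hf; have [m2 _] := cintegrable_windowed x hu.
    by apply: cmeasurableM => //; exact: cmeasurableJ.
rewrite (cfubini jc)/= -cintegralZ//; apply: eq_cintegral => t.
rewrite cintegralZ.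
  rewrite mulrC; congr (_ * _); apply: complex_ext => /=; last by rewrite /Rintegral integral0.
  by rewrite /Rintegral integral_gauss_square_translate.
apply: cintegrable_ReIm => /=; last exact: integrable0.
apply/integrableP; split.
  apply/measurable_EFinP; apply: measurable_funX.
  apply: (measurableT_comp (@measurable_gauss_cV R d)).
  apply: measurable_fun_cV => i; under eq_fun do rewrite !mxE.
  by apply: measurable_funB => //; exact: measurable_coord_cV.
under eq_integral do rewrite gee0_abs ?lee_fin ?sqr_ge0//.
by rewrite integral_gauss_square_translate ltry.
Qed.

End moyal.

(** * Matrix coefficients as superpositions of Gaussians *)

Section kernel.
Context {R : realType} {d : nat}.
Local Notation V := 'cV[R]_d.
Local Notation W := 'cV[R]_(d + d).
Local Notation C := R[i].
Local Notation phi := (@gaussian R d).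
Local Notation ip := (cinner (leb d)).
Local Notation n2 := (nrm2 (leb d)).

Definition halfgauss (y : W) : R := expR (- (pi / 2 * dotv y y)).

(** The squared norm of the Gaussian window, see [nrm2_gaussian]. *)
Definition kappa : R := (Num.sqrt 2) ^- d.

Lemma kappa_gt0 : 0 < kappa.
Proof. by rewrite invr_gt0 exprn_gt0// sqrtr_gt0. Qed.

Lemma halfgauss_ge0 y : 0 <= halfgauss y. Proof. exact: expR_ge0. Qed.

Lemma halfgauss_le1 y : halfgauss y <= 1.
Proof.
rewrite -expR0 ler_expR oppr_le0 mulr_ge0 ?dotv_ge0//.
by rewrite divr_ge0 ?pi_ge0.
Qed.

(** Completing the square, and rescaling by [sqrt 2] to reach [gauss_fourier]. *)
Lemma ambiguity_gaussian (y : W) :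
  ip (tfshift y phi) phi = (kappa * halfgauss y)%:C * cexpi (pi * pairing y y).
Proof.
set x := usubmx y; set w := dsubmx y.
pose s : R := Num.sqrt 2; have s0 : 0 < s by rewrite sqrtr_gt0.
have ss : s * s = 2 by rewrite -expr2 sqr_sqrtr.
have sn : s != 0 by rewrite gt_eqF.
pose a : V := - (s^-1 *: x); pose r : V := s^-1 *: w.
pose f (v : V) := (gauss v)%:C * cexpi (2 * pi * dotv v r).
have jf : cintegrable (leb d) f by exact: gauss_character_cintegrable.
have := cov_cintegral (cov_scale a s0) jf; rewrite gauss_fourier => cov.
transitivity ((expR (- (pi / 2 * dotv x x)))%:C * cexpi (pi * dotv x w) *
    cintegral (leb d) (fun v => f (s *: v + a))).
  have k0 : 0 < s ^- d by rewrite invr_gt0 exprn_gt0.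
  rewrite -cintegralZ; last exact: (cov_cintegrable (measurable_affine s a) k0 (cov_scale a s0) jf).
  apply: eq_cintegral => t; rewrite /tfshift gaussianE conjc_real -/x -/w /f /r dotvZr.
  have e1 : gauss (t - x) * gauss t = expR (- (pi / 2 * dotv x x)) * gauss (s *: t + a).
    rewrite /gauss -!expRD; congr expR; rewrite /a.
    rewrite !(dotvDl, dotvDr, dotvNl, dotvNr, dotvZl, dotvZr) !(dotvC x t).
    rewrite !(mulrDr, mulrN, opprK) !(mulVKf sn) (mulrA s s) ss.
    by rewrite (mulrA s^-1 s^-1) -invfM ss; field.
  have e2 : cexpi (2 * pi * dotv t w) =
      cexpi (pi * dotv x w) * cexpi (2 * pi * (s^-1 * dotv (s *: t + a) w)).
    rewrite -cexpiD; congr cexpi; rewrite /a dotvDl dotvNl !dotvZl.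
    have -> : s^-1 * (s * dotv t w - s^-1 * dotv x w) = dotv t w - dotv x w / 2.
      by rewrite mulrBr (mulKf sn) (mulrA s^-1 s^-1) -invfM ss [2^-1 * _]mulrC.
    by field.
  rewrite e2 -[RHS]mulrA -[LHS]mulrA -rmorphM/= e1 rmorphM/=; ring.
rewrite cov -/kappa /pairing -/x -/w mulrAC -!rmorphM/=; congr (_%:C * _).
rewrite mulrCA; congr (_ * _).
rewrite /halfgauss dotv_split -/x -/w /gauss -expRD; congr expR.
rewrite /r dotvZl dotvZr.
have -> : s^-1 * (s^-1 * dotv w w) = dotv w w / 2 by rewrite mulrA -invfM ss mulrC.
by field.
Qed.

Definition kernel_phase (w z z' : W) : R :=
  2 * pi * pairing w (z - w) + 2 * pi * pairing z' (z - w - z') +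
  pi * pairing (z - w - z') (z - w - z').

(** The matrix coefficient of [tfshift w] between the Gaussian wave packets at
    [p.1] and [p.2], in closed form, see [kernelE]. *)
Definition kernel (w : W) (p : W * W) : C :=
  (kappa * halfgauss (p.1 - w - p.2))%:C * cexpi (kernel_phase w p.1 p.2).

Lemma normc_kernel w p : normc (kernel w p) = kappa * halfgauss (p.1 - w - p.2).
Proof.
rewrite normcM normc_cexpi mulr1 normcR ger0_norm// mulr_ge0 ?halfgauss_ge0//.
exact: ltW kappa_gt0.
Qed.

Lemma ip_tfshift_gaussian (v z' : W) :
  ip (tfshift v phi) (tfshift z' phi) =
  (kappa * halfgauss (v - z'))%:C *
  cexpi (2 * pi * pairing z' (v - z') + pi * pairing (v - z') (v - z')).
Proof.
rewrite ip_tfshift2; [|exact: L2_gaussian|exact: L2_gaussian].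
by rewrite ambiguity_gaussian cexpiD; ring.
Qed.

Lemma measurable_addcV d1 (T : measurableType d1) m (f g : T -> 'cV[R]_m) :
  measurable_fun setT f -> measurable_fun setT g ->
  measurable_fun setT (fun t => f t + g t).
Proof.
move=> mf mg; apply: measurable_fun_cV => i; under eq_fun do rewrite mxE.
apply: measurable_funD; first exact: (measurableT_comp (measurable_coord_cV i) mf).
exact: (measurableT_comp (measurable_coord_cV i) mg).
Qed.

Lemma measurable_oppcV d1 (T : measurableType d1) m (f : T -> 'cV[R]_m) :
  measurable_fun setT f -> measurable_fun setT (fun t => - f t).
Proof.
move=> mf; apply: measurable_fun_cV => i; under eq_fun do rewrite mxE.
apply: (measurableT_comp (@oppr_measurable R setT)).
exact: (measurableT_comp (measurable_coord_cV i) mf).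
Qed.

Lemma measurable_pairing d1 (T : measurableType d1) (f g : T -> W) :
  measurable_fun setT f -> measurable_fun setT g ->
  measurable_fun setT (fun t => pairing (f t) (g t)).
Proof.
move=> mf mg; apply: measurable_dotv.
  exact: (measurableT_comp (@measurable_usubmx R d d)).
exact: (measurableT_comp (@measurable_dsubmx R d d)).
Qed.

Lemma cmeasurable_gaussian_overlap d1 (T : measurableType d1) (v z' : T -> W) :
  measurable_fun setT v -> measurable_fun setT z' ->
  cmeasurable (fun t => ip (tfshift (v t) phi) (tfshift (z' t) phi)).
Proof.
move=> mv mz; under eq_fun do rewrite ip_tfshift_gaussian.
have ms : measurable_fun setT (fun t => v t - z' t).
  by apply: measurable_addcV => //; exact: measurable_oppcV.
apply: cmeasurableM.
  apply: cmeasurable_real; apply: measurable_funM => //.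
  apply: (@measurableT_comp _ _ _ _ _ _ (@expR R)) => //.
  apply: (measurableT_comp (@oppr_measurable R setT)).
  by apply: measurable_funM => //; exact: measurable_dotv.
apply: cmeasurable_cexpi; apply: measurable_funD; apply: measurable_funM => //.
  exact: measurable_pairing.
exact: measurable_pairing.
Qed.

Lemma kernelE w p : kernel w p = cexpi (2 * pi * pairing w (p.1 - w)) *
  ip (tfshift (p.1 - w) phi) (tfshift p.2 phi).
Proof.
rewrite ip_tfshift_gaussian mulrCA -cexpiD.
by rewrite /kernel /kernel_phase [in RHS]addrA.
Qed.

Lemma cmeasurable_kernel w : cmeasurable (kernel w).
Proof.
have m1 : measurable_fun setT (fun p : W * W => p.1 - w).
  by apply: measurable_addcV; [exact: measurable_fst|exact: measurable_cst].
rewrite (funext (kernelE w)).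
apply: cmeasurableM.
  apply: cmeasurable_cexpi; apply: measurable_funM => //.
  by apply: measurable_pairing => //; exact: measurable_cst.
by apply: cmeasurable_gaussian_overlap => //; exact: measurable_snd.
Qed.

Section expansion.
Variables (f h : V -> C).
Hypotheses (hf : L2 f) (hh : L2 h).
Hypotheses (jf : cintegrable (leb (d + d)) (stft phi f)).
Hypotheses (jh : cintegrable (leb (d + d)) (stft phi h)).

Let Vf := stft phi f.
Let Vh := stft phi h.

Let Lphi z : L2 (tfshift z phi). Proof. exact: L2_tfshift L2_gaussian. Qed.

Let stft_shift w z : conjc (stft phi (tfshift w h) z) =
  cexpi (2 * pi * pairing w (z - w)) * conjc (Vh (z - w)).
Proof.
have c1 := cinner_conj (L2_tfshift w hh) (Lphi z).
have c2 := cinner_conj hh (Lphi (z - w)).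
transitivity (ip (tfshift z phi) (tfshift w h)); first exact: (esym c1).
rewrite ip_tfshift2//; last exact: L2_gaussian.
by congr (_ * _); exact: c2.
Qed.

Let reproduce v : conjc ((n2 phi)%:C * Vh v) =
  cintegral (leb (d + d)) (fun z' => conjc (Vh z') * ip (tfshift v phi) (tfshift z' phi)).
Proof.
have ms : cmeasurable (stft phi (tfshift v phi)).
  by apply: (@cmeasurable_gaussian_overlap _ _ (fun=> v) id); [exact: measurable_cst|exact: measurable_id].
have := moyal hh (Lphi v) jh ms; rewrite -/(Vh v) => <-.
rewrite -cintegralJ; last first.
  under eq_fun do rewrite mulrC.
  apply: (@cintegrableMb _ _ _ _ _ _ (Num.sqrt (n2 (tfshift v phi) * n2 phi))) => //.
    exact: cmeasurableJ.
  by move=> z; rewrite normcJ; exact: normc_stft.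
by apply: eq_cintegral => z'; rewrite conjcM conjcK.
Qed.

Lemma kernel_integrable w :
  cintegrable (leb (d + d) \x leb (d + d))%E (fun p => Vf p.1 * conjc (Vh p.2) * kernel w p).
Proof.
apply: (@cintegrable_tensor _ _ _ _ _ (leb (d + d)) (leb (d + d))
  (fun z => kappa * normc (Vf z)) (fun z => normc (Vh z))).
- apply: cmeasurableM; first apply: cmeasurableM.
  + exact: (cmeasurable_fst jf.1).
  + exact: (cmeasurable_snd (cmeasurableJ jh.1)).
  + exact: cmeasurable_kernel.
- exact: (integrableZl measurableT kappa jf.2).
- exact: jh.2.
- have aux (a b k e : R) : 0 <= a -> 0 <= b -> 0 <= k -> e <= 1 -> a * b * (k * e) <= k * a * b.
    move=> a0 b0 k0 e1; rewrite mulrC -[leLHS]mulrA -[leRHS]mulrA ler_wpM2l//.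
    by rewrite ler_piMl ?mulr_ge0.
  move=> x y; rewrite 2!normcM normcJ normc_kernel.
  exact: (aux _ _ _ _ (normc_ge0 _) (normc_ge0 _) (ltW kappa_gt0) (halfgauss_le1 _)).
Qed.

(** Both functions are expanded in Gaussian wave packets by [moyal]: first [f]
    against the shifted [h], then [h] against each wave packet.  All dependence on
    [w] ends up in the kernel. *)
Lemma inner_tfshift_expansion w :
  ((n2 phi) ^+ 2)%:C * ip f (tfshift w h) =
  cintegral (leb (d + d) \x leb (d + d))%E
    (fun p => Vf p.1 * conjc (Vh p.2) * kernel w p).
Proof.
have ms : cmeasurable (stft phi (tfshift w h)).
  have -> : stft phi (tfshift w h) = fun z =>
      conjc (cexpi (2 * pi * pairing w (z - w)) * conjc (Vh (z - w))).
    by apply/funext => z; rewrite -stft_shift conjcK.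
  have mz : measurable_fun setT (fun z : W => z - w).
    by apply: measurable_addcV; [exact: measurable_id|exact: measurable_cst].
  apply: cmeasurableJ; apply: cmeasurableM.
    apply: cmeasurable_cexpi; apply: measurable_funM => //.
    by apply: measurable_pairing => //; exact: measurable_cst.
  by apply: cmeasurableJ; exact: (cmeasurable_comp jh.1).
rewrite expr2 rmorphM -mulrA; have := moyal hf (L2_tfshift w hh) jf ms => <-.
rewrite cfubini1; last exact: kernel_integrable.
rewrite -cintegralZ; last first.
  under eq_fun do rewrite mulrC.
  apply: (@cintegrableMb _ _ _ _ _ _ (Num.sqrt (n2 (tfshift w h) * n2 phi))) => //.
    exact: cmeasurableJ.
  by move=> z; rewrite normcJ; apply: normc_stft; exact: L2_tfshift.
apply: eq_cintegral => z.
transitivity ((n2 phi)%:C * (Vf z * (cexpi (2 * pi * pairing w (z - w)) * conjc (Vh (z - w))))).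
  by congr (_ * (_ * _)); exact: stft_shift.
transitivity (Vf z * cexpi (2 * pi * pairing w (z - w)) * conjc ((n2 phi)%:C * Vh (z - w))).
  by rewrite conjcM conjc_real; ring.
rewrite reproduce -cintegralZ; last first.
  under eq_fun do rewrite mulrC.
  apply: (@cintegrableMb _ _ _ _ _ _ (Num.sqrt (n2 (tfshift (z - w) phi) * n2 phi))).
  - exact: cintegrableJ.
  - apply: (@cmeasurable_gaussian_overlap _ _ (fun=> z - w) id); [exact: measurable_cst|exact: measurable_id].
  - by move=> z'; apply: (@normc_stft _ _ (tfshift (z - w) phi)); exact: Lphi.
by apply: eq_cintegral => z'; rewrite (kernelE w (z, z')); exact: mulrACA.
Qed.

End expansion.
End kernel.

(** * Gaussian and lattice estimates *)

Section onenorm.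
Context {R : realType} {n : nat}.
Implicit Types u v : 'cV[R]_n.

Definition onenorm v : R := \sum_(i < n) `|v i ord0|.

Lemma onenorm_ge0 v : 0 <= onenorm v.
Proof. by apply: sumr_ge0. Qed.
Lemma onenormD u v : onenorm (u + v) <= onenorm u + onenorm v.
Proof.
by rewrite /onenorm -big_split/=; apply: ler_sum => i _; rewrite mxE ler_normD.
Qed.
Lemma onenormN v : onenorm (- v) = onenorm v.
Proof. by apply: eq_bigr => i _; rewrite mxE normrN. Qed.
Lemma onenormB u v : onenorm (u - v) <= onenorm u + onenorm v.
Proof. by rewrite -(onenormN v) onenormD. Qed.
Lemma onenorm_coord v i : `|v i ord0| <= onenorm v.
Proof. by rewrite /onenorm (bigD1 i)//= lerDl sumr_ge0. Qed.

Lemma dotv_le u v : `|dotv u v| <= onenorm u * onenorm v.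
Proof.
apply: (le_trans (ler_norm_sum _ _ _)); rewrite {1}/onenorm mulr_suml.
by apply: ler_sum => i _; rewrite normrM ler_wpM2l// onenorm_coord.
Qed.

Lemma onenorm_intr (k : 'cV[int]_n) : onenorm (map_mx intr k) = norm1 k.
Proof. by apply: eq_bigr => i _; rewrite mxE -intr_norm pmulrn. Qed.

Lemma onenorm_mulmx (A : 'M[R]_n) (e : R) v : (forall i j, `|A i j| <= e) ->
  onenorm (A *m v) <= n%:R * e * onenorm v.
Proof.
move=> Ae; apply: (@le_trans _ _ (\sum_(i < n) e * onenorm v)); last first.
  by rewrite sumr_const card_ord -[leRHS]mulrA mulr_natl.
apply: ler_sum => i _; rewrite mxE; apply: (le_trans (ler_norm_sum _ _ _)).
rewrite mulr_sumr; apply: ler_sum => j _.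
by rewrite normrM ler_wpM2r.
Qed.

End onenorm.

Section kernel_estimates.
Context {R : realType} {d : nat}.
Local Notation n := (d + d)%N.
Local Notation W := 'cV[R]_(d + d).
Local Notation N := onenorm.
Implicit Types z w v : W.

Lemma onenorm_usubmx z : N (usubmx z) <= N z.
Proof.
rewrite [leRHS]/onenorm big_split_ord/= -[leLHS]addr0 lerD ?sumr_ge0//.
by apply: ler_sum => i _; rewrite mxE.
Qed.

Lemma onenorm_dsubmx z : N (dsubmx z) <= N z.
Proof.
rewrite [leRHS]/onenorm big_split_ord/= -[leLHS]add0r lerD ?sumr_ge0//.
by apply: ler_sum => i _; rewrite mxE.
Qed.

Lemma pairing_le z w : `|pairing z w| <= N z * N w.
Proof.
apply: (le_trans (dotv_le _ _)).
by rewrite ler_pM ?onenorm_ge0 ?onenorm_usubmx ?onenorm_dsubmx.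
Qed.

(** The rate [3] is chosen so that [expR (- N v)] remains when a quadratic weight,
    estimated by [expR (2 * N v)], has been absorbed. *)
Lemma halfgauss_decay v : halfgauss v <= expR (3 * n%:R) * expR (- (3 * N v)).
Proof.
rewrite -expRD ler_expR /dotv /onenorm !mulr_sumr -sumrN.
have -> : 3 * n%:R = \sum_(i < n) (3 : R) by rewrite sumr_const card_ord mulr_natr.
rewrite -sumrN -big_split/=; apply: ler_sum => i _.
have p2 : 2 <= pi :> R by exact: pi_ge2.
set x := v i ord0; have := normr_ge0 x; rewrite -expr2 -[x ^+ 2]real_normK ?num_real//.
have := sqr_ge0 (`|x| - 3 / 2); set a := `|x| => a1 a0.
have : (pi / 2 - 1) * a ^+ 2 >= 0 by rewrite mulr_ge0 ?sqr_ge0// subr_ge0 ler_pdivlMr// mul1r.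
nra.
Qed.

Lemma ler_expR_diff (a b : R) : `|expR (- a) - expR (- b)| <= `|a - b| * (expR (- a) + expR (- b)).
Proof.
wlog ab : a b / a <= b.
  move=> H; case/orP : (le_total a b) => h; first exact: H.
  by rewrite (distrC (expR _)) (distrC a) [X in _ * X]addrC; exact: H.
have e : expR (- a) - expR (- b) <= (b - a) * expR (- a).
  have -> : expR (- b) = expR (- a) * expR (a - b) by rewrite -expRD; congr expR; ring.
  have := expR_ge1Dx (a - b); have := expR_ge0 (- a); nra.
rewrite (ger0_norm (_ : 0 <= expR (- a) - expR (- b))); last first.
  by rewrite subr_ge0 ler_expR lerN2.
rewrite distrC (ger0_norm (_ : 0 <= b - a)) ?subr_ge0//.
by apply: (le_trans e); rewrite ler_wpM2l ?subr_ge0// lerDl expR_ge0.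
Qed.

Lemma halfgauss_lipschitz v v' :
  `|halfgauss v - halfgauss v'| <=
  pi / 2 * (N (v - v') * (N v + N v')) * (halfgauss v + halfgauss v').
Proof.
apply: (le_trans (ler_expR_diff _ _)).
rewrite ler_wpM2r ?addr_ge0 ?halfgauss_ge0//.
have p0 : 0 <= pi / 2 :> R by rewrite divr_ge0 ?pi_ge0.
rewrite -mulrBr normrM (ger0_norm p0) ler_wpM2l//.
have -> : dotv v v - dotv v' v' = dotv (v - v') (v + v').
  by rewrite !dotvDl !dotvDr !dotvNl (dotvC v' v); ring.
apply: (le_trans (dotv_le _ _)); rewrite ler_wpM2l ?onenorm_ge0//.
exact: onenormD.
Qed.

Section lipschitz.
Variables (z z' w w' : W) (r : R).
Hypotheses (wr : N w <= r) (wr' : N w' <= r).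
Let s := N z + N z'.
Let v := z - w - z'.
Let v' := z - w' - z'.
Let dl := N (w - w').

Let Nz := onenorm_ge0 z.
Let Nz' := onenorm_ge0 z'.
Let dl0 : 0 <= dl. Proof. exact: onenorm_ge0. Qed.
Let r0 : 0 <= r. Proof. exact: le_trans (onenorm_ge0 w) wr. Qed.

Let Nv : N v <= s + r.
Proof.
have := onenormB (z - w) z'; have := onenormB z w; rewrite -/v /s; have := wr; lra.
Qed.
Let Nv' : N v' <= s + r.
Proof.
have := onenormB (z - w') z'; have := onenormB z w'; rewrite -/v' /s; have := wr'; lra.
Qed.
Let vv' : N (v - v') = dl.
Proof. by rewrite -onenormN /dl; congr onenorm; apply/colP => i; rewrite !mxE; ring. Qed.

Let pair_diff (a b a' b' : W) (ea eb : R) : N (a - a') <= dl -> N (b - b') <= dl ->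
  N b <= eb -> N a' <= ea ->
  `|pairing a b - pairing a' b'| <= dl * (ea + eb).
Proof.
move=> h1 h2 h3 h4.
have -> : pairing a b - pairing a' b' = pairing (a - a') b + pairing a' (b - b').
  by rewrite pairingBl pairingBr; ring.
apply: (le_trans (ler_normD _ _)); rewrite mulrDr addrC; apply: lerD.
  apply: (le_trans (pairing_le _ _)); rewrite mulrC.
  by apply: ler_pM => //; exact: onenorm_ge0.
apply: (le_trans (pairing_le _ _)).
by apply: ler_pM => //; exact: onenorm_ge0.
Qed.

Lemma kernel_phase_lipschitz :
  `|kernel_phase w z z' - kernel_phase w' z z'| <= 8 * pi * (dl * (s + r)).
Proof.
have p0 : 0 < pi :> R by exact: pi_gt0.
have zw : N (z - w) <= s + r by have := onenormB z w; rewrite /s; have := wr; have := Nz'; lra.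
have d1 : N ((z - w) - (z - w')) <= dl.
  by rewrite /dl -onenormN (_ : - (_ - _) = w - w')//; apply/colP => i; rewrite !mxE; ring.
have d0 : N (z' - z') <= dl.
  by rewrite subrr /onenorm big1 ?dl0// => i _; rewrite mxE normr0.
have dv : N (v - v') <= dl by rewrite vv'.
have a1 := @pair_diff w (z - w) w' (z - w') r (s + r) (lexx _) d1 zw wr'.
have a2 := @pair_diff z' v z' v' s (s + r) d0 dv Nv (ltac:(have := Nz; have := Nz'; rewrite /s; lra)).
have a3 := @pair_diff v v v' v' (s + r) (s + r) dv dv Nv Nv'.
rewrite /kernel_phase -/v -/v'.
move: a1 a2 a3; rewrite !ler_norml.
set A := pairing w _; set A' := pairing w' _; set B := pairing z' v; set B' := pairing z' v'.
set C := pairing v v; set C' := pairing v' v'.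
move=> /andP[a1 a1'] /andP[a2 a2'] /andP[a3 a3'].
have -> : 2 * pi * A + 2 * pi * B + pi * C - (2 * pi * A' + 2 * pi * B' + pi * C') =
   pi * (2 * (A - A') + 2 * (B - B') + (C - C')) by ring.
have -> : 8 * pi * (dl * (s + r)) = pi * (8 * (dl * (s + r))) by ring.
rewrite -mulrN !ler_pM2l//.
have dr : 0 <= dl * r by rewrite mulr_ge0.
have ds : 0 <= dl * s by rewrite mulr_ge0// addr_ge0.
by apply/andP; split; nra.
Qed.

(** The phase and the exponent of the Gaussian are quadratic polynomials, so the
    displacement of [w] is multiplied by the size of the points involved. *)
Lemma kernel_lipschitz :
  normc (kernel w (z, z') - kernel w' (z, z')) <=
  @kappa R d * (9 * pi) * (dl * (s + r)) * (halfgauss v + halfgauss v').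
Proof.
have k0 := @kappa_gt0 R d; have p0 : 0 < pi :> R by exact: pi_gt0.
rewrite /kernel /= -/v -/v'.
set a := kernel_phase w z z'; set b := kernel_phase w' z z'.
have -> : (@kappa R d * halfgauss v)%:C * cexpi a - (@kappa R d * halfgauss v')%:C * cexpi b =
   (@kappa R d)%:C * ((halfgauss v)%:C * (cexpi a - cexpi b) +
      (halfgauss v - halfgauss v')%:C * cexpi b).
  have rM (x y : R) : (x * y)%:C = x%:C * y%:C :> R[i] by rewrite rmorphM.
  have rB (x y : R) : (x - y)%:C = x%:C - y%:C :> R[i] by rewrite rmorphB.
  by rewrite !rM rB; ring.
rewrite normcM normcR (ger0_norm (ltW k0)) -!mulrA ler_pM2l//.
apply: (le_trans (le_normcD _ _)); rewrite !normcM normc_cexpi mulr1 !normcR.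
rewrite (ger0_norm (halfgauss_ge0 v)).
have h1 := le_trans (normc_cexpiB a b) kernel_phase_lipschitz.
have h2 := halfgauss_lipschitz v v'.
have hv := halfgauss_ge0 v; have hv' := halfgauss_ge0 v'.
set X := dl * (s + r) in h1 *.
have X0 : 0 <= X by rewrite mulr_ge0// addr_ge0// addr_ge0.
have h3 : N (v - v') * (N v + N v') <= 2 * X.
  rewrite vv' /X mulrCA ler_wpM2l//; have := Nv; have := Nv'; lra.
have h4 : pi / 2 * (N (v - v') * (N v + N v')) * (halfgauss v + halfgauss v') <=
    pi * X * (halfgauss v + halfgauss v').
  rewrite ler_wpM2r ?addr_ge0//; apply: (@le_trans _ _ (pi / 2 * (2 * X))).
    by rewrite ler_wpM2l// divr_ge0// ltW.
  by rewrite mulrA divfK.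
have h5 : halfgauss v * normc (cexpi a - cexpi b) <= 8 * pi * X * halfgauss v.
  by rewrite mulrC ler_wpM2r.
apply: (le_trans (lerD h5 (le_trans h2 h4))).
have pX := mulr_ge0 (mulr_ge0 (ltW p0) X0) hv'.
have -> : 9 * (pi * (dl * ((s + r) * (halfgauss v + halfgauss v')))) =
    8 * pi * X * halfgauss v + pi * X * (halfgauss v + halfgauss v') + 8 * (pi * X * halfgauss v').
  by rewrite /X; ring.
by rewrite lerDl mulr_ge0.
Qed.

End lipschitz.
End kernel_estimates.

Section lattice_sums.
Context {R : realType} {n : nat}.
Local Notation Z := 'cV[int]_n.

Lemma ler_sum_subseq (I : eqType) (s t : seq I) (F : I -> R) : uniq s -> uniq t ->
  {subset s <= t} -> (forall i, 0 <= F i) -> \sum_(i <- s) F i <= \sum_(i <- t) F i.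
Proof.
move=> us ut st F0; rewrite [leRHS](bigID (mem s))/= -[leLHS]addr0 lerD ?sumr_ge0//.
rewrite -[leRHS]big_filter (perm_big [seq i <- t | i \in s])//.
apply: uniq_perm => //; first exact: filter_uniq.
by move=> i; rewrite mem_filter /=; case: (boolP (i \in s)) => //= /st ->.
Qed.

Lemma geometric_two_sided (q : R) (N M : nat) : 0 <= q < 1 ->
  \sum_(x < N) q ^+ `|x%:Z - M%:Z|%N <= 2 / (1 - q).
Proof.
move=> /andP[q0 q1]; have q1' : 0 < 1 - q by rewrite subr_gt0.
have up : (\sum_(x < N) (if (M <= x)%N then q ^+ (x - M)%N else 0)) * (1 - q) <= 1 - q ^+ (N - M)%N.
  elim: N => [|N IH]; first by rewrite big_ord0 mul0r sub0n expr0 subrr.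
  rewrite big_ord_recr/= mulrDl; case: leqP => h.
    rewrite subSn// exprS; have := IH; nra.
  have -> : (N.+1 - M = 0)%N by lia.
  have e : (N - M = 0)%N by lia.
  by rewrite e in IH; rewrite mul0r addr0.
have down : (\sum_(x < N) (if (x <= M)%N then q ^+ (M - x)%N else 0)) * (1 - q) <= q ^+ (M.+1 - N)%N.
  elim: N {up} => [|N IH]; first by rewrite big_ord0 mul0r exprn_ge0.
  rewrite big_ord_recr/= mulrDl subSS; case: leqP => h.
    by move: IH; rewrite subSn// exprS; nra.
  rewrite mul0r addr0; apply: (le_trans IH).
  have -> : (M.+1 - N = 0)%N by lia.
  by have -> : (M - N = 0)%N by lia.
apply: (@le_trans _ _ (\sum_(x < N) ((if (M <= x)%N then q ^+ (x - M)%N else 0) +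
    (if (x <= M)%N then q ^+ (M - x)%N else 0)))).
  apply: ler_sum => x _; case: (leqP M x) => h.
    have -> : `|x%:Z - M%:Z|%N = (x - M)%N by lia.
    by rewrite lerDl; case: ifP => _; rewrite ?exprn_ge0.
  have -> : `|x%:Z - M%:Z|%N = (M - x)%N by lia.
  by rewrite add0r ltnW.
rewrite big_split/= ler_pdivlMr// mulrDl.
have : q ^+ (N - M)%N >= 0 by rewrite exprn_ge0.
have : q ^+ (M.+1 - N)%N <= 1 by rewrite exprn_ile1// ltW.
lra.
Qed.

Lemma sum_pow_norm (q : R) (s : seq Z) : 0 <= q < 1 -> uniq s ->
  \sum_(k <- s) \prod_(i < n) q ^+ `|k i ord0|%N <= (2 / (1 - q)) ^+ n.
Proof.
move=> /[dup] q01 /andP[q0 q1] us.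
pose M := (\max_(k <- s) \max_(i < n) `|k i ord0|%N)%N.
pose pt (j : {ffun 'I_n -> 'I_(M + M).+1}) : Z := \col_i ((j i)%:Z - M%:Z).
pose t := [seq pt j | j <- index_enum {ffun 'I_n -> 'I_(M + M).+1}].
have ut : uniq t.
  rewrite map_inj_uniq ?index_enum_uniq// => j j' /colP e; apply/ffunP => i.
  by apply: val_inj; have := e i; rewrite !mxE => /addIr [].
have st : {subset s <= t}.
  move=> k ks; have kM i : (`|k i ord0| <= M)%N.
    apply: (@leq_trans (\max_(i < n) `|k i ord0|%N)); first exact: (leq_bigmax i).
    by rewrite /M (big_rem k)//= leq_maxl.
  apply/mapP; exists [ffun i => inord `|(k i ord0 + M%:Z)%R|%N] => //; first exact: mem_index_enum.
  apply/colP => i; rewrite mxE ffunE inordK; last by have := kM i; lia.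
  by have := kM i; rewrite -[k i 0]/(k i ord0); lia.
apply: (le_trans (ler_sum_subseq us ut st _)).
  by move=> k; apply: prodr_ge0 => i _; rewrite exprn_ge0.
rewrite big_map.
under eq_bigr do under eq_bigr do rewrite mxE.
rewrite -(bigA_distr_bigA (fun (i : 'I_n) (x : 'I_(M + M).+1) => q ^+ `|x%:Z - M%:Z|%N))/=.
apply: (@le_trans _ _ (\prod_(i < n) (2 / (1 - q)))); last by rewrite prodr_const card_ord.
apply: ler_prod => i _; rewrite geometric_two_sided// andbT.
by apply: sumr_ge0 => x _; rewrite exprn_ge0.
Qed.

Lemma expR_norm1 (b : R) (k : Z) : expR (- (b * norm1 k)) = \prod_(i < n) expR (- b) ^+ `|k i ord0|%N.
Proof.
rewrite /norm1 mulr_sumr -sumrN expR_sum; apply: eq_bigr => i _.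
by rewrite -expRM_natl; congr expR; ring.
Qed.

Lemma exists_min (I : eqType) (s : seq I) (f : I -> R) : s != [::] ->
  exists2 i, i \in s & forall j, j \in s -> f i <= f j.
Proof.
elim: s => // a s IH _; case: (eqVneq s [::]) => [->|/IH[i si im]].
  by exists a; rewrite ?mem_head// => j; rewrite inE => /eqP ->.
case: (leP (f a) (f i)) => h.
  exists a; rewrite ?mem_head// => j; rewrite inE => /orP[/eqP ->//|/im]; exact: le_trans.
exists i; rewrite ?inE ?si ?orbT// => j; rewrite inE => /orP[/eqP ->|/im//]; exact: ltW.
Qed.

Definition lattice_sum_bound (c0 : R) : R := (2 / (1 - expR (- (c0 / 2)))) ^+ n.

(** Compared with a minimiser [k0] of [f] on [s], [f k] is at least half of
    [f k + f k0], which grows with the distance to [k0]; the bound is therefore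
    uniform in [f]. *)
Lemma separated_sum (f : Z -> R) (c0 : R) (s : seq Z) : 0 < c0 -> uniq s ->
  (forall k l, c0 * norm1 (k - l) <= f k + f l) ->
  \sum_(k <- s) expR (- f k) <= lattice_sum_bound c0.
Proof.
move=> c00 us fk; have q01 : 0 <= expR (- (c0 / 2)) < 1.
  by rewrite expR_ge0/= -expR0 ltr_expR oppr_lt0 divr_gt0.
have [->|s0] := eqVneq s [::].
  rewrite big_nil exprn_ge0// divr_ge0// subr_ge0 ltW//; by case/andP: q01.
have [k0 _ km] := exists_min f s0.
apply: (@le_trans _ _ (\sum_(k <- s) expR (- (c0 / 2 * norm1 (k - k0))))).
  rewrite big_seq [leRHS]big_seq; apply: ler_sum => k ks.
  by rewrite ler_expR lerN2; have := fk k k0; have := km k ks; lra.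
rewrite -(big_map (fun k => k - k0) xpredT (fun m => expR (- (c0 / 2 * norm1 m)))).
under eq_bigr do rewrite expR_norm1.
apply: sum_pow_norm => //; rewrite map_inj_uniq//; exact: subIr.
Qed.

End lattice_sums.

(** * Weighted lattice sums and moments *)

Section weighted_sums.
Context {R : realType} {d : nat}.
Local Notation n := (d + d)%N.
Local Notation W := 'cV[R]_(d + d).
Local Notation Z := 'cV[int]_(d + d).
Local Notation N := onenorm.

Definition weighted_const (c0 : R) : R :=
  4 / c0 ^+ 2 * expR (3 * n%:R) * lattice_sum_bound (n := d + d) c0.

Lemma lattice_sum_bound_ge0 (c0 : R) : 0 < c0 -> 0 <= lattice_sum_bound (n := d + d) c0.
Proof.
move=> c00; rewrite exprn_ge0// divr_ge0// subr_ge0.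
by rewrite -expR0 ler_expR oppr_le0 divr_ge0// ltW.
Qed.

(** A lattice point far from [z - z'] is suppressed exponentially, and a nearby one
    has a weight comparable to that of [z] and [z']. *)
Lemma weighted_lattice_sum (L : 'M[R]_(d + d)) (c0 : R) (z z' : W) (s : seq Z) :
  0 < c0 -> c0 <= 1 -> (forall k, c0 * norm1 k <= N (lattice_pt L k)) -> uniq s ->
  \sum_(k <- s) (1 + (N z + N z') + norm1 k) ^+ 2 * halfgauss (z - lattice_pt L k - z')
  <= weighted_const c0 * (1 + (N z + N z')) ^+ 2.
Proof.
move=> c00 c01 Lc us; set t := N z + N z'.
have t0 : 0 <= t by rewrite addr_ge0 ?onenorm_ge0.
have t1 : 0 <= 1 + t by rewrite addr_ge0.
pose x k := N (z - lattice_pt L k - z').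
have x0 k : 0 <= x k by exact: onenorm_ge0.
apply: (@le_trans _ _ (\sum_(k <- s) 4 / c0 ^+ 2 * expR (3 * n%:R) * (1 + t) ^+ 2 * expR (- x k))).
  apply: ler_sum => k _.
  have nk : c0 * norm1 k <= x k + t.
    apply: (le_trans (Lc k)).
    have -> : lattice_pt L k = (z - z') - (z - lattice_pt L k - z').
      by apply/colP => i; rewrite !mxE; ring.
    by apply: (le_trans (onenormB _ _)); rewrite -/(x k) addrC lerD2l onenormB.
  have n0 := norm1_ge0 (R := R) k.
  have h1 : 1 + t + norm1 k <= 2 / c0 * ((1 + t) * (1 + x k)).
    rewrite mulrAC ler_pdivlMr//; have xk := x0 k.
    have := mulr_ge0 t0 xk; have : (1 + t) * c0 <= 1 + t by rewrite ler_piMr.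
    have -> : (1 + t + norm1 k) * c0 = (1 + t) * c0 + c0 * norm1 k by ring.
    nra.
  have h2 : (1 + t + norm1 k) ^+ 2 <= 4 / c0 ^+ 2 * (1 + t) ^+ 2 * expR (2 * x k).
    have h3 : 1 + t + norm1 k <= 2 / c0 * ((1 + t) * expR (x k)).
      apply: (le_trans h1); rewrite ler_wpM2l ?divr_ge0 ?(ltW c00)// ler_wpM2l//.
      exact: expR_ge1Dx.
    have -> : 4 / c0 ^+ 2 * (1 + t) ^+ 2 * expR (2 * x k) = (2 / c0 * ((1 + t) * expR (x k))) ^+ 2.
      rewrite (expRM_natl 2); field; exact: lt0r_neq0.
    have c2 : 0 <= 2 / c0 by rewrite divr_ge0// ltW.
    by rewrite ler_sqr ?nnegrE//; [exact: addr_ge0|exact: (mulr_ge0 c2 (mulr_ge0 t1 (expR_ge0 _)))].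
  apply: (@le_trans _ _ (4 / c0 ^+ 2 * (1 + t) ^+ 2 * expR (2 * x k) *
      (expR (3 * n%:R) * expR (- (3 * x k))))).
    by apply: ler_pM => //; [exact: sqr_ge0|exact: halfgauss_ge0|exact: halfgauss_decay].
  have -> : expR (- x k) = expR (2 * x k) * expR (- (3 * x k)) by rewrite -expRD; congr expR; ring.
  by rewrite le_eqVlt; apply/orP; left; apply/eqP; ring.
rewrite -mulr_sumr /weighted_const mulrAC ler_wpM2r ?sqr_ge0//.
have K0 : 0 <= 4 / c0 ^+ 2 * expR (3 * n%:R) by rewrite mulr_ge0 ?expR_ge0// divr_ge0 ?sqr_ge0.
rewrite ler_wpM2l//; apply: separated_sum => // k l.
have -> : x k + x l = N (z - lattice_pt L l - z') + N (z - lattice_pt L k - z') by rewrite addrC.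
apply: (le_trans (Lc _)); apply: le_trans (onenormB _ _).
rewrite lattice_ptB (_ : _ - _ - (_ - _) = lattice_pt L k - lattice_pt L l)//.
by apply/colP => i; rewrite !mxE; ring.
Qed.

End weighted_sums.

Section moments.
Context {R : realType} {d : nat}.
Local Notation W := 'cV[R]_(d + d).
Local Notation Z := 'cV[int]_(d + d).
Local Notation N := onenorm.
Local Notation C := R[i].
Local Notation phi := (@gaussian R d).
Local Notation lebW := (leb (d + d)).
Local Notation leb2 := (leb (d + d) \x leb (d + d))%E.

Lemma M1_moment (f : 'cV[R]_d -> C) : M1 2 f ->
  [/\ L2 f, cintegrable lebW (stft phi f) &
    lebW.-integrable setT (fun z => ((1 + N z) ^+ 2 * normc (stft phi f z))%:E)].
Proof.
move=> [hf [mf nf]].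
have wE (z : W) : weight 2 z = (1 + N z) ^+ 2.
  by rewrite /weight powR_mulrn// addr_ge0// sumr_ge0.
have w1 (z : W) : 1 <= weight 2 z.
  by rewrite wE exprn_ege1// lerDl onenorm_ge0.
have mw : measurable_fun setT (fun z : W => weight 2 z).
  rewrite (_ : (fun z => _) = (fun z => (1 + N z) ^+ 2)); last exact/funext.
  apply: measurable_funX; apply: measurable_funD => //.
  by apply: measurable_sum => i; apply: measurableT_comp => //; exact: measurable_coord_cV.
have jw : cintegrable lebW (fun z => stft phi f z * Complex (weight 2 z) 0).
  apply: cintegrable_lty => //; move: nf; rewrite /cLnorm Lnorm1.
  by under eq_integral do rewrite gee0_abs ?lee_fin ?normc_ge0//.
have ms : cmeasurable (stft phi f).
  rewrite (_ : stft phi f = fun z => (stft phi f z * Complex (weight 2 z) 0) * ((weight 2 z)^-1)%:C).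
    apply: cmeasurableM => //; apply: cmeasurable_real.
    rewrite (_ : (fun z => _) = (fun z => ((weight 2 z) `^ (-1)))).
      exact: (measurableT_comp (measurable_powR (-1)) mw).
    by apply/funext => z; rewrite powR_inv1// (le_trans ler01).
  apply/funext => z; rewrite -mulrA -[Complex _ _]/((weight 2 z)%:C) -rmorphM/= divff ?mulr1//.
  by rewrite gt_eqF// (lt_le_trans ltr01).
have nE z : normc (stft phi f z * Complex (weight 2 z) 0) = (1 + N z) ^+ 2 * normc (stft phi f z).
  by rewrite normcM -[Complex _ _]/((weight 2 z)%:C) normcR wE mulrC ger0_norm// sqr_ge0.
split => //.
  apply: (cintegrable_le ms jw.2) => z; rewrite nE ler_peMl ?normc_ge0//.
  by rewrite -wE.
by have := jw.2; under eq_fun do rewrite nE.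
Qed.

Section sum_kernels.
Variables (f h : 'cV[R]_d -> C).
Hypotheses (hf : M1 2 f) (hh : M1 2 h).
Let Vf := stft phi f.
Let Vh := stft phi h.

Definition moment_weight (p : W * W) : R :=
  (1 + N p.1) ^+ 2 * normc (stft phi f p.1) * ((1 + N p.2) ^+ 2 * normc (stft phi h p.2)).

Definition moment_mass : R := Rintegral leb2 setT moment_weight.

Lemma moment_weight_ge0 p : 0 <= moment_weight p.
Proof. by apply: mulr_ge0; apply: mulr_ge0; rewrite ?sqr_ge0 ?normc_ge0. Qed.

Lemma moment_mass_ge0 : 0 <= moment_mass.
Proof. by apply: Rintegral_ge0 => p _; exact: moment_weight_ge0. Qed.

Lemma moment_weight_integrable : leb2.-integrable setT (fun p => (moment_weight p)%:E).
Proof.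
have [_ _ jf] := M1_moment hf; have [_ _ jh] := M1_moment hh.
have m1 := measurable_int _ jf; have m2 := measurable_int _ jh.
have j : cintegrable leb2 (fun p => (moment_weight p)%:C).
  apply: (cintegrable_tensor _ jf jh).
    apply: cmeasurable_real; apply: measurable_funM.
      apply: (@measurableT_comp _ _ _ _ _ _ (fun z : W => (1 + N z) ^+ 2 * normc (stft phi f z))); last exact: measurable_fst.
      exact/measurable_EFinP.
    apply: (@measurableT_comp _ _ _ _ _ _ (fun z : W => (1 + N z) ^+ 2 * normc (stft phi h z))); last exact: measurable_snd.
    exact/measurable_EFinP.
  by move=> x y; rewrite normcR ger0_norm ?moment_weight_ge0.
exact: cintegrable_Re j.
Qed.

Lemma sum_Rintegral (s : seq Z) (w : Z -> R) (u : Z -> W * W -> R) :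
  (forall k, leb2.-integrable setT (fun p => (u k p)%:E)) ->
  leb2.-integrable setT (fun p => (\sum_(k <- s) w k * u k p)%:E) /\
  Rintegral leb2 setT (fun p => \sum_(k <- s) w k * u k p) =
  \sum_(k <- s) w k * Rintegral leb2 setT (u k).
Proof.
move=> ju; elim: s => [|k s [IH1 IH2]].
  split; first by under eq_fun do rewrite big_nil; exact: integrable0.
  by rewrite big_nil /Rintegral; under eq_integral do rewrite big_nil; rewrite integral0.
have jk := integrableZl measurableT (w k) (ju k).
split.
  under eq_fun do rewrite big_cons EFinD.
  exact: (integrableD measurableT jk IH1).
under eq_Rintegral do rewrite big_cons.
rewrite RintegralD// big_cons -IH2; congr (_ + _).
exact: (RintegralZl _ measurableT (ju k)).
Qed.

(** A pointwise bound on a sum of kernels, growing quadratically in the two points,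
    is integrable against the two transforms, as these have second moments. *)
Lemma sum_kernels (K : Z -> W * W -> C) (b : Z -> C) (c A : R) (w : Z -> R) (s : seq Z) :
  0 <= c -> 0 <= A -> (forall k, 0 <= w k) ->
  (forall k, cintegrable leb2 (fun p => Vf p.1 * conjc (Vh p.2) * K k p)) ->
  (forall k, c%:C * b k = cintegral leb2 (fun p => Vf p.1 * conjc (Vh p.2) * K k p)) ->
  (forall p, \sum_(k <- s) w k * normc (K k p) <= A * (1 + (N p.1 + N p.2)) ^+ 2) ->
  c * \sum_(k <- s) w k * normc (b k) <= A * moment_mass.
Proof.
move=> c0 A0 w0 jK bK sK.
pose u k p := normc (Vf p.1 * conjc (Vh p.2) * K k p).
have [j e] := @sum_Rintegral s w u (fun k => (jK k).2).
rewrite mulr_sumr; apply: (@le_trans _ _ (\sum_(k <- s) w k * Rintegral leb2 setT (u k))).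
  apply: ler_sum => k _; rewrite mulrCA ler_wpM2l//.
  have -> : c * normc (b k) = normc (c%:C * b k) by rewrite normcM normcR ger0_norm.
  by rewrite bK; exact: le_normc_cintegral.
rewrite -e /moment_mass -RintegralZl//; last exact: moment_weight_integrable.
apply: le_Rintegral => //; first exact: (integrableZl measurableT A moment_weight_integrable).
move=> p _; rewrite /u.
under eq_bigr do rewrite normcM mulrCA.
rewrite -mulr_sumr normcM normcJ.
apply: (@le_trans _ _ (normc (Vf p.1) * normc (Vh p.2) * (A * (1 + (N p.1 + N p.2)) ^+ 2))).
  by rewrite ler_wpM2l ?mulr_ge0 ?normc_ge0.
have N1 := onenorm_ge0 p.1; have N2 := onenorm_ge0 p.2.
have hN : (1 + (N p.1 + N p.2)) ^+ 2 <= ((1 + N p.1) * (1 + N p.2)) ^+ 2.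
  rewrite ler_sqr ?nnegrE ?mulr_ge0 ?addr_ge0//.
  by have := mulr_ge0 N1 N2; nra.
have -> : A * moment_weight p =
    normc (Vf p.1) * normc (Vh p.2) * (A * ((1 + N p.1) * (1 + N p.2)) ^+ 2).
  have aux (x y a e' : R) : A * (x ^+ 2 * a * (y ^+ 2 * e')) = a * e' * (A * (x * y) ^+ 2) by ring.
  exact: aux.
by rewrite ler_wpM2l ?mulr_ge0 ?normc_ge0// ler_wpM2l.
Qed.

End sum_kernels.
End moments.

(** * Uniform bounds near an invertible matrix *)

Section matrix_norm.
Context {R : realType} {n : nat}.
Implicit Types (A : 'M[R]_n) (x : 'cV[R]_n).

Lemma coord_le_enorm x i : `|x i ord0| <= enorm x.
Proof.
rewrite -sqrtr_sqr ler_sqrt ?dotv_ge0// /dotv (bigD1 i)//= -expr2 lerDl.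
by apply: sumr_ge0 => j _; rewrite -expr2 sqr_ge0.
Qed.

Lemma enorm_le_onenorm x : enorm x <= onenorm x.
Proof.
rewrite -(ger0_norm (onenorm_ge0 x)) -sqrtr_sqr ler_sqrt ?sqr_ge0//.
by rewrite (le_trans (ler_norm _))// (le_trans (dotv_le _ _))// expr2.
Qed.

Lemma onenorm_le_enorm x : onenorm x <= n%:R * enorm x.
Proof.
apply: (@le_trans _ _ (\sum_(i < n) enorm x)).
  by apply: ler_sum => i _; exact: coord_le_enorm.
by rewrite sumr_const card_ord mulr_natl.
Qed.

Lemma enorm_mulmx A (e : R) x : 0 <= e -> (forall i j, `|A i j| <= e) ->
  enorm (A *m x) <= n%:R * e * n%:R * enorm x.
Proof.
move=> e0 Ae; apply: (le_trans (enorm_le_onenorm _)).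
apply: (le_trans (onenorm_mulmx _ Ae)).
by rewrite -[leRHS]mulrA ler_wpM2l ?mulr_ge0// onenorm_le_enorm.
Qed.

Lemma mxopnorm_le A (e : R) : 0 <= e -> (forall i j, `|A i j| <= e) ->
  mxopnorm A <= n%:R * e * n%:R.
Proof.
move=> e0 Ae; apply: ge_inf; first by exists 0 => c [].
by split=> [|x]; [rewrite !mulr_ge0|exact: enorm_mulmx].
Qed.

Lemma mxopnorm_ge A (b : R) :
  (forall c, 0 <= c -> (forall x, enorm (A *m x) <= c * enorm x) -> b <= c) ->
  b <= mxopnorm A.
Proof.
move=> h; apply: lb_le_inf; last by move=> c []; exact: h.
pose e := \sum_i \sum_j `|A i j|.
have e0 : 0 <= e by apply: sumr_ge0 => ? _; apply: sumr_ge0.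
have Ae i j : `|A i j| <= e.
  rewrite /e (bigD1 i)//= (bigD1 j)//= -addrA lerDl addr_ge0 ?sumr_ge0// => ? _.
  by apply: sumr_ge0.
exists (n%:R * e * n%:R); split=> [|x]; first by rewrite !mulr_ge0.
exact: enorm_mulmx.
Qed.

Lemma entry_le_mxopnorm A i j : `|A i j| <= mxopnorm A.
Proof.
apply: mxopnorm_ge => c c0 hc; have := hc (delta_mx j 0).
have -> : enorm (delta_mx j 0 : 'cV[R]_n) = 1.
  rewrite /enorm /dotv (bigD1 j)//= mxE !eqxx mulr1 big1 ?addr0 ?sqrtr1// => k kj.
  by rewrite mxE (negbTE kj) mulr0.
rewrite mulr1; apply: le_trans; rewrite -colE; apply: le_trans (coord_le_enorm _ i).
by rewrite mxE.
Qed.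

Lemma mxopnorm_ge0 A : 0 <= mxopnorm A.
Proof. by apply: mxopnorm_ge. Qed.

End matrix_norm.

Section local_bounds.
Context {R : realType} {d : nat}.
Local Notation W := 'cV[R]_(d + d).
Local Notation M := 'M[R]_(d + d).
Local Notation N := onenorm.
Local Notation C := R[i].
Local Notation phi := (@gaussian R d).
Local Notation nn := ((d + d)%:R : R).
Local Notation l1 := (wl1 (fun=> 1)).

Lemma nrm2_gaussian : nrm2 (leb d) phi = kappa (d := d).
Proof.
have e : cinner (leb d) (tfshift 0 phi) phi = (nrm2 (leb d) phi)%:C.
  by rewrite -cinner_self; congr (cinner _ _ _); apply/funext; exact: tfshift0.
have d0 m (v : 'cV[R]_m) : dotv 0 v = 0 by rewrite /dotv big1// => i _; rewrite mxE mul0r.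
have u0 : usubmx (0 : W) = 0 by exact: raddf0.
move: e; rewrite ambiguity_gaussian /pairing u0 /halfgauss !d0 !mulr0 oppr0 expR0 cexpi0 !mulr1.
by case.
Qed.

(** Invertibility gives a lower bound on [L0 k] proportional to [k], and a small
    perturbation loses at most half of it. *)
Lemma separated_near (L0 : M) : L0 \in unitmx ->
  exists r c0 : R, [/\ 0 < r, 0 < c0, c0 <= 1 &
    forall L : M, (forall i j, `|(L - L0) i j| <= r) ->
      forall k, c0 * norm1 k <= N (lattice_pt L k)].
Proof.
move=> uL.
pose e : R := 1 + \sum_i \sum_j `|(invmx L0) i j|.
have e1 : 1 <= e by rewrite lerDl; apply: sumr_ge0 => ? _; apply: sumr_ge0.
have e0 : 0 <= e by exact: le_trans e1.
have Ae i j : `|(invmx L0) i j| <= e.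
  rewrite /e (bigD1 i)//= (bigD1 j)//=; set S := \sum_(k | k != i) _; set T := \sum_(k | k != j) _.
  have : 0 <= S by apply: sumr_ge0 => ? _; apply: sumr_ge0.
  have : 0 <= T by apply: sumr_ge0.
  lra.
pose b : R := (nn + 1) * e.
have b1 : 1 <= b by have : 0 <= nn by []; rewrite /b; nra.
have b0 : 0 < b by exact: lt_le_trans b1.
have n1 : 0 < nn + 1 by rewrite ltr_wpDl.
pose r := (2 * b * (nn + 1))^-1.
have r0 : 0 < r by rewrite invr_gt0 (mulr_gt0 (mulr_gt0 _ b0) n1).
exists r, (2 * b)^-1; split => //; first by rewrite invr_gt0 mulr_gt0.
  by rewrite invf_le1 ?mulr_gt0//; lra.
move=> L Lr k.
have k0 := norm1_ge0 (R := R) k.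
have h1 : norm1 k <= b * N (lattice_pt L0 k).
  rewrite -(onenorm_intr k) -[map_mx _ _](mulKmx uL).
  apply: (le_trans (onenorm_mulmx _ Ae)); rewrite ler_wpM2r ?onenorm_ge0//.
  by rewrite ler_wpM2r// lerDl.
have h2 : N (lattice_pt (L - L0) k) <= nn * r * norm1 k.
  by rewrite -(onenorm_intr k); exact: onenorm_mulmx.
have h3 : N (lattice_pt L0 k) <= N (lattice_pt L k) + N (lattice_pt (L - L0) k).
  apply: le_trans (onenormB _ _); rewrite /lattice_pt mulmxBl opprB addrC subrK.
  by [].
have h4 : nn * r <= (2 * b)^-1.
  rewrite /r invfM mulrCA ler_piMr ?invr_ge0 ?mulr_ge0 ?(ltW b0)//.
  by rewrite ler_pdivrMr// mul1r lerDl.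
have h5 : nn * r * norm1 k <= (2 * b)^-1 * norm1 k by rewrite ler_wpM2r.
have h6 : b^-1 * norm1 k <= N (lattice_pt L0 k) by rewrite mulrC ler_pdivrMr// mulrC.
have h7 : b^-1 = (2 * b)^-1 + (2 * b)^-1 by field; rewrite gt_eqF.
move: h6; rewrite h7 mulrDl; lra.
Qed.

Lemma lpairing_lipschitz (L L' : M) (e B : R) k l : 0 <= e -> 0 <= B ->
  (forall i j, `|(L - L') i j| <= e) -> (forall i j, `|L i j| <= B) ->
  (forall i j, `|L' i j| <= B) ->
  `|lpairing L k l - lpairing L' k l| <= (2 * nn ^+ 2 * B * e) * norm1 k * norm1 l.
Proof.
move=> e0 B0 Le LB LB'.
have k0 := norm1_ge0 (R := R) k; have l0 := norm1_ge0 (R := R) l.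
have ptB (A : M) c m : (forall i j, `|A i j| <= c) -> N (lattice_pt A m) <= nn * c * norm1 m.
  by move=> Ac; rewrite -(onenorm_intr m); exact: onenorm_mulmx.
have dE m : lattice_pt L m - lattice_pt L' m = lattice_pt (L - L') m.
  by rewrite /lattice_pt mulmxBl.
have -> : lpairing L k l - lpairing L' k l =
    pairing (lattice_pt (L - L') k) (lattice_pt L l) +
    pairing (lattice_pt L' k) (lattice_pt (L - L') l).
  by rewrite -!dE pairingBl pairingBr /lpairing; ring.
apply: (le_trans (ler_normD _ _)).
have -> : 2 * nn ^+ 2 * B * e * norm1 k * norm1 l =
  (nn * e * norm1 k) * (nn * B * norm1 l) + (nn * B * norm1 k) * (nn * e * norm1 l) by ring.
apply: lerD; apply: (le_trans (pairing_le _ _)); apply: ler_pM; rewrite ?onenorm_ge0//; exact: ptB.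
Qed.

Section coefficients.
Variables (f h : 'cV[R]_d -> C) (c0 B : R).
Hypotheses (hf : M1 2 f) (hh : M1 2 h).
Hypotheses (c00 : 0 < c0) (c01 : c0 <= 1) (B0 : 0 <= B).

Let admissible (L : M) := (forall k, c0 * norm1 k <= N (lattice_pt L k)) /\
  (forall i j, `|L i j| <= B).

Let A : R := kappa (d := d) * weighted_const (d := d) c0.
Let c : R := (nrm2 (leb d) phi) ^+ 2.

Let cgt0 : 0 < c.
Proof. by rewrite exprn_gt0// nrm2_gaussian kappa_gt0. Qed.

Let wc0 : 0 <= weighted_const (d := d) c0.
Proof.
rewrite /weighted_const mulr_ge0 ?lattice_sum_bound_ge0//.
by rewrite mulr_ge0 ?expR_ge0// divr_ge0 ?sqr_ge0.
Qed.

Let A0 : 0 <= A.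
Proof. by rewrite mulr_ge0// ltW// kappa_gt0. Qed.

Let nB1 : 0 <= 9 * pi * nn * (1 + nn * B).
Proof.
have p0 : 0 <= 9 * pi :> R by rewrite mulr_ge0 ?pi_ge0.
by rewrite (mulr_ge0 (mulr_ge0 p0 (ler0n _ _)))// addr_ge0// mulr_ge0.
Qed.

Definition coef_bound : R := A * moment_mass f h / c.

Lemma coef_bound_ge0 : 0 <= coef_bound.
Proof. by rewrite divr_ge0 ?(ltW cgt0)// mulr_ge0// moment_mass_ge0. Qed.

Lemma module_inner_wl1 L : admissible L ->
  wl1 (fun k => 1 + norm1 k) (module_inner L f h) coef_bound.
Proof.
move=> [Lc LB] s us; have [Lf jf _] := M1_moment hf; have [Lh jh _] := M1_moment hh.
rewrite /coef_bound ler_pdivlMr// mulrC.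
apply: (sum_kernels hf hh (K := fun k => kernel (lattice_pt L k))) => //.
- exact: ltW.
- by move=> k; rewrite addr_ge0 ?norm1_ge0.
- by move=> k; exact: kernel_integrable.
- by move=> k; exact: inner_tfshift_expansion.
move=> [z z'] /=; rewrite /A -mulrA.
apply: le_trans (ler_wpM2l (ltW (@kappa_gt0 R d)) (weighted_lattice_sum z z' c00 c01 Lc us)).
rewrite mulr_sumr; apply: ler_sum => k _; rewrite normc_kernel /= mulrCA.
rewrite ler_wpM2l ?(ltW (@kappa_gt0 R d))// ler_wpM2r ?halfgauss_ge0//.
have k0 := norm1_ge0 (R := R) k; have z0 := onenorm_ge0 z; have z'0 := onenorm_ge0 z'.
set t := N z + N z'; have t0 : 0 <= t by rewrite addr_ge0.
by have := mulr_ge0 t0 k0; have := sqr_ge0 (t + norm1 k); nra.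
Qed.

Definition diff_bound : R :=
  9 * pi * nn * (1 + nn * B) * (A * 2) * moment_mass f h / c.

Lemma diff_bound_ge0 : 0 <= diff_bound.
Proof.
rewrite divr_ge0 ?(ltW cgt0)// mulr_ge0 ?moment_mass_ge0//.
by rewrite (mulr_ge0 nB1)// mulr_ge0.
Qed.

(** In the increment of the kernel, the motion of the lattice point costs a factor
    [norm1 k] and the quadratic phase another factor of this size; together they use
    up the square of the weight. *)
Lemma module_inner_diff L L' (e : R) : 0 <= e -> admissible L -> admissible L' ->
  (forall i j, `|(L - L') i j| <= e) ->
  l1 (fun k => module_inner L f h k - module_inner L' f h k) (diff_bound * e).
Proof.
move=> e0 [Lc LB] [Lc' LB'] Le s us.
have [Lf jf _] := M1_moment hf; have [Lh jh _] := M1_moment hh.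
have ptB (A' : M) c' m : (forall i j, `|A' i j| <= c') -> N (lattice_pt A' m) <= nn * c' * norm1 m.
  by move=> Ac; rewrite -(onenorm_intr m); exact: onenorm_mulmx.
pose D := 9 * pi * nn * (1 + nn * B) * e.
have D0 : 0 <= D by exact: (mulr_ge0 nB1 e0).
have -> : diff_bound * e = D * (A * 2) * moment_mass f h / c by rewrite /diff_bound /D; ring.
rewrite ler_pdivlMr// mulrC.
apply: (sum_kernels hf hh (K := fun k p => kernel (lattice_pt L k) p - kernel (lattice_pt L' k) p)).
- exact: ltW.
- by rewrite mulr_ge0// mulr_ge0.
- by [].
- move=> k; under eq_fun do rewrite mulrBr.
  by apply: cintegrableB; exact: kernel_integrable.
- move=> k; under eq_cintegral do rewrite mulrBr.
  rewrite cintegralB; [|exact: kernel_integrable|exact: kernel_integrable].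
  by rewrite mulrBr; congr (_ - _); exact: inner_tfshift_expansion.
move=> [z z'] /=; set t := N z + N z'.
have z0 := onenorm_ge0 z; have z'0 := onenorm_ge0 z'.
have t0 : 0 <= t by rewrite addr_ge0.
have kp := @kappa_gt0 R d.
have sumb (L1 : M) : (forall k, c0 * norm1 k <= N (lattice_pt L1 k)) ->
    \sum_(k <- s) (1 + t + norm1 k) ^+ 2 * halfgauss (z - lattice_pt L1 k - z')
    <= weighted_const (d := d) c0 * (1 + t) ^+ 2.
  by move=> h1; exact: weighted_lattice_sum.
apply: (@le_trans _ _ (\sum_(k <- s) D * kappa (d := d) *
   ((1 + t + norm1 k) ^+ 2 * halfgauss (z - lattice_pt L k - z') +
    (1 + t + norm1 k) ^+ 2 * halfgauss (z - lattice_pt L' k - z')))); last first.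
  rewrite -mulr_sumr big_split/=.
  have -> : D * (A * 2) * (1 + t) ^+ 2 = D * kappa (d := d) *
     (weighted_const (d := d) c0 * (1 + t) ^+ 2 + weighted_const (d := d) c0 * (1 + t) ^+ 2).
    by rewrite /A; ring.
  by apply: ler_wpM2l; [exact: (mulr_ge0 D0 (ltW kp))|apply: lerD; exact: sumb].
apply: ler_sum => k _; rewrite mul1r.
have k0 := norm1_ge0 (R := R) k.
apply: (le_trans (kernel_lipschitz z z' (ptB _ _ k LB) (ptB _ _ k LB'))).
set g1 := halfgauss _; set g2 := halfgauss _.
have g10 : 0 <= g1 by exact: halfgauss_ge0.
have g20 : 0 <= g2 by exact: halfgauss_ge0.
rewrite -mulrDr [leRHS]mulrA; apply: ler_wpM2r; first exact: addr_ge0.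
have dl : N (lattice_pt L k - lattice_pt L' k) <= nn * e * norm1 k.
  by rewrite /lattice_pt -mulmxBl; exact: ptB.
apply: (@le_trans _ _ (kappa (d := d) * (9 * pi) *
    (nn * e * norm1 k * ((1 + nn * B) * (1 + t + norm1 k))))).
  rewrite ler_wpM2l ?mulr_ge0 ?pi_ge0 ?(ltW kp)//.
  apply: ler_pM; rewrite ?onenorm_ge0//.
    by rewrite addr_ge0 ?mulr_ge0.
  have nB : 0 <= nn * B by rewrite mulr_ge0.
  rewrite -/t; set q := nn * B in nB *; have := mulr_ge0 nB t0; nra.
have -> : kappa (d := d) * (9 * pi) *
    (nn * e * norm1 k * ((1 + nn * B) * (1 + t + norm1 k))) =
    D * kappa (d := d) * (norm1 k * (1 + t + norm1 k)) by rewrite /D; ring.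
apply: ler_wpM2l; first exact: (mulr_ge0 D0 (ltW kp)).
have T0 : 0 <= 1 + t + norm1 k by apply: addr_ge0 => //; apply: addr_ge0.
rewrite expr2; apply: ler_wpM2r => //.
by rewrite lerDr addr_ge0.
Qed.

End coefficients.
End local_bounds.

(** * Hoelder continuity *)

Lemma holder_on_real {R : realType} (V : zmodType) (N : V -> R) (A : set V) (c : R)
    (F : V -> \bar R) (G : V -> R) : 0 < c -> (forall x, 0 <= N x) ->
  (forall x, A x -> F x = (G x)%:E) ->
  (forall x y, A x -> A y -> `|G x - G y| <= c * Num.sqrt (N (x - y))) ->
  holder_on N A 2^-1 F.
Proof.
move=> c0 N0 FG h; exists c => // x y Ax Ay.
by rewrite (FG x Ax) (FG y Ay) lee_fin powR12_sqrt//; exact: h.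
Qed.

Section holder.
Context {R : realType} {d : nat}.
Local Notation M := 'M[R]_(d + d).
Local Notation Z := 'cV[int]_(d + d).
Local Notation C := R[i].
Local Notation nn := ((d + d)%:R : R).
Local Notation l1 := (wl1 (fun=> 1)).

(** For [x] the square root of the distance of two matrices, [N] is the side of the
    averaging window. *)
Lemma exists_nat_inv_le (x : R) : 0 < x -> exists2 N : nat, (0 < N)%N &
  N%:R^-1 <= x /\ x * N%:R <= 1 + x.
Proof.
move=> x0; exists (Num.truncn x^-1).+1 => //.
have xi : 0 <= x^-1 by rewrite invr_ge0 ltW.
split.
  rewrite -[leRHS]invrK lef_pV2 ?posrE ?invr_gt0//.
  exact: ltW (truncnS_gt _).
rewrite -natr1 mulrDr mulr1 lerD2r mulrC -ler_pdivlMr// mul1r.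
by rewrite truncn_le.
Qed.

Lemma sqrtr_lipschitz (a x y : R) : 0 < a -> a <= x -> a <= y ->
  `|Num.sqrt x - Num.sqrt y| <= (Num.sqrt a)^-1 * `|x - y|.
Proof.
move=> a0 ax ay; have s0 : 0 < Num.sqrt a by rewrite sqrtr_gt0.
have x0 : 0 <= x by exact: le_trans (ltW a0) ax.
have y0 : 0 <= y by exact: le_trans (ltW a0) ay.
have -> : x - y = (Num.sqrt x - Num.sqrt y) * (Num.sqrt x + Num.sqrt y).
  by rewrite -subr_sqr !sqr_sqrtr.
rewrite normrM mulrCA ler_peMr//.
rewrite (ger0_norm (addr_ge0 (sqrtr_ge0 _) (sqrtr_ge0 _))).
rewrite mulrC ler_pdivlMr// mul1r; apply: le_trans (_ : Num.sqrt x <= _).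
  by rewrite ler_sqrt.
by rewrite lerDl sqrtr_ge0.
Qed.

Lemma module_inner_null (L : M) (f : 'cV[R]_d -> C) : L2 f -> nrm2 (leb d) f = 0 ->
  module_inner L f f = fun=> 0.
Proof.
move=> hf f0; apply/funext => k; apply: ComplexField.Normc.eq0_normc.
have := cauchy_schwarz hf (L2_tfshift (lattice_pt L k) hf).
rewrite f0 mul0r => cs; apply/eqP; rewrite -sqrf_eq0 eq_le cs sqr_ge0//.
Qed.

Lemma gramnorm0 (L : M) : gramnorm L (fun=> 0) = 0.
Proof.
have z : l1 ((fun=> 0) : Z -> C) 0.
  by move=> s us; rewrite big1// => k _; rewrite ComplexField.Normc.normc0 mulr0.
apply/eqP; rewrite eq_le (gramnorm_ge0 L z) andbT.
exact: gramnorm_le (gram_bound_l1 L z).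
Qed.

Lemma wl1_weaken (w w' : Z -> R) (a : Z -> C) (S : R) : (forall k, w k <= w' k) ->
  wl1 w' a S -> wl1 w a S.
Proof.
move=> ww aS s us; apply: le_trans (aS s us); apply: ler_sum => k _.
by rewrite ler_wpM2r ?normc_ge0.
Qed.

(** One passes from [L'] to [L] by changing first the lattice with the coefficients
    fixed ([gram_bound_lattice]) and then the coefficients ([module_inner_diff]).
    All constants are uniform on the neighbourhood, whose bounded diameter also
    allows the linear error of the second step to be absorbed in a square root. *)
Lemma gramnorm_holder (f h : 'cV[R]_d -> C) (L0 : M) : M1 2 f -> M1 2 h -> L0 \in unitmx ->
  exists r S K : R, [/\ 0 < r, 0 < K,
    forall L, mxopnorm (L - L0) < r -> l1 (module_inner L f h) S &
    forall L L', mxopnorm (L - L0) < r -> mxopnorm (L' - L0) < r ->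
      `|gramnorm L (module_inner L f h) - gramnorm L' (module_inner L' f h)| <=
      K * Num.sqrt (mxopnorm (L - L'))].
Proof.
move=> hf hh uL0; have [r [c0 [r0 c00 c01 sep]]] := separated_near uL0.
pose B : R := r + \sum_i \sum_j `|L0 i j|.
have B0 : 0 <= B.
  by rewrite addr_ge0 ?(ltW r0)//; apply: sumr_ge0 => ? _; apply: sumr_ge0.
have near (L : M) : mxopnorm (L - L0) < r -> forall i j, `|(L - L0) i j| <= r.
  by move=> h1 i j; exact: le_trans (entry_le_mxopnorm _ _ _) (ltW h1).
have adm (L : M) : mxopnorm (L - L0) < r ->
   (forall k, c0 * norm1 k <= onenorm (lattice_pt L k)) /\ (forall i j, `|L i j| <= B).
  move=> h1; split; first exact: sep (near _ h1).
  move=> i j; have -> : L i j = (L - L0) i j + L0 i j by rewrite !mxE subrK.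
  apply: (le_trans (ler_normD _ _)); apply: lerD; first exact: near.
  rewrite (bigD1 i)//= (bigD1 j)//= -addrA lerDl addr_ge0 ?sumr_ge0// => ? _.
  by apply: sumr_ge0.
pose S := coef_bound f h c0; pose T := diff_bound f h c0 B.
have S0 : 0 <= S by exact: coef_bound_ge0.
have T0 : 0 <= T by exact: diff_bound_ge0.
have wS (L : M) : mxopnorm (L - L0) < r -> wl1 (fun k => 1 + norm1 k) (module_inner L f h) S.
  by move=> h1; exact: (module_inner_wl1 hf hh c00 c01 (adm _ h1)).
have lS (L : M) : mxopnorm (L - L0) < r -> l1 (module_inner L f h) S.
  by move=> /wS; apply: wl1_weaken => k; rewrite lerDl norm1_ge0.
have nS (L : M) : mxopnorm (L - L0) < r -> wl1 (fun k => norm1 k) (module_inner L f h) S.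
  by move=> /wS; apply: wl1_weaken => k; rewrite lerDr.
pose c3 : R := 2 * nn ^+ 2 * B.
have c30 : 0 <= c3 by rewrite mulr_ge0// mulr_ge0// sqr_ge0.
pose m : R := nn * (r + r) * nn.
have m0 : 0 <= m by rewrite !mulr_ge0// addr_ge0// ltW.
pose q : R := 2 * pi * c3 * nn.
have q0 : 0 <= q by rewrite mulr_ge0// mulr_ge0// mulr_ge0// pi_ge0.
pose sm := Num.sqrt m.
have sm0 : 0 <= sm by exact: sqrtr_ge0.
pose K : R := 1 + (1 + q * (1 + sm)) * S + T * sm.
have qs : 0 <= 1 + q * (1 + sm) := addr_ge0 ler01 (mulr_ge0 q0 (addr_ge0 ler01 sm0)).
have K1 : 1 <= K.
  by rewrite /K -addrA lerDl; exact: addr_ge0 (mulr_ge0 qs S0) (mulr_ge0 T0 sm0).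
have K0 : 0 < K by exact: lt_le_trans ltr01 K1.
exists r, S, K; split => //.
have small (L L' : M) : mxopnorm (L - L0) < r -> mxopnorm (L' - L0) < r -> mxopnorm (L - L') <= m.
  move=> h1 h2; apply: mxopnorm_le; first by rewrite addr_ge0// ltW.
  move=> i j; have -> : (L - L') i j = (L - L0) i j - (L' - L0) i j by rewrite !mxE; ring.
  by apply: (le_trans (ler_normB _ _)); apply: lerD; exact: near.
have one_sided (L L' : M) (e : R) : mxopnorm (L - L0) < r -> mxopnorm (L' - L0) < r ->
    0 < e -> e <= m -> (forall i j, `|(L - L') i j| <= e) ->
    gramnorm L (module_inner L f h) <= gramnorm L' (module_inner L' f h) + K * Num.sqrt e.
  move=> h1 h2 e0 em Le; have s0 : 0 < Num.sqrt e by rewrite sqrtr_gt0.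
  have ss : Num.sqrt e * Num.sqrt e = e by rewrite -expr2 sqr_sqrtr// ltW.
  have sle : Num.sqrt e <= sm by rewrite /sm ler_sqrt.
  have [N N0 [Ni Ne]] := exists_nat_inv_le s0.
  have g' := gramnorm_bound L' (lS _ h2).
  have Le' i j : `|(L' - L) i j| <= e by rewrite -normrN (_ : - _ = (L - L') i j)// !mxE; ring.
  have gl : gram_bound L (module_inner L' f h)
      (gramnorm L' (module_inner L' f h) + (N%:R^-1 + 2 * pi * (c3 * e) * nn * N%:R) * S).
    apply: gram_bound_lattice (nS _ h2) g' => //; first by rewrite mulr_ge0// ltW.
    move=> k l; exact: (lpairing_lipschitz k l (ltW e0) B0 Le' (adm _ h2).2 (adm _ h1).2).
  have gd := gram_bound_perturb gl (module_inner_diff hf hh c00 c01 B0 (ltW e0) (adm _ h1) (adm _ h2) Le).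
  apply: (le_trans (gramnorm_le gd)); rewrite -addrA lerD2l.
  set x := Num.sqrt e in s0 ss sle Ni Ne *.
  have a1 : N%:R^-1 + 2 * pi * (c3 * e) * nn * N%:R <= x * (1 + q * (1 + sm)).
    have -> : 2 * pi * (c3 * e) * nn * N%:R = q * x * (x * N%:R) by rewrite -ss /q; ring.
    rewrite mulrDr mulr1 lerD// [q * x]mulrC -mulrA ler_wpM2l ?(ltW s0)//.
    rewrite ler_wpM2l//; apply: (le_trans Ne); by rewrite lerD2l.
  have a2 : T * e <= T * sm * x by rewrite -ss mulrA ler_wpM2r ?(ltW s0)// ler_wpM2l.
  have a3 : (N%:R^-1 + 2 * pi * (c3 * e) * nn * N%:R) * S <= x * (1 + q * (1 + sm)) * S.
    by rewrite ler_wpM2r.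
  apply: le_trans (lerD a3 a2) _.
  have -> : K * x = x + (x * (1 + q * (1 + sm)) * S + T * sm * x) by rewrite /K; ring.
  by rewrite lerDr ltW.
move=> L L' h1 h2; have e0 := mxopnorm_ge0 (L - L').
have [e00|ep] := eqVneq (mxopnorm (L - L')) 0.
  have -> : L = L'.
    apply/matrixP => i j; apply/eqP; rewrite -subr_eq0 -normr_le0 -e00.
    by apply: le_trans (entry_le_mxopnorm _ i j); rewrite !mxE.
  by rewrite subrr normr0 mulr_ge0 ?sqrtr_ge0 ?(ltW K0).
have {}ep : 0 < mxopnorm (L - L') by rewrite lt_neqAle eq_sym ep.
have Le := entry_le_mxopnorm (L - L').
have Le' i j : `|(L' - L) i j| <= mxopnorm (L - L').
  by apply: le_trans (Le i j); rewrite -normrN (_ : - _ = (L - L') i j)// !mxE; ring.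
rewrite ler_distl lerBlDr; apply/andP; split.
  exact: one_sided h2 h1 ep (small _ _ h1 h2) Le'.
exact: one_sided h1 h2 ep (small _ _ h1 h2) Le.
Qed.

End holder.

Theorem theorem3p36 (R : realType) (d : nat) (hd : (0 < d)%N)
    (f g : 'cV[R]_d -> R[i]) (hf : M1 2 f) (hg : M1 2 g) :
  locally_holder (@mxopnorm R (d + d)) (@GL R (d + d)) 2^-1
    (fun L => opnorm (integrated L (module_inner L f g))) /\
  ((forall L, GL L ->
      heisenberg_norm L f =
      (opnorm (integrated L (module_inner L f f)) `^ 2^-1)%E) /\
   locally_holder (@mxopnorm R (d + d)) (@GL R (d + d)) 2^-1
    (fun L => heisenberg_norm L f)).
Proof.
have Lg : L2 (@gaussian R d) by exact: L2_gaussian.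
have g0 : 0 < nrm2 (leb d) (@gaussian R d) by rewrite nrm2_gaussian kappa_gt0.
have opE (h : 'cV[R]_d -> R[i]) (L : 'M[R]_(d + d)) (S : R) : GL L -> wl1 (fun=> 1) (module_inner L f h) S ->
    opnorm (integrated L (module_inner L f h)) = (gramnorm L (module_inner L f h))%:E.
  by move=> uL aS; exact: opnorm_integrated uL Lg g0 aS.
have near0 (L : 'M[R]_(d + d)) (r : R) : 0 < r -> mxopnorm (L - L) < r.
  move=> r0; apply: le_lt_trans r0; have := @mxopnorm_le R (d + d) (L - L) 0 (lexx _).
  by rewrite mulr0 mul0r; apply => i j; rewrite !mxE subrr normr0.
have hL2 : L2 f := hf.1.
split; last split.
- move=> L0 uL0; have [r [S [K [r0 K0 lS gh]]]] := gramnorm_holder hf hg uL0.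
  exists r => //; apply: (holder_on_real (G := fun L => gramnorm L (module_inner L f g)) K0).
  + exact: mxopnorm_ge0.
  + by move=> L [uL nL]; exact: opE uL (lS L nL).
  + by move=> L L' [_ nL] [_ nL']; exact: gh.
- move=> L uL; have [r [S [K [r0 K0 lS gh]]]] := gramnorm_holder hf hf uL.
  have aS := lS L (near0 _ _ r0).
  rewrite (opE f L S uL aS) poweR_EFin powR12_sqrt; last exact: gramnorm_ge0 aS.
  exact: heisenberg_gramnorm aS.
move=> L0 uL0; have [r [S [K [r0 K0 lS gh]]]] := gramnorm_holder hf hf uL0.
(* a null function gives the zero form for every lattice *)
have [f0|f0] := eqVneq (nrm2 (leb d) f) 0.
  exists r => //.
  apply: (holder_on_real (G := fun L => Num.sqrt (gramnorm L (module_inner L f f))) ltr01).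
  + exact: mxopnorm_ge0.
  + by move=> L [_ nL]; exact: heisenberg_gramnorm hL2 (lS L nL).
  + move=> L L' _ _; rewrite !(module_inner_null _ hL2 f0) !gramnorm0 subrr normr0.
    by rewrite mul1r sqrtr_ge0.
(* otherwise the square root is taken of numbers bounded away from zero *)
have fp : 0 < nrm2 (leb d) f by rewrite lt_neqAle eq_sym f0 nrm2_ge0.
have sp : 0 < (Num.sqrt (nrm2 (leb d) f))^-1 by rewrite invr_gt0 sqrtr_gt0.
exists r => //.
apply: (holder_on_real (G := fun L => Num.sqrt (gramnorm L (module_inner L f f)))
  (mulr_gt0 sp K0)).
- exact: mxopnorm_ge0.
- by move=> L [_ nL]; exact: heisenberg_gramnorm hL2 (lS L nL).
move=> L L' [_ nL] [_ nL'].
have b1 := gramnorm_ge hL2 (lS L nL); have b2 := gramnorm_ge hL2 (lS L' nL').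
apply: (le_trans (sqrtr_lipschitz fp b1 b2)); rewrite -mulrA.
by apply: ler_wpM2l; [exact: ltW|exact: gh].
Qed.
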